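(* Let $\lambda=0$. Suppose that $n$ is an integer with $1\le n\le q$ such that $F_i(x,y)\equiv0$ and $G_i(x,y)\equiv 0$ for all $i<n$, and such that $G_{n+l}(0,0)=0$ for all $0\le l<n$ and $$G_{2n}(0,0)-F_n(0,0)\big(\partial_yG_n(0,0)+\delta_{n,q}\big)\neq0.$$ Put $$\Delta_n=\big(\partial_xG_n(0,0)\big)^2-4w(0)\Big(\big(\partial_yG_n(0,0)+\delta_{n,q}\big)F_n(0,0)-G_{2n}(0,0)\Big),$$ suppose $\Delta_n>0$, and put $$\nu_+=\frac{1}{2w(0)}\big(\partial_xG_n(0,0)+\sqrt{\Delta_n}\big),\qquad \beta_n=\partial_xF_n(0,0)+\partial_yG_n(0,0)+\frac52\,\delta_{n,q}.$$ Let $x_\ast(t),y_\ast(t)$ be the solution of the perturbed system $$\frac{dx}{dt}=\partial_y H(x,y;\lambda)+F(x,y,t),\qquad \frac{dy}{dt}=-\partial_x H(x,y;\lambda)+G(x,y,t)$$ with asymptotics $$x_\ast(t)=\sum_{k=n}^{\infty}t^{-\frac{k}{q}}x_k,\qquad y_\ast(t)=\sum_{k=n}^{\infty}t^{-\frac{k}{q}}y_k,\qquad t\to\infty,$$ where $x_k,y_k$ are real constants and $x_n=\nu_+$. Then: (i) if $\beta_n<0$, the solution $x_\ast(t),y_\ast(t)$ is stable; (ii) if $\beta_n>3\delta_{n,q}$, the solution $x_\ast(t),y_\ast(t)$ is unstable.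
   Context: Standing setting. The functions $H(x,y;\lambda)$, $F(x,y,t)$, $G(x,y,t)$ are smooth for all $(x,y)\in\mathbb R^2$, $t>0$, $\lambda\in\mathbb R$. The Hamiltonian of the limiting system is $H(x,y;\lambda)=\frac{y^2}{2}+V(x;\lambda)$ with $\partial_xV(x;\lambda)=(x^2-\lambda)w(x)$, where, for some $d_0>0$, $w(x)>0$ for all $(x,\lambda)\in\{|x|<\sqrt\lambda+d_0,\ \lambda\ge 0\}\cup\{|x|<d_0,\ \lambda<0\}$. The perturbations satisfy $F(x,y,t)\to0$ and $G(x,y,t)\to0$ as $t\to\infty$ for $(x,y)$ in any compact subset of $\mathbb R^2$, and have power-law asymptotics $$F(x,y,t)=\sum_{k=1}^\infty t^{-\frac kq}F_k(x,y),\qquad G(x,y,t)=\sum_{k=1}^\infty t^{-\frac kq}G_k(x,y),\qquad t\to\infty,$$ where $q$ is a positive integer and $F_k,G_k$ are smooth functions on $\mathbb R^2$. Infinite series followed by ''$t\to\infty$'' are understood as asymptotic expansions. The coefficients $x_k,y_k$ of the solution's expansion are those obtained by substituting the series into the system and equating the coefficients of equal powers of $t$. $\delta_{n,q}$ is the Kronecker delta. Stability and instability of a solution are understood in the sense of Lyapunov, as $t\to\infty$.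
   Formalization: The expansions of F and G are assumed uniform on compact sets and termwise differentiable once in x and once in y; without this, adding terms like ∓exp(-√t)·tanh(exp(t)(x-x_*(t))) to F, and the analogue to G, changes no coefficient but falsifies (ii) or (i). *)

(* Defs.v *)
(* Stdlib reals with Coquelicot. *)
From Stdlib Require Export Reals.
From Coquelicot Require Export Coquelicot.
Open Scope R_scope.

Definition d1 (f : R -> R -> R -> R) (x y t : R) : R := Derive (fun u => f u y t) x.
Definition d2 (f : R -> R -> R -> R) (x y t : R) : R := Derive (fun u => f x u t) y.
Definition d3 (f : R -> R -> R -> R) (x y t : R) : R := Derive (fun u => f x y u) t.

(* Three-variable analogue of Coquelicot's [ex_diff_n]. *)
Fixpoint ex_diff3_n (f : R -> R -> R -> R) (m : nat) (x y t : R) : Prop :=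
  continuous (fun p : R * R * R => f (fst (fst p)) (snd (fst p)) (snd p)) (x, y, t) /\
  match m with
  | O => True
  | S m' =>
      ex_derive (fun u => f u y t) x /\
      ex_derive (fun u => f x u t) y /\
      ex_derive (fun u => f x y u) t /\
      ex_diff3_n (d1 f) m' x y t /\
      ex_diff3_n (d2 f) m' x y t /\
      ex_diff3_n (d3 f) m' x y t
  end.

(* Used only for open sets [D], where it is membership in C^infinity. *)
Definition smooth3_on (D : R -> R -> R -> Prop) (f : R -> R -> R -> R) : Prop :=
  forall m x y t, D x y t -> ex_diff3_n f m x y t.

Definition smooth2 (f : R -> R -> R) : Prop :=
  forall m x y, ex_diff_n f m x y.

(* A compact subset of the plane is contained in some box |x|, |y| <= M, so
   "uniformly on compact sets" is rendered by "uniformly on every such box". *)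
Definition vanishes_at_infinity (f : R -> R -> R -> R) : Prop :=
  forall M eps, 0 < eps ->
    Rbar_locally p_infty (fun t =>
      forall x y, Rabs x <= M -> Rabs y <= M -> Rabs (f x y t) < eps).

(* f(t) ~ sum_(k >= m) t^(-k/q) a_k.  The remainder is bounded by the first
   omitted power; since this is asked at every order N, it is the same as asking
   for a remainder o(t^(-N/q)).  For N < m the sum is empty. *)
Definition asymp_series (q m : nat) (f : R -> R) (a : nat -> R) : Prop :=
  forall N : nat, exists C : R,
    Rbar_locally p_infty (fun t =>
      Rabs (f t - sum_n_m (fun k => Rpower t (- (INR k / INR q)) * a k) m N)
        <= C * Rpower t (- (INR (S N) / INR q))).

(* f(x,y,t) ~ sum_(k >= 1) t^(-k/q) f_k(x,y), uniformly on compact sets. *)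
Definition unif_asymp_series (q : nat) (f : R -> R -> R -> R) (fk : nat -> R -> R -> R)
    : Prop :=
  forall (M : R) (N : nat), exists C : R,
    Rbar_locally p_infty (fun t =>
      forall x y, Rabs x <= M -> Rabs y <= M ->
        Rabs (f x y t
              - sum_n_m (fun k => Rpower t (- (INR k / INR q)) * fk k x y) 1 N)
          <= C * Rpower t (- (INR (S N) / INR q))).

(* The expansion of a perturbation may be differentiated termwise, once, in x
   and in y.  This cannot be dropped: adding
     - exp(- sqrt t) * tanh(exp t * (x - xs t))
   to F, and its analogue in y to G, leaves the first clause intact and keeps (xs, ys)
   a solution, yet makes it asymptotically stable. *)
Definition power_asymptotics (q : nat) (f : R -> R -> R -> R) (fk : nat -> R -> R -> R)
    : Prop :=
  unif_asymp_series q f fk /\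
  unif_asymp_series q (d1 f) (fun k x y => Derive (fun u => fk k u y) x) /\
  unif_asymp_series q (d2 f) (fun k x y => Derive (fun u => fk k x u) y).

(* Solution on [t0, +oo).  Asking for a two-sided derivative at t0 is harmless:
   [x] and [y] are total, and a solution on the half-line can be continued
   affinely to the left of t0. *)
Definition is_solution (H F G : R -> R -> R -> R) (lam t0 : R) (x y : R -> R) : Prop :=
  forall t, t0 <= t ->
    is_derive x t (d2 H (x t) (y t) lam + F (x t) (y t) t) /\
    is_derive y t (- d1 H (x t) (y t) lam + G (x t) (y t) t).

(* Lyapunov stability of (xs, ys) for perturbations of the data at time t0:
   solutions starting close exist on [t0, +oo) and stay close. *)
Definition lyapunov_stable (H F G : R -> R -> R -> R) (lam t0 : R) (xs ys : R -> R)
    : Prop :=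
  forall eps, 0 < eps -> exists delta, 0 < delta /\
    forall a b, Rabs (a - xs t0) < delta -> Rabs (b - ys t0) < delta ->
      (exists x y, is_solution H F G lam t0 x y /\ x t0 = a /\ y t0 = b) /\
      (forall x y, is_solution H F G lam t0 x y -> x t0 = a -> y t0 = b ->
         forall t, t0 <= t -> Rabs (x t - xs t) < eps /\ Rabs (y t - ys t) < eps).

Definition kron (n q : nat) : R := if Nat.eq_dec n q then 1 else 0.

(* Main.v *)
Require Import Defs.
From Stdlib Require Import Lra Lia List Classical ClassicalEpsilon.

(** At [lambda = 0] the equations read [x' = y + F], [y' = - x^2 w(x) + G].  Write
    [u = x - xs], [v = y - ys] for the deviation from the given solution, [s = n/q],
    and let [A], [D] be the values at the origin of the x-derivative of [F_n] and the
    y-derivative of [G_n].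

    Stability.  As [xs ~ nu_+ t^(-s)], the deviation is an oscillator with restoring
    force [- t^(-s) sqrt(Delta) u - w(0) u^2] and damping rates [t^(-s) A] and
    [t^(-s) D].  The quadratic part of the force limits the region of stability to
    [|u| < const t^(-s)], so one rescales [X = t^s u], [Y = t^(3s/2) v]; in these
    variables the force is of order [t^(-s/2)] and the damping of order [t^(-s)]
    ([rescaled_increments]).  The rescaling adds [s/t] and [3s/(2t)] to the two
    damping rates, which is of order [t^(-s)] precisely if [n = q]
    ([dilation_rate]).  The averaged rate is then half of
    [A + D + (5/2) delta_{n,q} = beta_n].  The energy of the cubic potential, with a
    mixed term [c t^(-s/2) X Y] that performs the averaging, has derivative about
    [t^(-s) (beta_n / 2) (Y^2 + sqrt(Delta) X^2)] ([energy_decay]), so it decreases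
    if [beta_n < 0] and keeps small deviations small ([stable_tail]).  Only finitely
    many terms of the expansions enter, those with [n <= k < 2n]; all others, and the
    variation of the coefficients over a ball of radius [const t^(-s)], are
    [O(t^(-2s))] and hence below the damping.  Up to the time from which this works,
    Gronwall's inequality suffices ([close_on_compact]); solutions exist globally
    because they never leave a square, outside which the field can be truncated
    ([clamped_solution]).

    Instability.  If [beta_n > 3 delta_{n,q}], then [A + D > 0], and the divergence
    of the field near the origin is at least [const t^(-s)], which is not integrable
    as [s <= 1].  By Liouville's theorem the area of a set of trajectories that stay
    near the origin tends to infinity.  If the solution were stable, a small square of
    initial data would remain in a small square for ever, a contradiction
    ([unstable_of_positive_trace]).  The area argument is carried out on functions
    transported by discrete steps, each of them a composition of two shears
    ([area_growth]), so that Fubini's theorem and one-dimensional substitution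
    are enough. *)

(** * Calculus on boxes *)

Definition cont2 (f : R -> R -> R) (x y : R) : Prop :=
  continuous (fun p : R * R => f (fst p) (snd p)) (x, y).

Definition cont3 (f : R -> R -> R -> R) (x y t : R) : Prop :=
  continuous (fun p : R * R * R => f (fst (fst p)) (snd (fst p)) (snd p)) (x, y, t).

Lemma cont2_comp {U : UniformSpace} (f : R -> R -> R) (a b : U -> R) (z : U) :
  continuous a z -> continuous b z -> cont2 f (a z) (b z) ->
  continuous (fun p => f (a p) (b p)) z.
Proof. intros; apply (continuous_comp_2 a b f z); assumption. Qed.

Lemma cont3_comp {U : UniformSpace} (f : R -> R -> R -> R) (a b c : U -> R) (z : U) :
  continuous a z -> continuous b z -> continuous c z -> cont3 f (a z) (b z) (c z) ->
  continuous (fun p => f (a p) (b p) (c p)) z.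
Proof.
  intros Ha Hb Hc Hf.
  apply (continuous_comp_2 (fun p => (a p, b p)) c (fun ab c => f (fst ab) (snd ab) c) z).
  - apply (continuous_comp_2 a b (fun a b => (a, b)) z); [exact Ha | exact Hb |].
    apply continuous_ext with (f := fun x : R * R => x);
      [intros [? ?]; reflexivity | apply continuous_id].
  - exact Hc.
  - exact Hf.
Qed.

Lemma continuous_continuity_2d (f : R -> R -> R) (x y : R) :
  cont2 f x y <-> continuity_2d_pt f x y.
Proof. symmetry. apply continuity_2d_pt_filterlim. Qed.

(** The partial derivatives are carried along explicitly, so that adding the
    Hamiltonian part to a perturbation does not require rewriting under
    [Derive]. *)
Record C1field (f fx fy ft : R -> R -> R -> R) : Prop := {
  C1_dx : forall x y t, 0 < t -> is_derive (fun u => f u y t) x (fx x y t);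
  C1_dy : forall x y t, 0 < t -> is_derive (fun u => f x u t) y (fy x y t);
  C1_dt : forall x y t, 0 < t -> is_derive (fun u => f x y u) t (ft x y t);
  C1_c : forall x y t, 0 < t -> cont3 f x y t;
  C1_cx : forall x y t, 0 < t -> cont3 fx x y t;
  C1_cy : forall x y t, 0 < t -> cont3 fy x y t;
  C1_ct : forall x y t, 0 < t -> cont3 ft x y t }.

Lemma smooth3_C1field (F : R -> R -> R -> R) :
  smooth3_on (fun _ _ t => 0 < t) F -> C1field F (d1 F) (d2 F) (d3 F).
Proof.
  intros HF.
  assert (H := fun x y t Ht => HF 1%nat x y t Ht).
  split; intros x y t Ht; destruct (H x y t Ht) as (Hc & H1 & H2 & H3 & [H4 _] & [H5 _] & [H6 _]);
    try assumption; apply Derive_correct; assumption.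
Qed.

(** Heine-Borel: a neighbourhood of every point of the box carries a bound, and
    finitely many of these cover it. *)
Lemma bounded_on_box (f : R -> R -> R -> R) (M a b : R) :
  (forall x y t, Rabs x <= M -> Rabs y <= M -> a <= t <= b -> cont3 f x y t) ->
  exists K, 0 <= K /\ forall x y t, Rabs x <= M -> Rabs y <= M -> a <= t <= b ->
    Rabs (f x y t) <= K.
Proof.
  intros Hc.
  pose (inbox := fun p : Compactness.Tn 3 R =>
     Rabs (fst p) <= M /\ Rabs (fst (snd p)) <= M /\ a <= fst (snd (snd p)) <= b).
  assert (Hd : forall p : Compactness.Tn 3 R, exists d : posreal, inbox p ->
     forall x y t, Rabs (x - fst p) < d -> Rabs (y - fst (snd p)) < d ->
       Rabs (t - fst (snd (snd p))) < d ->
       Rabs (f x y t) < Rabs (f (fst p) (fst (snd p)) (fst (snd (snd p)))) + 1).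
  { intros p. destruct (classic (inbox p)) as [Hp|Hp].
    2: { exists (mkposreal 1 Rlt_0_1). intros; contradiction. }
    destruct p as [x0 [y0 [t0 []]]]. destruct Hp as (H1 & H2 & H3). simpl in *.
    specialize (Hc _ _ _ H1 H2 H3).
    assert (Hl := proj1 (filterlim_locally _ _) Hc (mkposreal 1 Rlt_0_1)).
    destruct Hl as [d Hl]. exists d. intros _ x y t Hx Hy Ht.
    specialize (Hl (x, y, t)). simpl in Hl.
    assert (Rabs (f x y t - f x0 y0 t0) < 1).
    { apply Hl. split; [split|]; assumption. }
    replace (f x y t) with (f x0 y0 t0 + (f x y t - f x0 y0 t0)) by ring.
    eapply Rle_lt_trans; [apply Rabs_triang|]. lra. }
  pose (delta := fun p => proj1_sig (constructive_indefinite_description _ (Hd p))).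
  assert (Hdelta : forall p, inbox p ->
     forall x y t, Rabs (x - fst p) < delta p -> Rabs (y - fst (snd p)) < delta p ->
       Rabs (t - fst (snd (snd p))) < delta p ->
       Rabs (f x y t) < Rabs (f (fst p) (fst (snd p)) (fst (snd (snd p)))) + 1).
  { intros p. unfold delta. destruct constructive_indefinite_description as [d Hd']. exact Hd'. }
  apply NNPP. intros Hn.
  apply (compactness_list 3 (- M, (- M, (a, tt))) (M, (M, (b, tt))) delta).
  intros [l Hl]. apply Hn.
  pose (g := fun p : Compactness.Tn 3 R =>
     Rabs (f (fst p) (fst (snd p)) (fst (snd (snd p)))) + 1).
  assert (Hmax : forall l, exists K, 0 <= K /\ forall p, In p l -> g p <= K).
  { clear. induction l as [|p l [K [HK IH]]].
    - exists 0. split; [lra|]. intros p [].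
    - exists (Rmax (g p) K). split.
      + eapply Rle_trans; [exact HK | apply Rmax_r].
      + intros p' [<-|Hp']; [apply Rmax_l|].
        eapply Rle_trans; [apply IH, Hp' | apply Rmax_r]. }
  destruct (Hmax l) as [K [HK0 HK]]. exists K. split; [exact HK0|].
  intros x y t Hx Hy Ht.
  apply Rabs_le_between in Hx. apply Rabs_le_between in Hy.
  destruct (Hl (x, (y, (t, tt)))) as (p & Hin & Hb & Hclose).
  { simpl. repeat split; lra. }
  specialize (HK p Hin). unfold g in HK.
  specialize (Hdelta p).
  destruct p as [x0 [y0 [s0 []]]]. simpl in *.
  destruct Hb as (Hb1 & Hb2 & Hb3 & _). destruct Hclose as (Hc1 & Hc2 & Hc3 & _).
  left. eapply Rlt_le_trans; [|exact HK]. apply Hdelta; try assumption.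
  repeat split; simpl; try lra; apply Rabs_le_between; lra.
Qed.

(** The mean value theorem without orienting the interval; the hypothesis may be
    restricted to any interval containing both points. *)
Lemma mean_value (f df : R -> R) (lo hi a b : R) :
  (forall x, lo <= x <= hi -> is_derive f x (df x)) ->
  lo <= a <= hi -> lo <= b <= hi ->
  exists c, lo <= c <= hi /\ Rmin a b <= c <= Rmax a b /\ f b - f a = df c * (b - a).
Proof.
  intros Hd Ha Hb.
  assert (Hin : forall x, Rmin a b <= x <= Rmax a b -> lo <= x <= hi).
  { intros x. unfold Rmin, Rmax. destruct (Rle_dec a b); lra. }
  destruct (MVT_gen f a b df) as (c & Hc & E).
  - intros x Hx. apply Hd, Hin. lra.
  - intros x Hx. apply continuity_pt_filterlim, (ex_derive_continuous f).
    eexists. apply Hd, Hin, Hx.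
  - exists c. auto.
Qed.

Lemma lipschitz_on_box (f fx fy ft : R -> R -> R -> R) (M a b : R) :
  C1field f fx fy ft -> 0 < a ->
  exists L, 0 <= L /\ forall x y t x' y' t',
    Rabs x <= M -> Rabs y <= M -> a <= t <= b ->
    Rabs x' <= M -> Rabs y' <= M -> a <= t' <= b ->
    Rabs (f x y t - f x' y' t') <= L * (Rabs (x - x') + Rabs (y - y') + Rabs (t - t')).
Proof.
  intros Hf Ha.
  destruct (bounded_on_box fx M a b) as [K1 [HK1 B1]].
  { intros. apply (C1_cx _ _ _ _ Hf). lra. }
  destruct (bounded_on_box fy M a b) as [K2 [HK2 B2]].
  { intros. apply (C1_cy _ _ _ _ Hf). lra. }
  destruct (bounded_on_box ft M a b) as [K3 [HK3 B3]].
  { intros. apply (C1_ct _ _ _ _ Hf). lra. }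
  exists (K1 + K2 + K3). split; [lra|].
  intros x y t x' y' t' Hx Hy Ht Hx' Hy' Ht'.
  assert (E1 : Rabs (f x y t - f x' y t) <= K1 * Rabs (x - x')).
  { apply Rabs_le_between in Hx. apply Rabs_le_between in Hx'.
    destruct (mean_value (fun u => f u y t) (fun u => fx u y t) (- M) M x' x)
      as (c & Hc & _ & E); try assumption.
    { intros. apply (C1_dx _ _ _ _ Hf). lra. }
    cbv beta in E. rewrite E, Rabs_mult.
    apply Rmult_le_compat_r; [apply Rabs_pos|].
    apply B1; try assumption. apply Rabs_le_between; assumption. }
  assert (E2 : Rabs (f x' y t - f x' y' t) <= K2 * Rabs (y - y')).
  { apply Rabs_le_between in Hy. apply Rabs_le_between in Hy'.
    destruct (mean_value (fun u => f x' u t) (fun u => fy x' u t) (- M) M y' y)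
      as (c & Hc & _ & E); try assumption.
    { intros. apply (C1_dy _ _ _ _ Hf). lra. }
    cbv beta in E. rewrite E, Rabs_mult.
    apply Rmult_le_compat_r; [apply Rabs_pos|].
    apply B2; try assumption. apply Rabs_le_between; assumption. }
  assert (E3 : Rabs (f x' y' t - f x' y' t') <= K3 * Rabs (t - t')).
  { destruct (mean_value (fun u => f x' y' u) (fun u => ft x' y' u) a b t' t)
      as (c & Hc & _ & E); try assumption.
    { intros. apply (C1_dt _ _ _ _ Hf). lra. }
    cbv beta in E. rewrite E, Rabs_mult.
    apply Rmult_le_compat_r; [apply Rabs_pos|].
    apply B3; assumption. }
  replace (f x y t - f x' y' t')
    with ((f x y t - f x' y t) + ((f x' y t - f x' y' t) + (f x' y' t - f x' y' t'))) by ring.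
  eapply Rle_trans; [apply Rabs_triang|].
  assert (H := Rabs_triang (f x' y t - f x' y' t) (f x' y' t - f x' y' t')).
  assert (P1 := Rabs_pos (x - x')). assert (P2 := Rabs_pos (y - y')).
  assert (P3 := Rabs_pos (t - t')).
  nra.
Qed.

Lemma nonincreasing_of_derive (f df : R -> R) (a b : R) :
  a <= b -> (forall t, a <= t <= b -> is_derive f t (df t)) ->
  (forall t, a <= t <= b -> df t <= 0) -> f b <= f a.
Proof.
  intros Hab Hd Hn.
  destruct (mean_value f df a b a b) as (c & Hc & _ & E); try lra.
  { exact Hd. }
  assert (df c <= 0) by (apply Hn; lra). nra.
Qed.

(** The continuity argument behind every estimate below whose derivation requires
    its own conclusion. *)
Lemma first_crossing (r : R -> R) (a t c : R) : a <= t ->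
  (forall s, a <= s <= t -> continuous r s) -> r a < c ->
  (forall s, a <= s <= t -> (forall u, a <= u <= s -> r u <= c) -> r s < c) ->
  r t < c.
Proof.
  intros Ht Hc Ha Hstep.
  destruct (Rlt_dec (r t) c) as [|Hn]; [assumption|exfalso].
  (* [T] is the supremum of the times up to which the level has not been crossed. *)
  pose (E := fun s => a <= s <= t /\ forall u, a <= u <= s -> r u <= c).
  destruct (completeness E) as [T [HT1 HT2]].
  { exists t. intros s [[_ Hs] _]. exact Hs. }
  { exists a. split; [lra|]. intros u Hu. replace u with a by lra. lra. }
  assert (HaT : a <= T).
  { apply HT1. split; [lra|]. intros u Hu. replace u with a by lra. lra. }
  assert (HTt : T <= t).
  { apply HT2. intros s [[_ Hs] _]. exact Hs. }
  assert (Hbefore : forall s, a <= s < T -> r s <= c).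
  { intros s Hs. apply NNPP. intros Hns.
    assert (T <= s).
    { apply HT2. intros s' [Hs' Hr]. apply Rnot_lt_le. intros Hlt.
      apply Hns, Hr. lra. }
    lra. }
  assert (HTc : r T <= c).
  { apply Rnot_lt_le. intros Hgt.
    destruct (Req_dec a T) as [->|Hne]; [lra|].
    destruct (proj1 (filterlim_locally _ _) (Hc T (conj HaT HTt)) (mkposreal (r T - c) ltac:(lra)))
      as [d Hd].
    assert (Hdp := cond_pos d).
    assert (Hs := Rmax_l a (T - d / 2)). assert (Hs' := Rmax_r a (T - d / 2)).
    assert (Hlt : Rmax a (T - d / 2) < T) by (apply Rmax_lub_lt; lra).
    set (s := Rmax a (T - d / 2)) in *.
    specialize (Hd s). simpl in Hd.
    assert (B : Rabs (r s - r T) < r T - c).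
    { apply Hd. change (Rabs (s - T) < d). apply Rabs_def1; lra. }
    apply Rabs_def2 in B. specialize (Hbefore s ltac:(lra)). lra. }
  assert (HTlt : r T < c).
  { apply Hstep; [lra|]. intros s Hs.
    destruct (Req_dec s T) as [->|]; [exact HTc | apply Hbefore; lra]. }
  destruct (proj1 (filterlim_locally _ _) (Hc T (conj HaT HTt)) (mkposreal (c - r T) ltac:(lra)))
    as [d Hd].
  assert (Hdp := cond_pos d).
  assert (HTt' : T < t) by (destruct (Req_dec T t) as [<-|]; lra).
  assert (Hm : T < Rmin t (T + d / 2)) by (apply Rmin_glb_lt; lra).
  assert (Hm1 := Rmin_l t (T + d / 2)). assert (Hm2 := Rmin_r t (T + d / 2)).
  set (s := Rmin t (T + d / 2)) in *.
  assert (s <= T).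
  { apply HT1. split; [lra|]. intros u Hu.
    destruct (Rlt_dec u T); [apply Hbefore; lra|].
    assert (B : Rabs (r u - r T) < c - r T).
    { apply (Hd u). change (Rabs (u - T) < d). apply Rabs_def1; lra. }
    apply Rabs_def2 in B. lra. }
  lra.
Qed.

(** [r e^(-K t)] is nonincreasing. *)
Lemma gronwall (r dr : R -> R) (K a b : R) :
  a <= b -> (forall t, a <= t <= b -> is_derive r t (dr t)) ->
  (forall t, a <= t <= b -> dr t <= K * r t) ->
  r b <= r a * exp (K * (b - a)).
Proof.
  intros Hab Hd Hle.
  assert (H : r b * exp (- K * b) <= r a * exp (- K * a)).
  { apply (nonincreasing_of_derive (fun t => r t * exp (- K * t))
             (fun t => (dr t - K * r t) * exp (- K * t))); [exact Hab| |].
    - intros t Ht. specialize (Hd t Ht).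
      auto_derive; [exists (dr t); exact Hd|].
      replace (Derive _ t) with (dr t) by (symmetry; exact (is_derive_unique _ _ _ Hd)). ring.
    - intros t Ht. specialize (Hle t Ht). assert (P := exp_pos (- K * t)). nra. }
  replace (exp (K * (b - a))) with (exp (- K * a) * exp (K * b))
    by (rewrite <- exp_plus; f_equal; ring).
  assert (E : exp (- K * b) * exp (K * b) = 1).
  { rewrite <- exp_plus. replace (- K * b + K * b) with 0 by ring. apply exp_0. }
  assert (P := exp_pos (K * b)).
  replace (r b) with (r b * exp (- K * b) * exp (K * b)) by (rewrite Rmult_assoc, E; ring).
  nra.
Qed.

(** * Iterated integrals over a square *)

Lemma cont2_x (f : R -> R -> R) x y : cont2 f x y -> continuous (fun u => f u y) x.
Proof.
  intros H. apply (cont2_comp f (fun u => u) (fun _ => y) x);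
    [apply continuous_id | apply continuous_const | exact H].
Qed.

Lemma cont2_swap (f : R -> R -> R) x y : cont2 f x y -> cont2 (fun a b => f b a) y x.
Proof.
  intros H.
  apply (cont2_comp f (fun p : R * R => snd p) (fun p => fst p) (y, x));
    [apply continuous_snd | apply continuous_fst | exact H].
Qed.

Lemma ex_RInt_cont (f : R -> R) a b : (forall x, continuous f x) -> ex_RInt f a b.
Proof. intros H. apply (@ex_RInt_continuous R_CompleteNormedModule). intros; apply H. Qed.

Lemma continuous_RInt_param (f : R -> R -> R) (a b y0 : R) :
  a <= b -> (forall x y, cont2 f x y) ->
  continuous (fun y => RInt (fun x => f x y) a b) y0.
Proof.
  intros Hab Hf.
  apply filterlim_locally. intros eps.
  assert (He : 0 < eps / (b - a + 1)).
  { apply Rdiv_lt_0_compat; [apply cond_pos | lra]. }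
  destruct (uniform_continuity_2d_1d f a b y0) with (eps := mkposreal _ He) as [d Hd].
  { intros. apply continuous_continuity_2d, Hf. }
  exists d. intros y Hy. change (Rabs (y - y0) < d) in Hy.
  assert (Hd0 := cond_pos d).
  change (Rabs (RInt (fun x => f x y) a b - RInt (fun x => f x y0) a b) < eps).
  assert (Hex : forall z, ex_RInt (fun x => f x z) a b).
  { intros z. apply ex_RInt_cont. intros x. apply cont2_x, Hf. }
  rewrite <- (RInt_minus (V := R_CompleteNormedModule)) by apply Hex.
  eapply Rle_lt_trans.
  - apply (abs_RInt_le_const (fun x => minus (f x y) (f x y0)) a b (eps / (b - a + 1)) Hab).
    + apply (@ex_RInt_minus R_NormedModule); apply Hex.
    + intros x Hx. left. apply Rabs_def2 in Hy. apply (Hd x y0 x y); try lra.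
      replace (x - x) with 0 by ring. rewrite Rabs_R0. exact Hd0.
  - assert (E : eps = eps / (b - a + 1) * (b - a + 1) :> R) by (field; lra).
    rewrite E at 2. nra.
Qed.

(** Both iterated integrals have the same derivative with respect to the upper
    limit [b]. *)
Lemma fubini (f : R -> R -> R) (a b c d : R) :
  a <= b -> c <= d -> (forall x y, cont2 f x y) ->
  RInt (fun y => RInt (fun x => f x y) a b) c d =
  RInt (fun x => RInt (fun y => f x y) c d) a b.
Proof.
  intros Hab Hcd Hf.
  assert (Hcx : forall x y, continuous (fun x => f x y) x) by (intros; apply cont2_x, Hf).
  assert (Hin : forall x, continuous (fun x => RInt (fun y => f x y) c d) x).
  { intros x. apply (continuous_RInt_param (fun y x => f x y)); [exact Hcd|].
    intros; apply cont2_swap, Hf. }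
  assert (Hprim : forall u y, is_derive (fun u => RInt (fun x => f x y) a u) u (f u y)).
  { intros u y. apply (is_derive_RInt (fun x => f x y) _ a).
    - apply filter_forall. intros v. apply (@RInt_correct R_CompleteNormedModule), ex_RInt_cont, (fun x => Hcx x y).
    - apply Hcx. }
  pose (D := fun u => RInt (fun y => RInt (fun x => f x y) a u) c d
                      - RInt (fun x => RInt (fun y => f x y) c d) a u).
  assert (HD : forall u, a <= u <= b -> is_derive D u 0).
  { intros u _. unfold D.
    replace 0 with (minus (RInt (fun y => f u y) c d) (RInt (fun y => f u y) c d))
      by (unfold minus, plus, opp; simpl; ring).
    apply (is_derive_minus (fun u => RInt (fun y => RInt (fun x => f x y) a u) c d)).
    - replace (RInt (fun y => f u y) c d)
        with (RInt (fun y => Derive (fun u => RInt (fun x => f x y) a u) u) c d)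
        by (apply RInt_ext; intros y _; apply is_derive_unique, Hprim).
      apply (is_derive_RInt_param (fun u y => RInt (fun x => f x y) a u) c d u).
      + apply filter_forall. intros v y _. eexists. apply Hprim.
      + intros y _. apply (continuity_2d_pt_ext f).
        * intros x z. symmetry. apply is_derive_unique, Hprim.
        * apply continuous_continuity_2d, Hf.
      + (* continuity in [y] also for upper limits below [a] *)
        apply filter_forall. intros v. apply ex_RInt_cont. intros y.
        destruct (Rle_dec a v) as [H|H].
        * apply (continuous_RInt_param f); assumption.
        * apply continuous_ext with (f := fun y => opp (RInt (fun x => f x y) v a)).
          { intros z. apply (opp_RInt_swap (V := R_CompleteNormedModule)).
            apply ex_RInt_cont, (fun x => Hcx x z). }
          apply (continuous_opp (V := R_NormedModule)), (continuous_RInt_param f);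
            [lra | assumption].
    - apply (is_derive_RInt (fun x => RInt (fun y => f x y) c d) _ a).
      + apply filter_forall. intros v. apply (@RInt_correct R_CompleteNormedModule), ex_RInt_cont, Hin.
      + apply Hin. }
  destruct (mean_value D (fun _ => 0) a b a b HD) as (z & _ & _ & E); try lra.
  assert (E0 : D a = 0).
  { unfold D. rewrite (RInt_point a).
    rewrite (RInt_ext _ (fun _ => 0)).
    - rewrite RInt_const. unfold scal, zero; simpl; unfold mult; simpl; ring.
    - intros y _. rewrite (RInt_point a (fun x => f x y)). reflexivity. }
  rewrite E0 in E. unfold D in E. lra.
Qed.

Definition square_integral (M : R) (f : R -> R -> R) : R :=
  RInt (fun y => RInt (fun x => f x y) (- M) M) (- M) M.

Lemma square_integral_swap (M : R) (f : R -> R -> R) :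
  0 <= M -> (forall x y, cont2 f x y) ->
  square_integral M f = square_integral M (fun x y => f y x).
Proof.
  intros HM Hf. unfold square_integral.
  rewrite (fubini f) by (assumption || lra). reflexivity.
Qed.

Lemma square_integral_le (M : R) (f g : R -> R -> R) :
  0 <= M -> (forall x y, cont2 f x y) -> (forall x y, cont2 g x y) ->
  (forall x y, Rabs x <= M -> Rabs y <= M -> f x y <= g x y) ->
  square_integral M f <= square_integral M g.
Proof.
  intros HM Hf Hg Hle. unfold square_integral.
  apply RInt_le; [lra | | |].
  - apply ex_RInt_cont. intros. apply continuous_RInt_param; [lra | assumption].
  - apply ex_RInt_cont. intros. apply continuous_RInt_param; [lra | assumption].
  - intros y Hy. apply RInt_le; [lra | | |].
    + apply ex_RInt_cont. intros. apply cont2_x, Hf.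
    + apply ex_RInt_cont. intros. apply cont2_x, Hg.
    + intros x Hx. apply Hle; apply Rabs_le_between; lra.
Qed.

Lemma square_integral_scal (M k : R) (f : R -> R -> R) :
  0 <= M -> (forall x y, cont2 f x y) ->
  square_integral M (fun x y => k * f x y) = k * square_integral M f.
Proof.
  intros HM Hf. unfold square_integral.
  rewrite (RInt_ext _ (fun y => k * RInt (fun x => f x y) (- M) M)).
  - apply (RInt_scal (V := R_CompleteNormedModule)).
    apply ex_RInt_cont. intros. apply continuous_RInt_param; [lra | assumption].
  - intros y _. apply (RInt_scal (V := R_CompleteNormedModule)).
    apply ex_RInt_cont. intros. apply cont2_x, Hf.
Qed.

Lemma square_integral_const (M k : R) : square_integral M (fun _ _ => k) = 4 * M ^ 2 * k.
Proof.
  unfold square_integral. rewrite (RInt_ext _ (fun _ => 2 * M * k)).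
  - rewrite RInt_const. unfold scal; simpl; unfold mult; simpl. ring.
  - intros y _. rewrite RInt_const. unfold scal; simpl; unfold mult; simpl. ring.
Qed.

Lemma square_integral_prod (M : R) (f g : R -> R) :
  (forall x, continuous f x) -> (forall x, continuous g x) ->
  square_integral M (fun x y => f x * g y) = RInt f (- M) M * RInt g (- M) M.
Proof.
  intros Hf Hg. unfold square_integral.
  rewrite (RInt_ext _ (fun y => RInt f (- M) M * g y)).
  - apply (RInt_scal (V := R_CompleteNormedModule)), ex_RInt_cont, Hg.
  - intros y _. rewrite (RInt_ext _ (fun x => g y * f x)) by (intros; apply Rmult_comm).
    rewrite Rmult_comm. apply (RInt_scal (V := R_CompleteNormedModule)), ex_RInt_cont, Hf.
Qed.

(** The shear moves points along horizontal lines only, so the inner integral is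
    transformed by a substitution in one variable; as the sides are fixed, its
    limits do not change. *)
Lemma square_integral_shear (M : R) (f phi dphi : R -> R -> R) :
  0 <= M -> (forall x y, cont2 f x y) ->
  (forall x y, Rabs x <= M -> Rabs y <= M -> is_derive (fun u => phi u y) x (dphi x y)) ->
  (forall x y, Rabs x <= M -> Rabs y <= M -> cont2 dphi x y) ->
  (forall y, Rabs y <= M -> phi (- M) y = - M /\ phi M y = M) ->
  square_integral M f = square_integral M (fun x y => dphi x y * f (phi x y) y).
Proof.
  intros HM Hf Hd Hdc Hends. unfold square_integral.
  apply RInt_ext. intros y Hy. rewrite Rmin_left, Rmax_right in Hy by lra.
  assert (HyM : Rabs y <= M) by (apply Rabs_le_between; lra).
  destruct (Hends y HyM) as [E1 E2].
  transitivity (RInt (fun x => f x y) (phi (- M) y) (phi M y)); [rewrite E1, E2; reflexivity|].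
  symmetry.
  apply (RInt_comp (V := R_CompleteNormedModule) (fun x => f x y) (fun x => phi x y) (fun x => dphi x y)).
  - intros x _. apply cont2_x, Hf.
  - intros x Hx. rewrite Rmin_left, Rmax_right in Hx by lra.
    assert (HxM : Rabs x <= M) by (apply Rabs_le_between; lra).
    split; [apply Hd; assumption | apply cont2_x, Hdc; assumption].
Qed.

(** * A cutoff function *)

Lemma is_derive_Rmax0_sqr (x : R) : is_derive (fun x => Rmax 0 x ^ 2) x (2 * Rmax 0 x).
Proof.
  destruct (Rtotal_order x 0) as [H|[->|H]].
  - apply (is_derive_ext_loc (fun _ => 0)).
    + apply (filter_imp (fun y => y < 0)); [|apply (open_lt 0), H].
      intros y Hy. rewrite Rmax_left by lra. apply eq_sym, pow_i. lia.
    + rewrite Rmax_left by lra. replace (2 * 0) with 0 by ring. apply (is_derive_const 0 x).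
  - (* the difference quotient at 0 is at most [|h|] *)
    apply is_derive_Reals. intros eps He. exists (mkposreal eps He). intros h Hh Hhe.
    simpl in Hhe. rewrite Rplus_0_l, (Rmax_left 0 0) by lra.
    eapply Rle_lt_trans; [|exact Hhe].
    destruct (Rle_dec h 0).
    + rewrite (Rmax_left 0 h) by lra.
      replace ((0 ^ 2 - 0 ^ 2) / h - 2 * 0) with 0 by (field; assumption).
      rewrite Rabs_R0. apply Rabs_pos.
    + rewrite (Rmax_right 0 h) by lra.
      replace ((h ^ 2 - 0 ^ 2) / h - 2 * 0) with h by (field; assumption). lra.
  - apply (is_derive_ext_loc (fun x => x ^ 2)).
    + apply (filter_imp (fun y => 0 < y)); [|apply (open_gt 0), H].
      intros y Hy. rewrite Rmax_right by lra. reflexivity.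
    + rewrite Rmax_right by lra. auto_derive; [exact I | ring].
Qed.

Lemma continuous_Rmax (c x : R) : continuous (Rmax c) x.
Proof.
  apply filterlim_locally. intros eps. exists eps. intros y Hy.
  change (Rabs (y - x) < eps) in Hy. change (Rabs (Rmax c y - Rmax c x) < eps).
  apply Rabs_def2 in Hy. assert (Hp := cond_pos eps).
  unfold Rmax. destruct (Rle_dec c y), (Rle_dec c x); apply Rabs_def1; lra.
Qed.

(** A C^1 function equal to 1 on [[-m, m]] and to 0 outside [[-m-1, m+1]]. *)
Definition cutoff (m x : R) : R :=
  Rmax 0 (1 - (Rmax 0 (x - m) ^ 2 + Rmax 0 (- x - m) ^ 2)) ^ 2.

Definition dcutoff (m x : R) : R :=
  - 4 * Rmax 0 (1 - (Rmax 0 (x - m) ^ 2 + Rmax 0 (- x - m) ^ 2))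
      * (Rmax 0 (x - m) - Rmax 0 (- x - m)).

Lemma is_derive_cutoff m x : is_derive (cutoff m) x (dcutoff m x).
Proof.
  unfold cutoff.
  pose (s := fun z => Rmax 0 z ^ 2).
  assert (Hs : forall z, is_derive s z (2 * Rmax 0 z)) by (exact is_derive_Rmax0_sqr).
  assert (H : is_derive (fun x => s (1 - (s (x - m) + s (- x - m)))) x
     (2 * Rmax 0 (1 - (s (x - m) + s (- x - m)))
        * - (2 * Rmax 0 (x - m) - 2 * Rmax 0 (- x - m)))).
  { auto_derive.
    - repeat split; eexists; apply Hs.
    - rewrite !(is_derive_unique _ _ _ (Hs _)). unfold Rminus. ring. }
  replace (dcutoff m x) with (2 * Rmax 0 (1 - (s (x - m) + s (- x - m)))
        * - (2 * Rmax 0 (x - m) - 2 * Rmax 0 (- x - m))); [exact H|].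
  unfold dcutoff, s. ring.
Qed.

Lemma continuous_Rmax0_affine (k c x : R) : continuous (fun x => Rmax 0 (k * x + c)) x.
Proof.
  apply (continuous_comp (fun x => k * x + c) (Rmax 0)).
  - apply (ex_derive_continuous (fun x => k * x + c)). auto_derive. exact I.
  - apply continuous_Rmax.
Qed.

Lemma continuous_dcutoff m x : continuous (dcutoff m) x.
Proof.
  assert (H1 := continuous_Rmax0_affine 1 (- m)).
  assert (H2 := continuous_Rmax0_affine (-1) (- m)).
  assert (E1 : forall x, Rmax 0 (1 * x + - m) = Rmax 0 (x - m)) by (intros; f_equal; ring).
  assert (E2 : forall x, Rmax 0 (-1 * x + - m) = Rmax 0 (- x - m)) by (intros; f_equal; ring).
  assert (H1' : forall x, continuous (fun x => Rmax 0 (x - m)) x).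
  { intros z. eapply continuous_ext; [exact E1 | apply H1]. }
  assert (H2' : forall x, continuous (fun x => Rmax 0 (- x - m)) x).
  { intros z. eapply continuous_ext; [exact E2 | apply H2]. }
  unfold dcutoff.
  apply (continuous_mult (K := R_AbsRing)).
  - apply (continuous_mult (K := R_AbsRing)); [apply continuous_const|].
    apply (continuous_comp (fun x => 1 - (Rmax 0 (x - m) ^ 2 + Rmax 0 (- x - m) ^ 2)) (Rmax 0));
      [|apply continuous_Rmax].
    apply (continuous_minus (V := R_NormedModule)); [apply continuous_const|].
    apply (continuous_plus (V := R_NormedModule)).
    + apply (continuous_comp (fun x => Rmax 0 (x - m)) (fun z => z ^ 2)); [apply H1'|].
      apply (ex_derive_continuous (fun z => z ^ 2)). auto_derive. exact I.
    + apply (continuous_comp (fun x => Rmax 0 (- x - m)) (fun z => z ^ 2)); [apply H2'|].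
      apply (ex_derive_continuous (fun z => z ^ 2)). auto_derive. exact I.
  - apply (continuous_minus (V := R_NormedModule)); [apply H1' | apply H2'].
Qed.

Lemma continuous_cutoff m x : continuous (cutoff m) x.
Proof. apply (ex_derive_continuous (cutoff m)). eexists. apply is_derive_cutoff. Qed.

Lemma cutoff_inside m x : Rabs x <= m -> cutoff m x = 1 /\ dcutoff m x = 0.
Proof.
  intros H. apply Rabs_le_between in H. unfold cutoff, dcutoff.
  rewrite !(Rmax_left 0 (_ - m)) by lra.
  split; [rewrite Rmax_right by lra|]; ring.
Qed.

Lemma cutoff_end m x : Rabs x = m + 1 -> 0 <= m -> cutoff m x = 0.
Proof.
  intros H Hm. unfold cutoff. rewrite Rmax_left; [ring|].
  assert (H1 := Rmax_l 0 (x - m)). assert (H2 := Rmax_l 0 (- x - m)).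
  assert (H3 := Rmax_r 0 (x - m)). assert (H4 := Rmax_r 0 (- x - m)).
  unfold Rabs in H. destruct Rcase_abs; nra.
Qed.

Lemma cont3_fst x y t : continuous (fun p : R * R * R => fst (fst p)) (x, y, t).
Proof.
  apply (continuous_comp fst fst); [apply (continuous_fst (x, y) t) | apply (continuous_fst x y)].
Qed.

Lemma cont3_snd x y t : continuous (fun p : R * R * R => snd (fst p)) (x, y, t).
Proof.
  apply (continuous_comp fst snd); [apply (continuous_fst (x, y) t) | apply (continuous_snd x y)].
Qed.

Lemma cont3_mult f g x y t :
  cont3 f x y t -> cont3 g x y t -> cont3 (fun x y t => f x y t * g x y t) x y t.
Proof. intros Hf Hg. apply (continuous_mult (K := R_AbsRing)); assumption. Qed.

Lemma cont3_plus f g x y t :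
  cont3 f x y t -> cont3 g x y t -> cont3 (fun x y t => f x y t + g x y t) x y t.
Proof. intros Hf Hg. apply (continuous_plus (V := R_NormedModule)); assumption. Qed.

Lemma cont3_of_x (c : R -> R) x y t : continuous c x -> cont3 (fun x _ _ => c x) x y t.
Proof.
  intros Hc. apply (continuous_comp (fun p : R * R * R => fst (fst p)) c);
    [apply cont3_fst | exact Hc].
Qed.

Lemma C1field_cutoff_x m f fx fy ft : C1field f fx fy ft ->
  C1field (fun x y t => cutoff m x * f x y t)
    (fun x y t => dcutoff m x * f x y t + cutoff m x * fx x y t)
    (fun x y t => cutoff m x * fy x y t) (fun x y t => cutoff m x * ft x y t).
Proof.
  intros [H1 H2 H3 H4 H5 H6 H7].
  assert (Cc := fun x y t => cont3_of_x (cutoff m) x y t (continuous_cutoff m x)).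
  assert (Cd := fun x y t => cont3_of_x (dcutoff m) x y t (continuous_dcutoff m x)).
  split; intros x y t Ht.
  - assert (Hc := is_derive_cutoff m x). specialize (H1 x y t Ht).
    apply (is_derive_mult (cutoff m) (fun u => f u y t)); [assumption|assumption|].
    intros; apply Rmult_comm.
  - apply (is_derive_scal (fun u => f x u t)), H2, Ht.
  - apply (is_derive_scal (fun u => f x y u)), H3, Ht.
  - apply (cont3_mult (fun x _ _ => cutoff m x)); auto.
  - apply (cont3_plus (fun x y t => dcutoff m x * f x y t));
      [apply (cont3_mult (fun x _ _ => dcutoff m x)) |
       apply (cont3_mult (fun x _ _ => cutoff m x))]; auto.
  - apply (cont3_mult (fun x _ _ => cutoff m x)); auto.
  - apply (cont3_mult (fun x _ _ => cutoff m x)); auto.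
Qed.

Lemma cont3_swap f x y t : cont3 f y x t -> cont3 (fun x y t => f y x t) x y t.
Proof.
  intros H. apply (cont3_comp f (fun p : R * R * R => snd (fst p)) (fun p => fst (fst p)) snd);
    [apply cont3_snd | apply cont3_fst | apply (continuous_snd (x, y) t) | exact H].
Qed.

Lemma C1field_swap f fx fy ft : C1field f fx fy ft ->
  C1field (fun x y t => f y x t) (fun x y t => fy y x t) (fun x y t => fx y x t)
    (fun x y t => ft y x t).
Proof.
  intros [H1 H2 H3 H4 H5 H6 H7]. split; intros x y t Ht; auto; apply cont3_swap; auto.
Qed.

Lemma cont3_slice f x y t : cont3 f x y t -> cont2 (fun x y => f x y t) x y.
Proof.
  intros H. apply (cont3_comp f (fun p : R * R => fst p) (fun p => snd p) (fun _ => t));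
    [apply (continuous_fst x y) | apply (continuous_snd x y) | apply continuous_const | exact H].
Qed.

(** * Growth of area along a flow *)

(** One time step of length [h], backwards along the field [(f, g)]: first a shear
    in [x], then a shear in [y].  Splitting Euler's step into shears makes the
    change of variables exact and one-dimensional. *)
Definition back_x (f : R -> R -> R -> R) (h t x y : R) : R := x - h * f x y t.
Definition back_y (f g : R -> R -> R -> R) (h t x y : R) : R :=
  y - h * g (back_x f h t x y) y t.

Lemma cont2_shear (c : R -> R -> R) (h : R) x y :
  cont2 c x y -> cont2 (fun x y => x - h * c x y) x y.
Proof.
  intros Hc. apply (continuous_minus (V := R_NormedModule)); [apply (continuous_fst x y)|].
  apply (continuous_scal_r (V := R_NormedModule) h), Hc.
Qed.

Lemma cont2_back_x f fx fy ft h t x y : C1field f fx fy ft -> 0 < t ->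
  cont2 (back_x f h t) x y.
Proof.
  intros Hf Ht. apply (cont2_shear (fun x y => f x y t)), cont3_slice, (C1_c _ _ _ _ Hf), Ht.
Qed.

Lemma cont2_back_y f fx fy ft g gx gy gt h t x y :
  C1field f fx fy ft -> C1field g gx gy gt -> 0 < t -> cont2 (back_y f g h t) x y.
Proof.
  intros Hf Hg Ht. unfold back_y, cont2.
  apply (continuous_minus (V := R_NormedModule)); [apply (continuous_snd x y)|].
  apply (continuous_scal_r (V := R_NormedModule) h).
  apply (cont2_comp (fun u v => g u v t) (fun p : R * R => back_x f h t (fst p) (snd p)) snd).
  - apply (cont2_back_x f fx fy ft h t x y Hf Ht).
  - apply (continuous_snd x y).
  - apply cont3_slice, (C1_c _ _ _ _ Hg), Ht.
Qed.

Lemma is_derive_shear (f df : R -> R) (h x : R) :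
  is_derive f x (df x) -> is_derive (fun u => u - h * f u) x (1 - h * df x).
Proof.
  intros H. apply (is_derive_minus (fun u => u) (fun u => h * f u)).
  - apply (is_derive_id (K := R_AbsRing)).
  - apply (is_derive_scal f), H.
Qed.

(** The weight is the Jacobian determinant of the step: each shear is a
    substitution in one variable. *)
Lemma square_integral_back_step f fx fy ft g gx gy gt (M h t : R) (rho : R -> R -> R) :
  C1field f fx fy ft -> C1field g gx gy gt -> 0 < t -> 0 <= M ->
  (forall x y, Rabs x = M -> f x y t = 0) -> (forall x y, Rabs y = M -> g x y t = 0) ->
  (forall x y, cont2 rho x y) ->
  square_integral M rho = square_integral M (fun x y =>
    (1 - h * fx x y t) * (1 - h * gy (back_x f h t x y) y t)
    * rho (back_x f h t x y) (back_y f g h t x y)).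
Proof.
  intros Hf Hg Ht HM Hf0 Hg0 Hrho.
  pose (sig := fun x y => (1 - h * gy x y t) * rho x (y - h * g x y t)).
  assert (Hw : forall k kx ky kt x y, C1field k kx ky kt ->
     cont2 (fun x y => 1 - h * ky x y t) x y).
  { intros k kx ky kt x y Hk.
    apply (continuous_minus (V := R_NormedModule)); [apply continuous_const|].
    apply (continuous_scal_r (V := R_NormedModule) h), cont3_slice, (C1_cy _ _ _ _ Hk), Ht. }
  assert (Hsig : forall x y, cont2 sig x y).
  { intros x y. apply (continuous_mult (K := R_AbsRing)).
    - apply (Hw g gx gy gt x y Hg).
    - apply (cont2_comp rho fst (fun p : R * R => snd p - h * g (fst p) (snd p) t)).
      + apply (continuous_fst x y).
      + apply (continuous_minus (V := R_NormedModule)); [apply (continuous_snd x y)|].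
        apply (continuous_scal_r (V := R_NormedModule) h), cont3_slice, (C1_c _ _ _ _ Hg), Ht.
      + apply Hrho. }
  assert (HM' : Rabs (- M) = M) by (rewrite Rabs_Ropp; apply Rabs_pos_eq, HM).
  assert (HM'' : Rabs M = M) by (apply Rabs_pos_eq, HM).
  transitivity (square_integral M sig).
  - rewrite (square_integral_swap M rho), (square_integral_swap M sig) by assumption.
    apply (square_integral_shear M (fun x y => rho y x) (fun y x => y - h * g x y t)
             (fun y x => 1 - h * gy x y t)); [assumption| | | |].
    + intros x y. apply (cont2_swap rho), Hrho.
    + intros y x _ _. apply (is_derive_shear (fun y => g x y t) (fun y => gy x y t)),
        (C1_dy _ _ _ _ Hg), Ht.
    + intros y x _ _. apply (cont2_swap (fun x y => 1 - h * gy x y t)), (Hw g gx gy gt x y Hg).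
    + intros x _. rewrite !Hg0 by assumption. split; ring.
  - rewrite (square_integral_shear M sig (back_x f h t) (fun x y => 1 - h * fx x y t));
      [| assumption | assumption | | |].
    + unfold sig, square_integral. apply RInt_ext. intros y _. apply RInt_ext. intros x _.
      unfold back_y. simpl. symmetry. apply Rmult_assoc.
    + intros x y _ _. apply (is_derive_shear (fun x => f x y t) (fun x => fx x y t)),
        (C1_dx _ _ _ _ Hf), Ht.
    + intros x y _ _. apply (cont2_swap (fun y x => 1 - h * fx x y t)).
      apply (Hw _ _ _ _ y x (C1field_swap _ _ _ _ Hf)).
    + intros y _. unfold back_x. rewrite !Hf0 by assumption. split; ring.
Qed.

(** The shear is monotone, since [h * df <= 1], and both end points are fixed. *)
Lemma shear_stays_in_interval (f df : R -> R) (M h : R) :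
  0 <= M -> (forall x, is_derive f x (df x)) -> f (- M) = 0 -> f M = 0 ->
  (forall x, Rabs x <= M -> h * df x <= 1) ->
  forall x, Rabs x <= M -> Rabs (x - h * f x) <= M.
Proof.
  intros HM Hd H1 H2 Hle x Hx. apply Rabs_le_between in Hx. apply Rabs_le_between.
  assert (D : forall z, - M <= z <= M ->
      is_derive (fun u => - (u - h * f u)) z (- (1 - h * df z))).
  { intros z _. apply (is_derive_opp (fun u => u - h * f u)), (is_derive_shear f df), Hd. }
  assert (N : forall z, - M <= z <= M -> - (1 - h * df z) <= 0).
  { intros z Hz. specialize (Hle z ltac:(apply Rabs_le_between; lra)). lra. }
  assert (A := nonincreasing_of_derive (fun u => - (u - h * f u)) (fun z => - (1 - h * df z))
                 (- M) x ltac:(lra) ltac:(intros; apply D; lra) ltac:(intros; apply N; lra)).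
  assert (B := nonincreasing_of_derive (fun u => - (u - h * f u)) (fun z => - (1 - h * df z))
                 x M ltac:(lra) ltac:(intros; apply D; lra) ltac:(intros; apply N; lra)).
  cbv beta in A, B. rewrite H1 in A. rewrite H2 in B. lra.
Qed.

(** The step and the trajectory [(X, Y)] both move by [h] times a value of the
    field, at points whose distance is the error at time [t] plus [O(h)]; hence a
    local error [O(h^2)].  The factor [exp (4 L h)] appears because the error at the
    later time occurs on both sides. *)
Lemma back_step_error f g (M a b L K h t x y : R) (X Y : R -> R) :
  0 <= L -> 0 < h -> 0 <= K -> 4 * h * L <= 1 ->
  (forall x y t x' y' t',
    Rabs x <= M -> Rabs y <= M -> a <= t <= b ->
    Rabs x' <= M -> Rabs y' <= M -> a <= t' <= b ->
    Rabs (f x y t - f x' y' t') <= L * (Rabs (x - x') + Rabs (y - y') + Rabs (t - t'))) ->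
  (forall x y t x' y' t',
    Rabs x <= M -> Rabs y <= M -> a <= t <= b ->
    Rabs x' <= M -> Rabs y' <= M -> a <= t' <= b ->
    Rabs (g x y t - g x' y' t') <= L * (Rabs (x - x') + Rabs (y - y') + Rabs (t - t'))) ->
  (forall x y t, Rabs x <= M -> Rabs y <= M -> a <= t <= b ->
     Rabs (f x y t) <= K /\ Rabs (g x y t) <= K) ->
  a <= t - h -> t <= b ->
  (forall s, a <= s <= b -> Rabs (X s) <= M /\ Rabs (Y s) <= M /\
     is_derive X s (f (X s) (Y s) s) /\ is_derive Y s (g (X s) (Y s) s)) ->
  Rabs x <= M -> Rabs y <= M -> Rabs (back_x f h t x y) <= M ->
  Rabs (x - X t) + Rabs (y - Y t) <=
    exp (4 * L * h) * (Rabs (back_x f h t x y - X (t - h)) + Rabs (back_y f g h t x y - Y (t - h))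
                       + L * (5 * K + 2) * h ^ 2).
Proof.
  intros HL Hh HK HhL Lf Lg B Ha Hb Htraj Hx Hy Hx'.
  assert (Hmv : forall Z Zd, (forall s, a <= s <= b -> is_derive Z s (Zd s)) ->
    forall s, t - h <= s <= t ->
    (forall s, a <= s <= b -> Rabs (Zd s) <= K) -> Rabs (Z t - Z s) <= K * h).
  { intros Z Zd HZ s Hs HZK.
    destruct (mean_value Z Zd a b s t HZ) as (c & Hc & _ & E); try lra.
    rewrite E, Rabs_mult, (Rabs_pos_eq (t - s)) by lra.
    specialize (HZK c Hc). assert (P := Rabs_pos (Zd c)). nra. }
  assert (HXt := fun s Hs => Hmv X _ (fun s Hs => proj1 (proj2 (proj2 (Htraj s Hs)))) s Hs).
  assert (HYt := fun s Hs => Hmv Y _ (fun s Hs => proj2 (proj2 (proj2 (Htraj s Hs)))) s Hs).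
  assert (HX : forall s, t - h <= s <= t -> Rabs (X t - X s) <= K * h).
  { intros s Hs. apply HXt; [exact Hs|]. intros u Hu. destruct (Htraj u Hu) as (? & ? & _).
    apply B; assumption. }
  assert (HY : forall s, t - h <= s <= t -> Rabs (Y t - Y s) <= K * h).
  { intros s Hs. apply HYt; [exact Hs|]. intros u Hu. destruct (Htraj u Hu) as (? & ? & _).
    apply B; assumption. }
  clear HXt HYt Hmv.
  destruct (mean_value X (fun s => f (X s) (Y s) s) a b (t - h) t) as (c1 & Hc1 & Hc1' & E1);
    try lra.
  { intros s Hs. apply Htraj, Hs. }
  destruct (mean_value Y (fun s => g (X s) (Y s) s) a b (t - h) t) as (c2 & Hc2 & Hc2' & E2);
    try lra.
  { intros s Hs. apply Htraj, Hs. }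
  rewrite Rmin_left, Rmax_right in Hc1', Hc2' by lra.
  cbv beta in E1, E2.
  assert (HX1 := HX c1 ltac:(lra)). assert (HY1 := HY c1 ltac:(lra)).
  assert (HX2 := HX c2 ltac:(lra)). assert (HY2 := HY c2 ltac:(lra)).
  destruct (Htraj c1 Hc1) as (BX1 & BY1 & _). destruct (Htraj c2 Hc2) as (BX2 & BY2 & _).
  set (e := Rabs (x - X t) + Rabs (y - Y t)).
  assert (Tri : forall p q r, Rabs (p - r) <= Rabs (p - q) + Rabs (q - r)).
  { intros p q r. replace (p - r) with ((p - q) + (q - r)) by ring. apply Rabs_triang. }
  assert (D1 : Rabs (f x y t - f (X c1) (Y c1) c1) <= L * (e + (2 * K + 1) * h)).
  { eapply Rle_trans; [apply Lf; try assumption; lra|].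
    apply Rmult_le_compat_l; [exact HL|].
    assert (T1 := Tri x (X t) (X c1)). assert (T2 := Tri y (Y t) (Y c1)).
    assert (Rabs (t - c1) <= h) by (apply Rabs_le_between; lra).
    unfold e. lra. }
  set (x' := back_x f h t x y) in *.
  assert (Hxx' : Rabs (x' - x) <= K * h).
  { unfold x', back_x. replace (x - h * f x y t - x) with (- (h * f x y t)) by ring.
    rewrite Rabs_Ropp, Rabs_mult, (Rabs_pos_eq h) by lra.
    destruct (B x y t Hx Hy ltac:(lra)). nra. }
  assert (D2 : Rabs (g x' y t - g (X c2) (Y c2) c2) <= L * (e + (3 * K + 1) * h)).
  { eapply Rle_trans; [apply Lg; try assumption; lra|].
    apply Rmult_le_compat_l; [exact HL|].
    assert (T1 := Tri x' x (X c2)). assert (T1' := Tri x (X t) (X c2)).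
    assert (T2 := Tri y (Y t) (Y c2)).
    assert (Rabs (t - c2) <= h) by (apply Rabs_le_between; lra).
    unfold e. lra. }
  assert (F1 : Rabs (x - X t) <= Rabs (x' - X (t - h)) + h * (L * (e + (2 * K + 1) * h))).
  { replace (x - X t) with ((x' - X (t - h)) + h * (f x y t - f (X c1) (Y c1) c1)).
    - eapply Rle_trans; [apply Rabs_triang|]. rewrite Rabs_mult, (Rabs_pos_eq h) by lra. nra.
    - unfold x', back_x. replace (X t) with (X (t - h) + f (X c1) (Y c1) c1 * (t - (t - h))) by lra.
      ring. }
  assert (F2 : Rabs (y - Y t) <= Rabs (back_y f g h t x y - Y (t - h))
                                  + h * (L * (e + (3 * K + 1) * h))).
  { replace (y - Y t) with ((back_y f g h t x y - Y (t - h)) + h * (g x' y t - g (X c2) (Y c2) c2)).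
    - eapply Rle_trans; [apply Rabs_triang|]. rewrite Rabs_mult, (Rabs_pos_eq h) by lra. nra.
    - unfold back_y. fold x'.
      replace (Y t) with (Y (t - h) + g (X c2) (Y c2) c2 * (t - (t - h))) by lra. ring. }
  set (e' := Rabs (x' - X (t - h)) + Rabs (back_y f g h t x y - Y (t - h))).
  assert (He : e * (1 - 2 * (h * L)) <= e' + L * (5 * K + 2) * h ^ 2).
  { unfold e' . unfold e in F1, F2 |- *. nra. }
  (* with [z = h L <= 1/4]: [1 / (1 - 2 z) <= exp (4 z)] *)
  assert (Hexp := exp_ineq1_le (4 * L * h)).
  set (z := h * L) in *.
  assert (Hz : 0 <= z) by (unfold z; nra).
  replace (4 * L * h) with (4 * z) in * by (unfold z; ring).
  assert (He0 : 0 <= e) by (unfold e; assert (P1 := Rabs_pos (x - X t));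
    assert (P2 := Rabs_pos (y - Y t)); lra).
  set (w := exp (4 * z)) in *.
  assert (Hz4 : z <= / 4) by (unfold z; lra).
  assert (Hw : 1 <= w * (1 - 2 * z)).
  { apply Rle_trans with ((1 + 4 * z) * (1 - 2 * z)); [nra|].
    apply Rmult_le_compat_r; lra. }
  assert (Hw0 : 0 <= w) by lra.
  apply Rle_trans with (w * (e * (1 - 2 * z))); [|apply Rmult_le_compat_l; assumption].
  replace (w * (e * (1 - 2 * z))) with (e * (w * (1 - 2 * z))) by ring. nra.
Qed.

(** Transport of [rho] by [k] forward steps from time [t0].  A point is followed
    backwards because the backward steps are the explicit ones. *)
Fixpoint transported (f g : R -> R -> R -> R) (h t0 : R) (rho : R -> R -> R) (k : nat)
    : R -> R -> R :=
  match k with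
  | O => rho
  | S k' => fun x y =>
      transported f g h t0 rho k' (back_x f h (t0 + INR k * h) x y)
        (back_y f g h (t0 + INR k * h) x y)
  end.

Lemma cont2_transported f fx fy ft g gx gy gt h t0 rho k x y :
  C1field f fx fy ft -> C1field g gx gy gt -> 0 < t0 -> 0 <= h ->
  (forall x y, cont2 rho x y) -> cont2 (transported f g h t0 rho k) x y.
Proof.
  intros Hf Hg Ht Hh Hrho. revert x y. induction k as [|k IH]; intros x y; [apply Hrho|].
  assert (0 < t0 + INR (S k) * h) by (assert (P := pos_INR (S k)); nra).
  apply (cont2_comp (transported f g h t0 rho k)
    (fun p => back_x f h (t0 + INR (S k) * h) (fst p) (snd p))
    (fun p => back_y f g h (t0 + INR (S k) * h) (fst p) (snd p))).
  - apply (cont2_back_x f fx fy ft); assumption.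
  - apply (cont2_back_y f fx fy ft g gx gy gt); assumption.
  - apply IH.
Qed.

Lemma transported_bounds f g h t0 rho k :
  (forall x y, 0 <= rho x y <= 1) -> forall x y, 0 <= transported f g h t0 rho k x y <= 1.
Proof. intros H. induction k as [|k IH]; intros x y; simpl; [apply H | apply IH]. Qed.

Lemma small_step (d bound : R) : 0 < d -> 0 < bound ->
  exists N, (0 < N)%nat /\ 0 < d / INR N /\ d / INR N < bound.
Proof.
  intros Hd Hb. destruct (nfloor_ex (d / bound)) as [N HN].
  { left. apply Rdiv_lt_0_compat; assumption. }
  exists (S N). rewrite S_INR. assert (P := pos_INR N).
  split; [lia|]. split; [apply Rdiv_lt_0_compat; lra|].
  apply Rmult_lt_reg_r with (INR N + 1); [lra|].
  replace (d / (INR N + 1) * (INR N + 1)) with d by (field; lra).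
  destruct HN as [_ HN].
  replace d with (d / bound * bound) at 1 by (field; lra).
  rewrite (Rmult_comm bound). apply Rmult_lt_compat_r; lra.
Qed.

(** Liouville's theorem as an inequality.  The mass of [rho] grows under transport
    at the rate of the divergence, which [gam] bounds from below near [(xs, ys)]; but
    the transported function stays below 1 and lives in a fixed square, so its mass
    is at most the area of that square.  The transport is discretised into Euler steps
    made of shears, whose Jacobian is explicit and whose trajectories converge to the
    true ones; a cutoff makes every step a bijection of the square.  The divergence
    is taken at two distinct points because the second shear acts after the first. *)
Theorem area_growth f fx fy ft g gx gy gt (m t0 T eps h0 : R) (xs ys gam : R -> R)
    (rho : R -> R -> R) :
  C1field f fx fy ft -> C1field g gx gy gt ->
  0 < t0 < T -> 0 < eps -> 0 < h0 -> 0 <= m ->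
  (forall x y, cont2 rho x y) -> (forall x y, 0 <= rho x y <= 1) ->
  (forall a b, rho a b <> 0 -> exists X Y, X t0 = a /\ Y t0 = b /\
     forall t, t0 <= t <= T ->
       is_derive X t (f (X t) (Y t) t) /\ is_derive Y t (g (X t) (Y t) t) /\
       Rabs (X t - xs t) < eps /\ Rabs (Y t - ys t) < eps) ->
  (forall t, t0 <= t <= T -> Rabs (xs t) + 3 * eps <= m /\ Rabs (ys t) + 3 * eps <= m) ->
  (forall t' t, t0 <= t' -> t' <= t -> t <= T -> t - t' <= h0 -> forall x y x' y',
     Rabs (x - xs t) <= 3 * eps -> Rabs (y - ys t) <= 3 * eps ->
     Rabs (x' - xs t) <= 3 * eps -> Rabs (y' - ys t) <= 3 * eps ->
     gam t - gam t' <= (t - t') * (fx x y t + gy x' y' t)) ->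
  square_integral (m + 1) rho * exp (gam T - gam t0) <= 4 * (m + 1) ^ 2.
Proof.
  intros Hf Hg HT Heps Hh0 Hm Hrc Hr01 Hflow Htube Hdiv.
  set (M := m + 1).
  assert (Htri : forall p q r, Rabs (p - r) <= Rabs (p - q) + Rabs (q - r)).
  { intros p q r. replace (p - r) with ((p - q) + (q - r)) by ring. apply Rabs_triang. }
  assert (Habs : forall p q, Rabs p <= Rabs q + Rabs (p - q)).
  { intros p q. replace p with (q + (p - q)) at 1 by ring. apply Rabs_triang. }
  pose (F := fun x y t => cutoff m x * f x y t).
  pose (Fx := fun x y t => dcutoff m x * f x y t + cutoff m x * fx x y t).
  pose (G := fun x y t => cutoff m y * g x y t).
  pose (Gy := fun x y t => dcutoff m y * g x y t + cutoff m y * gy x y t).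
  assert (HF : C1field F Fx (fun x y t => cutoff m x * fy x y t) (fun x y t => cutoff m x * ft x y t))
    by exact (C1field_cutoff_x m f fx fy ft Hf).
  assert (HG : C1field G (fun x y t => cutoff m y * gx x y t) Gy (fun x y t => cutoff m y * gt x y t))
    by exact (C1field_swap _ _ _ _ (C1field_cutoff_x m _ _ _ _ (C1field_swap _ _ _ _ Hg))).
  destruct (lipschitz_on_box _ _ _ _ M t0 T HF ltac:(lra)) as (L1 & HL1 & LF).
  destruct (lipschitz_on_box _ _ _ _ M t0 T HG ltac:(lra)) as (L2 & HL2 & LG).
  destruct (bounded_on_box F M t0 T) as (K1 & HK1 & BF).
  { intros. apply (C1_c _ _ _ _ HF). lra. }
  destruct (bounded_on_box G M t0 T) as (K2 & HK2 & BG).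
  { intros. apply (C1_c _ _ _ _ HG). lra. }
  destruct (bounded_on_box Fx M t0 T) as (P1 & HP1 & BFx).
  { intros. apply (C1_cx _ _ _ _ HF). lra. }
  destruct (bounded_on_box Gy M t0 T) as (P2 & HP2 & BGy).
  { intros. apply (C1_cy _ _ _ _ HG). lra. }
  pose (L := L1 + L2). pose (K := K1 + K2). pose (P := P1 + P2).
  assert (HF0 : forall x y t, Rabs x = M -> F x y t = 0).
  { intros x y t Hx. unfold F. rewrite (cutoff_end m x Hx Hm). ring. }
  assert (HG0 : forall x y t, Rabs y = M -> G x y t = 0).
  { intros x y t Hx. unfold G. rewrite (cutoff_end m y Hx Hm). ring. }
  (* all the bounds that the step length has to satisfy, in one number *)
  pose (A := 1 + K + P + 4 * L + / h0 * eps + (T - t0) * (L * (5 * K + 2)) * exp (4 * L * (T - t0))).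
  destruct (small_step (T - t0) (Rmin 1 eps / A)) as (N & HN & Hh & Hhs).
  { lra. }
  { assert (Hinv : 0 < / h0) by (apply Rinv_0_lt_compat; lra).
    assert (He := exp_pos (4 * L * (T - t0))).
    assert (0 <= (T - t0) * (L * (5 * K + 2))).
    { apply Rmult_le_pos; [lra|]. apply Rmult_le_pos; unfold L, K; lra. }
    apply Rdiv_lt_0_compat; [apply Rmin_glb_lt; lra|].
    unfold A, L, K, P in *. nra. }
  set (h := (T - t0) / INR N) in *.
  assert (HLKP : 0 <= L /\ 0 <= K /\ 0 <= P) by (unfold L, K, P; lra).
  destruct HLKP as (HL & HK & HP).
  pose (C := L * (5 * K + 2)).
  assert (HC : 0 <= C) by (apply Rmult_le_pos; lra).
  assert (Hsmall : h * K < eps /\ h * P <= 1 /\ 4 * h * L <= 1 /\ h <= h0 /\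
                   C * h * (T - t0) * exp (4 * L * (T - t0)) < eps).
  { assert (Hinv : 0 < / h0) by (apply Rinv_0_lt_compat; lra).
    assert (He := exp_pos (4 * L * (T - t0))).
    set (W := exp (4 * L * (T - t0))) in *.
    assert (HCW : 0 <= (T - t0) * C * W) by (apply Rmult_le_pos; nra).
    assert (HA : 0 < A) by (unfold A; fold C; nra).
    assert (HhA : h * A < Rmin 1 eps).
    { apply Rmult_lt_reg_r with (/ A); [apply Rinv_0_lt_compat, HA|].
      replace (h * A * / A) with h by (field; lra). exact Hhs. }
    assert (HA1 : h * A < 1) by (eapply Rlt_le_trans; [exact HhA | apply Rmin_l]).
    assert (HA2 : h * A < eps) by (eapply Rlt_le_trans; [exact HhA | apply Rmin_r]).
    assert (Ex : h * A = h + h * K + h * P + 4 * h * L + h * (/ h0 * eps) + C * h * (T - t0) * W).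
    { unfold A. fold C W. ring. }
    assert (0 <= h * K) by nra. assert (0 <= h * P) by nra. assert (0 <= h * L) by nra.
    assert (0 <= / h0 * eps) by nra.
    assert (0 <= h * (/ h0 * eps)) by nra.
    assert (0 <= C * h * (T - t0) * W)
      by (replace (C * h * (T - t0) * W) with (h * ((T - t0) * C * W)) by ring; nra).
    repeat split; try lra.
    assert (h * (/ h0 * eps) < eps) by lra.
    apply Rmult_le_reg_r with (/ h0 * eps); [nra|].
    replace (h0 * (/ h0 * eps)) with eps by (field; lra). lra. }
  destruct Hsmall as (S1 & S2 & S3 & S4 & S5).
  assert (HNh : INR N * h = T - t0).
  { unfold h. field. apply not_0_INR. lia. }
  set (tk := fun k : nat => t0 + INR k * h).
  assert (Htk : forall k, (k <= N)%nat -> t0 <= tk k <= T).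
  { intros k Hk. apply le_INR in Hk. assert (Q := pos_INR k). unfold tk. split; nra. }
  assert (HtkS : forall k, tk (S k) - h = tk k).
  { intros k. unfold tk. rewrite S_INR. ring. }
  assert (HLF : forall x y t x' y' t',
    Rabs x <= M -> Rabs y <= M -> t0 <= t <= T -> Rabs x' <= M -> Rabs y' <= M -> t0 <= t' <= T ->
    Rabs (F x y t - F x' y' t') <= L * (Rabs (x - x') + Rabs (y - y') + Rabs (t - t'))).
  { intros. eapply Rle_trans; [apply LF; assumption|].
    apply Rmult_le_compat_r; [|unfold L; lra].
    assert (Q1 := Rabs_pos (x - x')). assert (Q2 := Rabs_pos (y - y')).
    assert (Q3 := Rabs_pos (t - t')). lra. }
  assert (HLG : forall x y t x' y' t',
    Rabs x <= M -> Rabs y <= M -> t0 <= t <= T -> Rabs x' <= M -> Rabs y' <= M -> t0 <= t' <= T ->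
    Rabs (G x y t - G x' y' t') <= L * (Rabs (x - x') + Rabs (y - y') + Rabs (t - t'))).
  { intros. eapply Rle_trans; [apply LG; assumption|].
    apply Rmult_le_compat_r; [|unfold L; lra].
    assert (Q1 := Rabs_pos (x - x')). assert (Q2 := Rabs_pos (y - y')).
    assert (Q3 := Rabs_pos (t - t')). lra. }
  assert (HB : forall x y t, Rabs x <= M -> Rabs y <= M -> t0 <= t <= T ->
     Rabs (F x y t) <= K /\ Rabs (G x y t) <= K).
  { intros x y t Hx Hy Ht. specialize (BF x y t Hx Hy Ht). specialize (BG x y t Hx Hy Ht).
    unfold K. lra. }
  assert (HBd : forall x y t, Rabs x <= M -> Rabs y <= M -> t0 <= t <= T ->
     h * Fx x y t <= 1 /\ h * Gy x y t <= 1).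
  { intros x y t Hx Hy Ht. specialize (BFx x y t Hx Hy Ht). specialize (BGy x y t Hx Hy Ht).
    apply Rabs_le_between in BFx. apply Rabs_le_between in BGy.
    assert (h * Fx x y t <= h * P) by (apply Rmult_le_compat_l; unfold P; lra).
    assert (h * Gy x y t <= h * P) by (apply Rmult_le_compat_l; unfold P; lra). lra. }
  assert (Hbx : forall x y t, Rabs x <= M -> Rabs y <= M -> t0 <= t <= T ->
     Rabs (back_x F h t x y) <= M).
  { intros x y t Hx Hy Ht.
    apply (shear_stays_in_interval (fun x => F x y t) (fun x => Fx x y t));
      [unfold M; lra | | apply HF0; rewrite Rabs_Ropp; apply Rabs_pos_eq; unfold M; lra
      | apply HF0; apply Rabs_pos_eq; unfold M; lra | | assumption].
    - intros. apply (C1_dx _ _ _ _ HF). lra.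
    - intros z Hz. apply HBd; assumption. }
  assert (Hby : forall x y t, Rabs x <= M -> Rabs y <= M -> t0 <= t <= T ->
     Rabs (back_y F G h t x y) <= M).
  { intros x y t Hx Hy Ht.
    apply (shear_stays_in_interval (fun y' => G (back_x F h t x y) y' t)
             (fun y' => Gy (back_x F h t x y) y' t));
      [unfold M; lra | | apply HG0; rewrite Rabs_Ropp; apply Rabs_pos_eq; unfold M; lra
      | apply HG0; apply Rabs_pos_eq; unfold M; lra | | assumption].
    - intros. apply (C1_dy _ _ _ _ HG). lra.
    - intros z Hz. apply HBd; try assumption. apply Hbx; assumption. }
  (* Euler's method converges: a point of the support at step [k] is within [O(h)] of
     the true trajectory issuing from a point of the support of [rho]. *)
  assert (Htrack : forall k, (k <= N)%nat -> forall x y, Rabs x <= M -> Rabs y <= M ->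
     transported F G h t0 rho k x y <> 0 ->
     exists X Y, (forall t, t0 <= t <= T ->
       is_derive X t (F (X t) (Y t) t) /\ is_derive Y t (G (X t) (Y t) t) /\
       Rabs (X t - xs t) < eps /\ Rabs (Y t - ys t) < eps) /\
       Rabs (x - X (tk k)) + Rabs (y - Y (tk k))
         <= C * h * (INR k * h) * exp (4 * L * (INR k * h))).
  { induction k as [|k IH]; intros Hk x y Hx Hy Hnz.
    - destruct (Hflow x y Hnz) as (X & Y & E1 & E2 & HXY). exists X, Y. split.
      + intros t Ht. destruct (HXY t Ht) as (D1 & D2 & N1 & N2).
        refine (conj _ (conj _ (conj N1 N2))).
        * unfold F. rewrite (proj1 (cutoff_inside m (X t) ltac:(
             specialize (Htube t Ht); specialize (Habs (X t) (xs t)); lra))).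
          rewrite Rmult_1_l. exact D1.
        * unfold G. rewrite (proj1 (cutoff_inside m (Y t) ltac:(
             specialize (Htube t Ht); specialize (Habs (Y t) (ys t)); lra))).
          rewrite Rmult_1_l. exact D2.
      + unfold tk. simpl. rewrite !Rmult_0_l, !Rmult_0_r, Rmult_0_l, Rplus_0_r, E1, E2.
        rewrite !Rminus_diag, Rabs_R0. lra.
    - assert (Ht := Htk (S k) Hk). assert (Ht' := Htk k ltac:(lia)).
      set (t := tk (S k)) in *.
      destruct (IH ltac:(lia) (back_x F h t x y) (back_y F G h t x y)) as (X & Y & HXY & E).
      { apply Hbx; assumption. } { apply Hby; assumption. } { exact Hnz. }
      exists X, Y. split; [exact HXY|].
      eapply Rle_trans.
      + apply (back_step_error F G M t0 T L K h t x y X Y); try assumption;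
          [unfold t; rewrite HtkS; lra | lra | | apply Hbx; assumption].
        intros s Hs. destruct (HXY s Hs) as (D1 & D2 & N1 & N2).
        specialize (Htube s Hs). assert (Q1 := Habs (X s) (xs s)).
        assert (Q2 := Habs (Y s) (ys s)). unfold M.
        refine (conj _ (conj _ (conj D1 D2))); lra.
      + unfold t. rewrite HtkS. fold t. fold C.
        rewrite S_INR.
        replace (4 * L * ((INR k + 1) * h)) with (4 * L * h + 4 * L * (INR k * h)) by ring.
        rewrite exp_plus.
        set (w := exp (4 * L * h)). set (v := exp (4 * L * (INR k * h))) in *.
        assert (Hw : 0 < w) by apply exp_pos.
        assert (Hv : 1 <= v).
        { assert (Q := exp_ineq1_le (4 * L * (INR k * h))). fold v in Q.
          assert (0 <= L * (INR k * h)) by (apply Rmult_le_pos; [lra | apply Rmult_le_pos; [apply pos_INR | lra]]).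
          lra. }
        assert (HCh : 0 <= C * h ^ 2) by (apply Rmult_le_pos; [lra | apply pow2_ge_0]).
        replace (C * h * ((INR k + 1) * h) * (w * v))
          with (w * (C * h * (INR k * h) * v + C * h ^ 2 * v)) by ring.
        apply Rmult_le_compat_l; [lra|]. nra. }
  (* Where the transported function vanishes there is nothing to compare; elsewhere
     the point is near a true trajectory, where the cutoff is locally 1 and the
     Jacobian involves the divergence of the original field. *)
  assert (Hstep : forall k, (k < N)%nat ->
    square_integral M (transported F G h t0 rho k) <=
    exp (gam (tk k) - gam (tk (S k))) * square_integral M (transported F G h t0 rho (S k))).
  { intros k Hk.
    assert (Ht := Htk (S k) Hk). assert (Ht' := Htk k ltac:(lia)).
    assert (Hcont : forall k x y, cont2 (transported F G h t0 rho k) x y).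
    { intros. apply (cont2_transported _ _ _ _ _ _ _ _ _ _ _ _ _ _ HF HG); (assumption || lra). }
    assert (Hlow := transported_bounds F G h t0 rho (S k) Hr01).
    assert (Htk1 : 0 < tk (S k)) by lra.
    rewrite (square_integral_back_step F _ _ _ G _ _ _ M h (tk (S k)) _ HF HG Htk1);
      [| unfold M; lra | intros; apply HF0; assumption | intros; apply HG0; assumption | apply Hcont].
    change (fun x y => (1 - h * Fx x y (tk (S k)))
              * (1 - h * Gy (back_x F h (tk (S k)) x y) y (tk (S k)))
              * transported F G h t0 rho k (back_x F h (tk (S k)) x y) (back_y F G h (tk (S k)) x y))
      with (fun x y => (1 - h * Fx x y (tk (S k)))
              * (1 - h * Gy (back_x F h (tk (S k)) x y) y (tk (S k)))
              * transported F G h t0 rho (S k) x y).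
    set (t := tk (S k)) in *.
    assert (HM0 : 0 <= M) by (unfold M; lra).
    rewrite <- (square_integral_scal M _ _ HM0 (Hcont (S k))).
    apply square_integral_le; [exact HM0 | | |].
    - intros x y. apply (continuous_mult (K := R_AbsRing)); [|apply Hcont].
      apply (continuous_mult (K := R_AbsRing)).
      + apply (continuous_minus (V := R_NormedModule)); [apply continuous_const|].
        apply (continuous_scal_r (V := R_NormedModule) h).
        apply (cont3_slice Fx x y t), (C1_cx _ _ _ _ HF), Htk1.
      + apply (continuous_minus (V := R_NormedModule)); [apply continuous_const|].
        apply (continuous_scal_r (V := R_NormedModule) h).
        apply (cont2_comp (fun u v => Gy u v t) (fun p : R * R => back_x F h t (fst p) (snd p)) snd).
        * apply (cont2_back_x F _ _ _ h t x y HF Htk1).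
        * apply (continuous_snd x y).
        * apply cont3_slice, (C1_cy _ _ _ _ HG), Htk1.
    - intros x y. apply (continuous_scal_r (V := R_NormedModule) (exp (gam (tk k) - gam t))), Hcont.
    - intros x y Hx Hy.
      destruct (Req_dec (transported F G h t0 rho (S k) x y) 0) as [Hz|Hnz].
      { rewrite Hz, !Rmult_0_r. lra. }
      apply Rmult_le_compat_r; [apply Hlow|].
      destruct (Htrack (S k) Hk x y Hx Hy Hnz) as (X & Y & HXY & E). fold t in E.
      destruct (HXY t Ht) as (_ & _ & N1 & N2).
      assert (Ee : C * h * (INR (S k) * h) * exp (4 * L * (INR (S k) * h)) < eps).
      { eapply Rle_lt_trans; [|exact S5].
        assert (Hkh : INR (S k) * h <= T - t0).
        { rewrite <- HNh. apply Rmult_le_compat_r; [lra|]. apply le_INR. lia. }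
        assert (Hkh0 : 0 <= INR (S k) * h) by (apply Rmult_le_pos; [apply pos_INR | lra]).
        assert (HCh : 0 <= C * h) by (apply Rmult_le_pos; lra).
        apply Rmult_le_compat; [apply Rmult_le_pos; lra | left; apply exp_pos | |].
        - apply Rmult_le_compat_l; assumption.
        - assert (Hle : 4 * L * (INR (S k) * h) <= 4 * L * (T - t0))
            by (apply Rmult_le_compat_l; lra).
          destruct Hle as [Hlt|Heq]; [left; apply exp_increasing, Hlt | right; f_equal; exact Heq]. }
      assert (Q1 := Rabs_pos (x - X t)). assert (Q2 := Rabs_pos (y - Y t)).
      assert (Nx := Htri x (X t) (xs t)). assert (Ny := Htri y (Y t) (ys t)).
      set (x' := back_x F h t x y).
      assert (Nx' : Rabs (x' - x) <= h * K).
      { unfold x', back_x. replace (x - h * F x y t - x) with (- (h * F x y t)) by ring.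
        rewrite Rabs_Ropp, Rabs_mult, (Rabs_pos_eq h) by lra.
        apply Rmult_le_compat_l; [lra|]. apply HB; assumption. }
      assert (Nx'' := Htri x' x (xs t)).
      specialize (Htube t Ht). destruct Htube as [Tx Ty].
      assert (Ax := Habs x (xs t)). assert (Ay := Habs y (ys t)).
      assert (EF : Fx x y t = fx x y t).
      { unfold Fx. destruct (cutoff_inside m x ltac:(lra)) as [-> ->]. ring. }
      assert (EG : Gy x' y t = gy x' y t).
      { unfold Gy. destruct (cutoff_inside m y ltac:(lra)) as [-> ->]. ring. }
      rewrite EF, EG.
      assert (Hd := Hdiv (tk k) t ltac:(lra) ltac:(rewrite <- (HtkS k); fold t; lra) ltac:(lra)
        ltac:(rewrite <- (HtkS k); fold t; lra) x y x' y ltac:(lra) ltac:(lra) ltac:(lra) ltac:(lra)).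
      replace (t - tk k) with h in Hd by (rewrite <- (HtkS k); fold t; ring).
      assert (HBx : h * Fx x y t <= 1) by (apply HBd; assumption).
      assert (HBy : h * Gy x' y t <= 1).
      { apply HBd; try assumption. apply Hbx; assumption. }
      rewrite EF in HBx. rewrite EG in HBy.
      apply Rle_trans with (exp (- (h * fx x y t)) * exp (- (h * gy x' y t))).
      + apply Rmult_le_compat; [lra | lra | |].
        * eapply Rle_trans; [|apply exp_ineq1_le]. lra.
        * eapply Rle_trans; [|apply exp_ineq1_le]. lra.
      + rewrite <- exp_plus.
        assert (Hle : - (h * fx x y t) + - (h * gy x' y t) <= gam (tk k) - gam t) by lra.
        destruct Hle as [Hlt|Heq]; [left; apply exp_increasing, Hlt | right; f_equal; exact Heq]. }
  assert (Hall : forall k, (k <= N)%nat ->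
    square_integral M rho <=
    exp (gam t0 - gam (tk k)) * square_integral M (transported F G h t0 rho k)).
  { induction k as [|k IH]; intros Hk.
    - unfold tk. simpl. rewrite Rmult_0_l, Rplus_0_r, Rminus_diag, exp_0, Rmult_1_l. apply Rle_refl.
    - eapply Rle_trans; [apply IH; lia|].
      replace (gam t0 - gam (tk (S k))) with ((gam t0 - gam (tk k)) + (gam (tk k) - gam (tk (S k)))) by ring.
      rewrite exp_plus, Rmult_assoc. apply Rmult_le_compat_l; [left; apply exp_pos|].
      apply Hstep. lia. }
  specialize (Hall N ltac:(lia)).
  replace (tk N) with T in Hall by (unfold tk; lra).
  assert (HM0 : 0 <= M) by (unfold M; lra).
  assert (Hub : square_integral M (transported F G h t0 rho N) <= 4 * M ^ 2).
  { replace (4 * M ^ 2) with (4 * M ^ 2 * 1) by ring. rewrite <- (square_integral_const M 1).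
    apply square_integral_le; [exact HM0 | | |].
    - intros. apply (cont2_transported _ _ _ _ _ _ _ _ _ _ _ _ _ _ HF HG); (assumption || lra).
    - intros. apply continuous_const.
    - intros. apply transported_bounds, Hr01. }
  apply Rle_trans with (exp (gam t0 - gam T) * square_integral M (transported F G h t0 rho N)
                        * exp (gam T - gam t0)).
  { apply Rmult_le_compat_r; [left; apply exp_pos | exact Hall]. }
  rewrite (Rmult_comm (exp (gam t0 - gam T))), Rmult_assoc, <- exp_plus.
  replace (gam t0 - gam T + (gam T - gam t0)) with 0 by ring. rewrite exp_0, Rmult_1_r.
  exact Hub.
Qed.

(** * Asymptotic expansions *)

Notation eventually_t P := (Rbar_locally p_infty P).

Lemma ev_and (P Q : R -> Prop) :
  eventually_t P -> eventually_t Q -> eventually_t (fun t => P t /\ Q t).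
Proof. apply filter_and. Qed.

Lemma ev_imp (P Q : R -> Prop) :
  (forall t, P t -> Q t) -> eventually_t P -> eventually_t Q.
Proof. apply filter_imp. Qed.

Lemma ev_ge (a : R) : eventually_t (fun t => a <= t).
Proof. exists a. intros; lra. Qed.

Definition tpow (q k : nat) (t : R) : R := Rpower t (- (INR k / INR q)).

Lemma tpow_pos q k t : 0 < tpow q k t.
Proof. apply exp_pos. Qed.

Lemma tpow_add q k l t : tpow q (k + l) t = tpow q k t * tpow q l t.
Proof. unfold tpow. rewrite <- Rpower_plus, plus_INR. f_equal. unfold Rdiv. ring. Qed.

Lemma Rpower_le_1 t e : 1 <= t -> e <= 0 -> Rpower t e <= 1.
Proof.
  intros Ht He. unfold Rpower. rewrite <- exp_0.
  assert (0 <= ln t) by (rewrite <- ln_1; apply ln_le; lra).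
  assert (Hle : e * ln t <= 0) by nra.
  destruct Hle as [H1|H1]; [left; apply exp_increasing, H1 | rewrite H1; right; reflexivity].
Qed.

Lemma Rpower_vanish (e eta : R) : e < 0 -> 0 < eta -> eventually_t (fun t => Rpower t e < eta).
Proof.
  intros He Heta. exists (Rmax 1 (Rpower eta (/ e))). intros t Ht.
  assert (Ht1 := Rle_lt_trans _ _ _ (Rmax_l _ _) Ht).
  assert (Ht2 := Rle_lt_trans _ _ _ (Rmax_r _ _) Ht).
  replace eta with (Rpower (Rpower eta (/ e)) e) at 1.
  - unfold Rpower at 1 2. apply exp_increasing.
    assert (ln (Rpower eta (/ e)) < ln t) by (apply ln_increasing; [apply exp_pos | exact Ht2]).
    nra.
  - rewrite Rpower_mult, Rinv_l, Rpower_1 by lra. reflexivity.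
Qed.

Lemma tpow_exponent q k : (1 <= q)%nat -> 0 <= INR k / INR q.
Proof.
  intros Hq. apply Rdiv_le_0_compat; [apply pos_INR | apply lt_0_INR; lia].
Qed.

Lemma tpow_le_1 q k t : (1 <= q)%nat -> 1 <= t -> tpow q k t <= 1.
Proof.
  intros Hq Ht. apply Rpower_le_1; [exact Ht|]. assert (H := tpow_exponent q k Hq). lra.
Qed.

Lemma tpow_le q k l t : (1 <= q)%nat -> 1 <= t -> (k <= l)%nat -> tpow q l t <= tpow q k t.
Proof.
  intros Hq Ht Hkl. replace l with (k + (l - k))%nat by lia. rewrite tpow_add.
  assert (H := tpow_le_1 q (l - k) t Hq Ht). assert (P := tpow_pos q k t). nra.
Qed.

Lemma tpow_vanish q k eta : (1 <= q)%nat -> (1 <= k)%nat -> 0 < eta ->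
  eventually_t (fun t => tpow q k t < eta).
Proof.
  intros Hq Hk He. apply Rpower_vanish; [|exact He].
  assert (0 < INR k / INR q) by (apply Rdiv_lt_0_compat; apply lt_0_INR; lia). lra.
Qed.

Lemma inv_le_tpow q n t : (1 <= q)%nat -> (n <= q)%nat -> 1 <= t -> / t <= tpow q n t.
Proof.
  intros Hq Hn Ht.
  replace (/ t) with (Rpower t (- (1))).
  - unfold tpow. apply Rle_Rpower; [exact Ht|].
    assert (INR n / INR q <= 1); [|lra].
    apply Rmult_le_reg_r with (INR q); [apply lt_0_INR; lia|].
    assert (INR n <= INR q) by (apply le_INR, Hn).
    replace (INR n / INR q * INR q) with (INR n); [lra|].
    field. apply not_0_INR. lia.
  - rewrite Rpower_Ropp, Rpower_1 by lra. reflexivity.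
Qed.

Lemma sum_n_m_leading (a : nat -> R) (n N : nat) :
  (1 <= n <= N)%nat -> (forall k, (1 <= k < n)%nat -> a k = 0) ->
  sum_n_m a 1 N = sum_n_m a n N.
Proof.
  intros Hn Ha. destruct (Nat.eq_dec n 1) as [->|Hne]; [reflexivity|].
  rewrite (sum_n_m_Chasles a 1 (n - 1) N) by lia.
  rewrite (sum_n_m_ext_loc a (fun _ => zero) 1 (n - 1)) by (intros k Hk; apply Ha; lia).
  rewrite (sum_n_m_const_zero (G := R_AbelianMonoid)), plus_zero_l.
  f_equal. lia.
Qed.

Lemma cont3_of_cont2 f x y t : cont2 f x y -> cont3 (fun x y _ => f x y) x y t.
Proof.
  intros H. apply (cont2_comp f (fun p : R * R * R => fst (fst p)) (fun p => snd (fst p)));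
    [apply cont3_fst | apply cont3_snd | exact H].
Qed.

Lemma smooth2_C1field (f : R -> R -> R) :
  (forall x y, ex_diff_n f 1 x y) ->
  C1field (fun x y _ => f x y) (fun x y _ => Derive (fun u => f u y) x)
    (fun x y _ => Derive (fun u => f x u) y) (fun _ _ _ => 0).
Proof.
  intros Hf. split; intros x y t Ht; destruct (Hf x y) as (Hc & Hx & Hy & [Hcx _] & [Hcy _]).
  - apply Derive_correct, Hx.
  - apply Derive_correct, Hy.
  - apply (is_derive_const (f x y)).
  - apply cont3_of_cont2, continuous_continuity_2d, Hc.
  - apply (cont3_of_cont2 (fun x y => Derive (fun u => f u y) x)), continuous_continuity_2d, Hcx.
  - apply (cont3_of_cont2 (fun x y => Derive (fun u => f x u) y)), continuous_continuity_2d, Hcy.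
  - apply continuous_const.
Qed.

Lemma lipschitz_at_origin (f : R -> R -> R) :
  (forall x y, ex_diff_n f 1 x y) ->
  exists L, 0 <= L /\ forall x y, Rabs x <= 1 -> Rabs y <= 1 ->
    Rabs (f x y - f 0 0) <= L * (Rabs x + Rabs y).
Proof.
  intros Hf.
  destruct (lipschitz_on_box _ _ _ _ 1 1 1 (smooth2_C1field f Hf) Rlt_0_1) as (L & HL & H).
  exists L. split; [exact HL|]. intros x y Hx Hy.
  specialize (H x y 1 0 0 1). rewrite !Rminus_0_r, Rminus_diag, !Rabs_R0, Rplus_0_r in H.
  apply H; lra.
Qed.

(** The omitted terms are smaller than the leading gauge by a factor [t^(-1/q)], and
    the leading coefficient is continuous at the origin. *)
Lemma leading_term q n f fk eta :
  (1 <= q)%nat -> (1 <= n)%nat -> unif_asymp_series q f fk ->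
  (forall k x y, (1 <= k < n)%nat -> fk k x y = 0) ->
  continuity_2d_pt (fk n) 0 0 -> 0 < eta ->
  exists r, 0 < r /\ eventually_t (fun t => forall x y, Rabs x <= r -> Rabs y <= r ->
    Rabs (f x y t - tpow q n t * fk n 0 0) <= eta * tpow q n t).
Proof.
  intros Hq Hn Hf Hz Hc Heta.
  destruct (Hc (mkposreal (eta / 2) ltac:(lra))) as [d Hd]. simpl in Hd.
  assert (Hd0 := cond_pos d).
  assert (Hm1 := Rmin_l 1 (d / 2)). assert (Hm2 := Rmin_r 1 (d / 2)).
  exists (Rmin 1 (d / 2)). split; [apply Rmin_glb_lt; lra|].
  destruct (Hf 1 n) as [C HC].
  assert (HA : 0 < Rabs C + 1) by (assert (P := Rabs_pos C); lra).
  assert (Hv := tpow_vanish q 1 (eta / 2 / (Rabs C + 1)) Hq (le_n 1) ltac:(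
    apply Rdiv_lt_0_compat; lra)).
  apply (ev_imp _ _) with (2 := ev_and _ _ HC Hv). clear HC Hv.
  intros t [H1 H2] x y Hx Hy. specialize (H1 x y ltac:(lra) ltac:(lra)).
  rewrite (sum_n_m_leading _ n n), sum_n_n in H1;
    [| lia | intros k Hk; rewrite Hz by exact Hk; apply Rmult_0_r].
  change (Rpower t (- (INR n / INR q))) with (tpow q n t) in H1.
  change (Rpower t (- (INR (S n) / INR q))) with (tpow q (S n) t) in H1.
  replace (S n) with (1 + n)%nat in H1 by lia. rewrite tpow_add in H1.
  specialize (Hd x y ltac:(rewrite Rminus_0_r; lra) ltac:(rewrite Rminus_0_r; lra)).
  assert (P := tpow_pos q n t). assert (P1 := tpow_pos q 1 t).
  set (s := tpow q n t) in *. set (s1 := tpow q 1 t) in *.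
  replace (f x y t - s * fk n 0 0)
    with ((f x y t - s * fk n x y) + s * (fk n x y - fk n 0 0)) by ring.
  eapply Rle_trans; [apply Rabs_triang|]. rewrite Rabs_mult, (Rabs_pos_eq s) by lra.
  assert (C * (s1 * s) <= eta / 2 * s).
  { assert (C * s1 <= eta / 2); [|nra].
    apply Rle_trans with ((Rabs C + 1) * s1).
    - apply Rmult_le_compat_r; [lra|]. assert (Q := Rle_abs C). lra.
    - apply Rlt_le. rewrite Rmult_comm.
      replace (eta / 2) with (eta / 2 / (Rabs C + 1) * (Rabs C + 1)) by (field; lra).
      apply Rmult_lt_compat_r; lra. }
  nra.
Qed.

(** On balls of the size of the leading gauge, freezing the Lipschitz coefficients
    at the origin costs the square of that gauge, as much as omitting the terms from
    [2 n] on. *)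
Lemma first_terms q n f fk :
  (1 <= q)%nat -> (1 <= n)%nat -> unif_asymp_series q f fk ->
  (forall k x y, (1 <= k < n)%nat -> fk k x y = 0) ->
  (forall k x y, (n <= k)%nat -> ex_diff_n (fk k) 1 x y) ->
  exists C, 0 <= C /\ eventually_t (fun t => forall x y, Rabs x <= 1 -> Rabs y <= 1 ->
    Rabs (f x y t - sum_n_m (fun k => tpow q k t * fk k 0 0) n (2 * n - 1)) <=
    C * (tpow q n t * (Rabs x + Rabs y) + tpow q (2 * n) t)).
Proof.
  intros Hq Hn Hf Hz Hd.
  assert (Hsum : forall j, exists L, 0 <= L /\ forall t x y, 1 <= t -> Rabs x <= 1 -> Rabs y <= 1 ->
    Rabs (sum_n_m (fun k => tpow q k t * fk k x y) n (n + j)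
          - sum_n_m (fun k => tpow q k t * fk k 0 0) n (n + j))
    <= L * (tpow q n t * (Rabs x + Rabs y))).
  { induction j as [|j (L & HL & IH)].
    - destruct (lipschitz_at_origin (fk n)) as (L & HL & H); [intros; apply Hd; lia|].
      exists L. split; [exact HL|]. intros t x y Ht Hx Hy. rewrite Nat.add_0_r, !sum_n_n.
      rewrite <- Rmult_minus_distr_l, Rabs_mult, (Rabs_pos_eq (tpow q n t))
        by (left; apply tpow_pos).
      specialize (H x y Hx Hy). assert (P := tpow_pos q n t). nra.
    - destruct (lipschitz_at_origin (fk (n + S j)%nat)) as (L' & HL' & H); [intros; apply Hd; lia|].
      exists (L + L'). split; [lra|]. intros t x y Ht Hx Hy.
      rewrite Nat.add_succ_r, !sum_n_Sm by lia. rewrite <- Nat.add_succ_r.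
      unfold plus; simpl.
      specialize (IH t x y Ht Hx Hy). specialize (H x y Hx Hy).
      assert (Hle := tpow_le q n (n + S j) t Hq Ht ltac:(lia)).
      assert (P := tpow_pos q (n + S j) t).
      set (s := tpow q (n + S j) t) in *.
      match goal with |- Rabs (?a + s * ?b - (?c + s * ?d)) <= _ =>
        replace (a + s * b - (c + s * d)) with ((a - c) + s * (b - d)) by ring end.
      eapply Rle_trans; [apply Rabs_triang|]. rewrite (Rabs_mult s), (Rabs_pos_eq s) by lra.
      assert (Q1 := Rabs_pos x). assert (Q2 := Rabs_pos y).
      assert (Q := Rabs_pos (fk (n + S j)%nat x y - fk (n + S j)%nat 0 0)).
      assert (s * Rabs (fk (n + S j)%nat x y - fk (n + S j)%nat 0 0)
              <= tpow q n t * (L' * (Rabs x + Rabs y))).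
      { apply Rmult_le_compat; lra. }
      lra. }
  destruct (Hsum (n - 1)%nat) as (L & HL & Hs). replace (n + (n - 1))%nat with (2 * n - 1)%nat in Hs by lia.
  destruct (Hf 1 (2 * n - 1)%nat) as [C HC].
  assert (PC := Rabs_pos C).
  exists (L + Rabs C). split; [lra|].
  apply (ev_imp _ _) with (2 := ev_and _ _ HC (ev_ge 1)). clear HC.
  intros t [H1 Ht] x y Hx Hy. specialize (H1 x y Hx Hy). specialize (Hs t x y Ht Hx Hy).
  rewrite (sum_n_m_leading _ n) in H1;
    [| lia | intros k Hk; rewrite Hz by exact Hk; apply Rmult_0_r].
  replace (S (2 * n - 1)) with (2 * n)%nat in H1 by lia.
  change (Rpower t (- (INR (2 * n) / INR q))) with (tpow q (2 * n) t) in H1.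
  change (fun k => Rpower t (- (INR k / INR q)) * fk k x y)
    with (fun k => tpow q k t * fk k x y) in H1.
  assert (P1 := tpow_pos q n t). assert (P2 := tpow_pos q (2 * n) t).
  assert (Q1 := Rabs_pos x). assert (Q2 := Rabs_pos y). assert (QC := Rle_abs C).
  match goal with |- Rabs (?a - ?c) <= _ =>
    match type of Hs with Rabs (?b - _) <= _ => replace (a - c) with ((a - b) + (b - c)) by ring end end.
  eapply Rle_trans; [apply Rabs_triang|].
  assert (0 <= tpow q n t * (Rabs x + Rabs y)) by (apply Rmult_le_pos; lra).
  nra.
Qed.

Lemma asymp_series_bound q n f a : (1 <= q)%nat ->
  asymp_series q n f a ->
  exists C, 0 <= C /\ eventually_t (fun t => Rabs (f t) <= C * tpow q n t).
Proof.
  intros Hq Hf. destruct (Hf n) as [C HC].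
  assert (PC := Rabs_pos C). assert (PA := Rabs_pos (a n)).
  exists (Rabs C + Rabs (a n)). split; [lra|].
  apply (ev_imp _ _) with (2 := ev_and _ _ HC (ev_ge 1)).
  intros t [H Ht]. rewrite sum_n_n in H.
  change (Rpower t (- (INR n / INR q))) with (tpow q n t) in H.
  change (Rpower t (- (INR (S n) / INR q))) with (tpow q (S n) t) in H.
  assert (Hle := tpow_le q n (S n) t Hq Ht ltac:(lia)).
  assert (P1 := tpow_pos q n t). assert (P2 := tpow_pos q (S n) t). assert (QC := Rle_abs C).
  replace (f t) with ((f t - tpow q n t * a n) + tpow q n t * a n) by ring.
  eapply Rle_trans; [apply Rabs_triang|]. rewrite (Rabs_mult (tpow q n t)), (Rabs_pos_eq (tpow q n t)) by lra.
  nra.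
Qed.

(** * The field of the perturbed system *)

Lemma C1field_add_y F Fx Fy Ft : C1field F Fx Fy Ft ->
  C1field (fun x y t => y + F x y t) Fx (fun x y t => 1 + Fy x y t) Ft.
Proof.
  intros [H1 H2 H3 H4 H5 H6 H7]. split; intros x y t Ht.
  - specialize (H1 x y t Ht).
    replace (Fx x y t) with (plus 0 (Fx x y t)) by apply Rplus_0_l.
    apply (is_derive_plus (fun _ => y) (fun u => F u y t)); [apply (is_derive_const y x) | exact H1].
  - apply (is_derive_plus (fun u => u) (fun u => F x u t)); [apply (is_derive_id (K := R_AbsRing)) | auto].
  - replace (Ft x y t) with (plus 0 (Ft x y t)) by apply Rplus_0_l.
    apply (is_derive_plus (fun _ => y) (fun u => F x y u)); [apply (is_derive_const y t) | auto].
  - apply (cont3_plus (fun _ y _ => y)); [apply cont3_snd | auto].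
  - auto.
  - apply (cont3_plus (fun _ _ _ => 1)); [apply continuous_const | auto].
  - auto.
Qed.

Lemma C1field_add_x p dp G Gx Gy Gt :
  (forall x, is_derive p x (dp x)) -> (forall x, continuous dp x) -> C1field G Gx Gy Gt ->
  C1field (fun x y t => p x + G x y t) (fun x y t => dp x + Gx x y t) Gy Gt.
Proof.
  intros Hp Hdp [H1 H2 H3 H4 H5 H6 H7]. split; intros x y t Ht.
  - apply (is_derive_plus p (fun u => G u y t)); auto.
  - replace (Gy x y t) with (plus 0 (Gy x y t)) by apply Rplus_0_l.
    apply (is_derive_plus (fun _ => p x) (fun u => G x u t)); [apply (is_derive_const (p x) y) | auto].
  - replace (Gt x y t) with (plus 0 (Gt x y t)) by apply Rplus_0_l.
    apply (is_derive_plus (fun _ => p x) (fun u => G x y u)); [apply (is_derive_const (p x) t) | auto].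
  - apply (cont3_plus (fun x _ _ => p x)); [|auto].
    apply cont3_of_x, (ex_derive_continuous p). eexists; apply Hp.
  - apply (cont3_plus (fun x _ _ => dp x)); [apply cont3_of_x, Hdp | auto].
  - auto.
  - auto.
Qed.

Lemma hamiltonian_dy H V x y l : (forall x y l, H x y l = y ^ 2 / 2 + V x l) -> d2 H x y l = y.
Proof.
  intros HV. unfold d2. rewrite (Derive_ext _ (fun u => u ^ 2 / 2 + V x l)) by (intros; apply HV).
  apply is_derive_unique. auto_derive; [exact I | field].
Qed.

Lemma hamiltonian_dx H V w x y l : (forall x y l, H x y l = y ^ 2 / 2 + V x l) ->
  (forall x l, is_derive (fun u => V u l) x ((x ^ 2 - l) * w x)) ->
  d1 H x y l = (x ^ 2 - l) * w x.
Proof.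
  intros HV HdV. unfold d1. rewrite (Derive_ext _ (fun u => y ^ 2 / 2 + V u l)) by (intros; apply HV).
  apply is_derive_unique.
  replace ((x ^ 2 - l) * w x) with (plus 0 ((x ^ 2 - l) * w x)) by apply Rplus_0_l.
  apply (is_derive_plus (fun _ => y ^ 2 / 2)); [apply (is_derive_const (y ^ 2 / 2) x) | apply HdV].
Qed.

(** Smoothness of [H] at the parameter value -1, where [x^2 - lambda] has no zero,
    gives smoothness of [w]. *)
Lemma weight_C1 H V w : (forall x y l, H x y l = y ^ 2 / 2 + V x l) ->
  (forall x l, is_derive (fun u => V u l) x ((x ^ 2 - l) * w x)) ->
  smooth3_on (fun _ _ _ => True) H ->
  exists dw, (forall x, is_derive w x (dw x)) /\ (forall x, continuous dw x).
Proof.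
  intros HV HdV HH.
  pose (h := fun x => d1 H x 0 (-1)). pose (dh := fun x => d1 (d1 H) x 0 (-1)).
  assert (Hh : forall x, is_derive h x (dh x)).
  { intros x. destruct (HH 2%nat x 0 (-1) I) as (_ & _ & _ & _ & (_ & H1 & _) & _).
    apply Derive_correct, H1. }
  assert (Hdh : forall x, continuous dh x).
  { intros x. destruct (HH 2%nat x 0 (-1) I) as (_ & _ & _ & _ & (_ & _ & _ & _ & (Hc & _) & _) & _).
    apply (cont3_comp (d1 (d1 H)) (fun u => u) (fun _ => 0) (fun _ => -1) x);
      [apply continuous_id | apply continuous_const | apply continuous_const | exact Hc]. }
  assert (Hw : forall x, h x / (x ^ 2 + 1) = w x).
  { intros x. unfold h. rewrite (hamiltonian_dx H V w) by assumption. field.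
    assert (P := pow2_ge_0 x). lra. }
  exists (fun x => (dh x * (x ^ 2 + 1) - h x * (2 * x)) / (x ^ 2 + 1) ^ 2). split.
  - intros x. apply (is_derive_ext _ _ _ _ Hw).
    assert (P := pow2_ge_0 x).
    auto_derive.
    + split; [eexists; apply Hh|]. split; [nra | exact I].
    + replace (Derive _ x) with (dh x) by (symmetry; exact (is_derive_unique _ _ _ (Hh x))).
      field. nra.
  - intros x. assert (P := pow2_ge_0 x).
    assert (Hpoly : forall k c : R, continuous (fun x => k * x ^ 2 + c) x).
    { intros k c. apply (ex_derive_continuous (fun x => k * x ^ 2 + c)). auto_derive. exact I. }
    assert (Hinv : continuous (fun x => / (x ^ 2 + 1) ^ 2) x).
    { apply (ex_derive_continuous (fun x => / (x ^ 2 + 1) ^ 2)). auto_derive. nra. }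
    apply (continuous_mult (K := R_AbsRing)); [|exact Hinv].
    apply (continuous_minus (V := R_NormedModule)); apply (continuous_mult (K := R_AbsRing)).
    + apply Hdh.
    + apply (ex_derive_continuous (fun x => x ^ 2 + 1)). auto_derive. exact I.
    + apply (ex_derive_continuous h). eexists; apply Hh.
    + apply (ex_derive_continuous (fun x => 2 * x)). auto_derive. exact I.
Qed.

Lemma bounded_on_halfline (f : R -> R) (t0 c : R) :
  (forall t, t0 <= t -> continuous f t) -> eventually_t (fun t => Rabs (f t) <= c) ->
  exists B, 0 <= B /\ forall t, t0 <= t -> Rabs (f t) <= B.
Proof.
  intros Hc [T HT].
  destruct (bounded_on_box (fun _ _ t => f t) 0 t0 (T + 1)) as (K & HK & HB).
  { intros x y t _ _ Ht. apply (continuous_comp (fun p : R * R * R => snd p) f).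
    - apply (continuous_snd (x, y) t).
    - apply Hc. simpl. lra. }
  exists (K + Rabs c). assert (P := Rabs_pos c). assert (P' := Rle_abs c).
  split; [lra|]. intros t Ht. destruct (Rle_dec t (T + 1)).
  - specialize (HB 0 0 t). rewrite Rabs_R0 in HB. specialize (HB ltac:(lra) ltac:(lra) ltac:(lra)). lra.
  - specialize (HT t ltac:(lra)). lra.
Qed.

(** * Instability from a positive divergence *)

Definition tent (delta c x : R) : R := Rmax 0 (1 - Rabs (x - c) / delta).

Lemma continuous_tent delta c x : continuous (tent delta c) x.
Proof.
  apply (continuous_comp (fun x => 1 - Rabs (x - c) / delta) (Rmax 0)); [|apply continuous_Rmax].
  apply (continuous_minus (V := R_NormedModule)); [apply continuous_const|].
  apply (continuous_scal_l (V := R_NormedModule) (fun x => Rabs (x - c))).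
  apply (continuous_Rabs_comp (fun x => x - c)).
  apply (ex_derive_continuous (fun x => x - c)). auto_derive. exact I.
Qed.

Lemma tent_bounds delta c x : 0 < delta -> 0 <= tent delta c x <= 1.
Proof.
  intros Hd. unfold tent. split; [apply Rmax_l|]. apply Rmax_lub; [lra|].
  assert (0 <= Rabs (x - c) / delta) by (apply Rdiv_le_0_compat; [apply Rabs_pos | lra]). lra.
Qed.

Lemma tent_support delta c x : 0 < delta -> tent delta c x <> 0 <-> Rabs (x - c) < delta.
Proof.
  intros Hd.
  assert (E : Rabs (x - c) = Rabs (x - c) / delta * delta) by (field; lra).
  unfold tent. split.
  - intros Hnz. apply Rnot_le_lt. intros Hle. apply Hnz, Rmax_left.
    assert (1 <= Rabs (x - c) / delta); [|lra].
    apply Rmult_le_reg_r with delta; lra.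
  - intros Hlt Hz. assert (Hm := Rmax_r 0 (1 - Rabs (x - c) / delta)). rewrite Hz in Hm. nra.
Qed.

Lemma tent_integral_pos delta c M : 0 < delta -> - M <= c - delta -> c + delta <= M ->
  0 < RInt (tent delta c) (- M) M.
Proof.
  intros Hd H1 H2.
  assert (Hex : forall a b, ex_RInt (tent delta c) a b)
    by (intros; apply ex_RInt_cont, continuous_tent).
  rewrite <- (RInt_Chasles (V := R_CompleteNormedModule) _ (- M) (c - delta) M) by apply Hex.
  rewrite <- (RInt_Chasles (V := R_CompleteNormedModule) _ (c - delta) (c + delta) M) by apply Hex.
  assert (P1 : 0 <= RInt (tent delta c) (- M) (c - delta)).
  { apply RInt_ge_0; [lra | apply Hex |]. intros; apply tent_bounds, Hd. }
  assert (P2 : 0 <= RInt (tent delta c) (c + delta) M).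
  { apply RInt_ge_0; [lra | apply Hex |]. intros; apply tent_bounds, Hd. }
  assert (P3 : 0 < RInt (tent delta c) (c - delta) (c + delta)).
  { apply RInt_gt_0; [lra | | intros; apply continuous_tent].
    intros x Hx. assert (Hs : Rabs (x - c) < delta) by (apply Rabs_def1; lra).
    apply tent_support in Hs; [|exact Hd]. assert (B := tent_bounds delta c x Hd).
    destruct (Rle_lt_or_eq_dec _ _ (proj1 B)); [assumption | congruence]. }
  unfold plus; simpl. lra.
Qed.

Lemma ln_increment t' t : 0 < t' -> t' <= t -> ln t - ln t' <= (t - t') / t'.
Proof.
  intros Ht' Htt. rewrite <- ln_div by lra.
  replace (t / t') with (1 + (t - t') / t') by (field; lra).
  assert (0 <= (t - t') / t') by (apply Rdiv_le_0_compat; lra).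
  replace ((t - t') / t') with (ln (exp ((t - t') / t'))) at 2 by apply ln_exp.
  apply ln_le; [lra | apply exp_ineq1_le].
Qed.

(** The divergence of the field is about [(A + D) * t^(-n/q)] near the origin, hence
    at least a constant times [1 / t] as [n <= q], whose integral diverges.  If the
    solution were stable, a small square of initial data would stay in a fixed box
    although its area tends to infinity. *)
Theorem unstable_of_positive_trace f fx fy ft g gx gy gt q n A D t0 (xs ys : R -> R) :
  C1field f fx fy ft -> C1field g gx gy gt -> (1 <= q)%nat -> (1 <= n <= q)%nat -> 0 < t0 ->
  0 < A + D ->
  (forall eta, 0 < eta -> exists r, 0 < r /\ eventually_t (fun t =>
     forall x y, Rabs x <= r -> Rabs y <= r ->
     Rabs (fx x y t - tpow q n t * A) <= eta * tpow q n t /\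
     Rabs (gy x y t - tpow q n t * D) <= eta * tpow q n t)) ->
  (forall t, t0 <= t -> continuous xs t /\ continuous ys t) ->
  (forall eta, 0 < eta -> eventually_t (fun t => Rabs (xs t) <= eta /\ Rabs (ys t) <= eta)) ->
  ~ (forall eps, 0 < eps -> exists delta, 0 < delta /\
       forall a b, Rabs (a - xs t0) < delta -> Rabs (b - ys t0) < delta ->
       exists X Y, X t0 = a /\ Y t0 = b /\ forall t, t0 <= t ->
         is_derive X t (f (X t) (Y t) t) /\ is_derive Y t (g (X t) (Y t) t) /\
         Rabs (X t - xs t) < eps /\ Rabs (Y t - ys t) < eps).
Proof.
  intros Hf Hg Hq Hn Ht0 Htr Hlead Hcont Hlim Hstab.
  set (tr := A + D) in *.
  destruct (Hlead (tr / 8) ltac:(lra)) as (r & Hr & Hdiv).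
  destruct (ev_and _ _ (ev_and _ _ Hdiv (Hlim (r / 2) ltac:(lra))) (ev_ge 1)) as [T0 HT0].
  clear Hdiv.
  assert (Hm1 := Rmax_l t0 (T0 + 1)). assert (Hm2 := Rmax_r t0 (T0 + 1)).
  set (T1 := Rmax t0 (T0 + 1)) in *.
  (* [3 eps <= r / 2], and the solution itself is eventually within [r / 2] of 0 *)
  pose (eps := r / 6). assert (Heps : 0 < eps) by (unfold eps; lra).
  destruct (Hstab eps Heps) as (delta' & Hdelta' & Hflow).
  pose (delta := Rmin delta' 1).
  assert (Hdelta : 0 < delta) by (apply Rmin_glb_lt; lra).
  assert (Hdl := Rmin_l delta' 1 : delta <= delta').
  assert (Hdr := Rmin_r delta' 1 : delta <= 1).
  destruct (bounded_on_halfline xs t0 1) as (B1 & HB1 & Bx).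
  { intros; apply Hcont; assumption. }
  { apply (ev_imp _ _) with (2 := Hlim 1 Rlt_0_1). intros t [H _]. exact H. }
  destruct (bounded_on_halfline ys t0 1) as (B2 & HB2 & By).
  { intros; apply Hcont; assumption. }
  { apply (ev_imp _ _) with (2 := Hlim 1 Rlt_0_1). intros t [_ H]. exact H. }
  pose (m := B1 + B2 + 3 * eps).
  assert (Hm : 0 <= m) by (unfold m; lra).
  destruct (bounded_on_box fx m t0 T1) as (C1 & HC1 & BF).
  { intros. apply (C1_cx _ _ _ _ Hf). lra. }
  destruct (bounded_on_box gy m t0 T1) as (C2 & HC2 & BG).
  { intros. apply (C1_cy _ _ _ _ Hg). lra. }
  (* The divergence is at least [tr / (2 t)]; one half is given away because the
     increment of [ln] over a step is compared with the value at its right end. *)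
  pose (k := tr / 4). assert (Hk : 0 < k) by (unfold k; lra).
  pose (C := C1 + C2 + k / t0).
  assert (HC : 0 < C) by (unfold C; assert (0 < k / t0) by (apply Rdiv_lt_0_compat; lra); lra).
  (* [k / t] bounds the divergence from below after [T1]; before, [- C1 - C2] does. *)
  pose (gam := fun t => k * ln t - C * Rmin t T1).
  pose (rho := fun x y => tent delta (xs t0) x * tent delta (ys t0) y).
  assert (Htube : forall t, t0 <= t -> Rabs (xs t) + 3 * eps <= m /\ Rabs (ys t) + 3 * eps <= m).
  { intros t Ht. specialize (Bx t Ht). specialize (By t Ht). unfold m. lra. }
  assert (Hnear : forall p c d, Rabs (p - c) <= 3 * eps -> Rabs c <= d -> Rabs p <= d + 3 * eps).
  { intros p c d H1 H2. replace p with (c + (p - c)) by ring.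
    eapply Rle_trans; [apply Rabs_triang|]. lra. }
  assert (Hgam : forall t' t, t0 <= t' -> t' <= t -> t - t' <= t0 -> forall x y x' y',
     Rabs (x - xs t) <= 3 * eps -> Rabs (y - ys t) <= 3 * eps ->
     Rabs (x' - xs t) <= 3 * eps -> Rabs (y' - ys t) <= 3 * eps ->
     gam t - gam t' <= (t - t') * (fx x y t + gy x' y' t)).
  { intros t' t Ht' Htt Hstep x y x' y' Hx Hy Hx' Hy'.
    assert (Hln := ln_increment t' t ltac:(lra) Htt).
    unfold gam. destruct (Rle_dec T1 t) as [HT|HT].
    - rewrite (Rmin_right t T1) by exact HT.
      assert (Hmin := Rmin_r t' T1).
      destruct (HT0 t ltac:(lra)) as [[Hd [Hxs Hys]] Ht1].
      assert (Ix := Hnear x _ _ Hx Hxs). assert (Iy := Hnear y _ _ Hy Hys).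
      assert (Ix' := Hnear x' _ _ Hx' Hxs). assert (Iy' := Hnear y' _ _ Hy' Hys).
      replace (r / 2 + 3 * eps) with r in * by (unfold eps; field).
      destruct (Hd x y Ix Iy) as [Hdx _]. destruct (Hd x' y' Ix' Iy') as [_ Hdy].
      apply Rabs_le_between in Hdx. apply Rabs_le_between in Hdy.
      assert (Hinv := inv_le_tpow q n t Hq (proj2 Hn) Ht1).
      set (s := tpow q n t) in *.
      assert (Hsum : 3 / 4 * tr * s <= fx x y t + gy x' y' t) by (unfold tr in *; lra).
      assert (Hlow : tr / 2 * / t <= fx x y t + gy x' y' t).
      { eapply Rle_trans; [|exact Hsum]. assert (0 < / t) by (apply Rinv_0_lt_compat; lra). nra. }
      assert (Hquot : (t - t') / t' <= 2 * ((t - t') * / t)).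
      { unfold Rdiv. replace (2 * ((t - t') * / t)) with ((t - t') * (2 * / t)) by ring.
        apply Rmult_le_compat_l; [lra|].
        apply Rmult_le_reg_r with (t * t'); [nra|].
        replace (/ t' * (t * t')) with t by (field; lra).
        replace (2 * / t * (t * t')) with (2 * t') by (field; lra). lra. }
      assert (k * (ln t - ln t') <= (t - t') * (tr / 2 * / t)).
      { apply Rle_trans with (k * (2 * ((t - t') * / t))).
        - apply Rmult_le_compat_l; lra.
        - unfold k. right. field. lra. }
      assert ((t - t') * (tr / 2 * / t) <= (t - t') * (fx x y t + gy x' y' t))
        by (apply Rmult_le_compat_l; lra).
      assert (0 <= C * (T1 - Rmin t' T1)) by (apply Rmult_le_pos; lra).
      lra.
    - rewrite (Rmin_left t T1), (Rmin_left t' T1) by lra.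
      specialize (Htube t ltac:(lra)).
      assert (Ix := Hnear x _ _ Hx (Rle_refl _)). assert (Iy := Hnear y _ _ Hy (Rle_refl _)).
      assert (Ix' := Hnear x' _ _ Hx' (Rle_refl _)). assert (Iy' := Hnear y' _ _ Hy' (Rle_refl _)).
      assert (Hdx := BF x y t ltac:(lra) ltac:(lra) ltac:(lra)).
      assert (Hdy := BG x' y' t ltac:(lra) ltac:(lra) ltac:(lra)).
      apply Rabs_le_between in Hdx. apply Rabs_le_between in Hdy.
      assert (Hln' : k * (ln t - ln t') <= (t - t') * (k / t0)).
      { apply Rle_trans with (k * ((t - t') / t')); [apply Rmult_le_compat_l; lra|].
        replace (k * ((t - t') / t')) with ((t - t') * (k * / t')) by (field; lra).
        apply Rmult_le_compat_l; [lra|]. apply Rmult_le_compat_l; [lra|].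
        apply Rinv_le_contravar; lra. }
      assert ((t - t') * (- (C1 + C2)) <= (t - t') * (fx x y t + gy x' y' t))
        by (apply Rmult_le_compat_l; lra).
      unfold C. nra. }
  assert (Hpos : 0 < square_integral (m + 1) rho).
  { unfold rho. rewrite square_integral_prod by (intros; apply continuous_tent).
    specialize (Bx t0 (Rle_refl _)). specialize (By t0 (Rle_refl _)).
    apply Rabs_le_between in Bx. apply Rabs_le_between in By.
    apply Rmult_lt_0_compat; apply tent_integral_pos; unfold m; lra. }
  set (I0 := square_integral (m + 1) rho) in *.
  pose (z := 4 * (m + 1) ^ 2 / I0).
  assert (Hz : 0 <= z) by (apply Rdiv_le_0_compat; [nra | exact Hpos]).
  pose (T := exp ((z + C * T1) / k + Rabs (ln t0)) + T1).
  assert (HTln : (z + C * T1) / k + Rabs (ln t0) <= ln T).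
  { replace ((z + C * T1) / k + Rabs (ln t0))
      with (ln (exp ((z + C * T1) / k + Rabs (ln t0)))) at 1 by apply ln_exp.
    apply ln_le; [apply exp_pos | unfold T; lra]. }
  assert (HTT : T1 < T) by (unfold T; assert (P := exp_pos ((z + C * T1) / k + Rabs (ln t0))); lra).
  assert (Hexp : z < exp (gam T - gam t0)).
  { eapply Rlt_le_trans; [|apply exp_ineq1_le].
    unfold gam. rewrite (Rmin_right T T1), (Rmin_left t0 T1) by lra.
    assert (Hab := Rle_abs (ln t0)).
    assert (k * ((z + C * T1) / k + Rabs (ln t0)) <= k * ln T) by (apply Rmult_le_compat_l; lra).
    replace (k * ((z + C * T1) / k + Rabs (ln t0))) with (z + C * T1 + k * Rabs (ln t0)) in *
      by (field; lra).
    assert (k * ln t0 <= k * Rabs (ln t0)) by (apply Rmult_le_compat_l; lra).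
    assert (0 < C * t0) by (apply Rmult_lt_0_compat; lra). lra. }
  assert (Hfinal := area_growth f fx fy ft g gx gy gt m t0 T eps t0 xs ys gam rho Hf Hg
    ltac:(lra) Heps Ht0 Hm).
  cut (I0 * exp (gam T - gam t0) <= 4 * (m + 1) ^ 2).
  { intros Hle. assert (Hlt : I0 * z < I0 * exp (gam T - gam t0)) by (apply Rmult_lt_compat_l; assumption).
    unfold z in Hlt. replace (I0 * (4 * (m + 1) ^ 2 / I0)) with (4 * (m + 1) ^ 2) in Hlt by (field; lra).
    lra. }
  apply Hfinal; clear Hfinal.
  - intros x y. apply (continuous_mult (K := R_AbsRing)).
    + apply (continuous_comp fst (tent delta (xs t0))); [apply (continuous_fst x y) | apply continuous_tent].
    + apply (continuous_comp snd (tent delta (ys t0))); [apply (continuous_snd x y) | apply continuous_tent].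
  - intros x y. unfold rho. assert (P1 := tent_bounds delta (xs t0) x Hdelta).
    assert (P2 := tent_bounds delta (ys t0) y Hdelta). nra.
  - intros a b Hab. unfold rho in Hab.
    destruct (Hflow a b) as (X & Y & E1 & E2 & HXY).
    + eapply Rlt_le_trans; [|exact Hdl]. apply tent_support; [exact Hdelta|].
      intros E; apply Hab; rewrite E; ring.
    + eapply Rlt_le_trans; [|exact Hdl]. apply tent_support; [exact Hdelta|].
      intros E; apply Hab; rewrite E; ring.
    + exists X, Y. split; [exact E1|]. split; [exact E2|]. intros t Ht. apply HXY. lra.
  - intros t Ht. apply Htube. lra.
  - intros t' t Ht' Htt HtT Hst. apply Hgam; assumption.
Qed.

(** * The Lyapunov function *)

(** Energy of the rescaled deviation.  The potential is kept up to the cubic term: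
    the restoring force is of order [sg], the damping only of order [sg^2], so that
    the quadratic part of the force is not a perturbation of the damping.  The mixed
    term distributes the damping evenly between kinetic and potential energy, so that
    only the sum of the two rates matters. *)
Definition energy (w0 c Om sg X Y : R) : R :=
  Y ^ 2 / 2 + Om * X ^ 2 / 2 + w0 * X ^ 3 / 3 + c * sg * X * Y.

Lemma Rabs_mult_le x y a b : Rabs x <= a -> Rabs y <= b -> Rabs (x * y) <= a * b.
Proof.
  intros Hx Hy. rewrite Rabs_mult. apply Rmult_le_compat; auto using Rabs_pos.
Qed.

Lemma Rabs_plus_le x y a b : Rabs x <= a -> Rabs y <= b -> Rabs (x + y) <= a + b.
Proof. intros Hx Hy. eapply Rle_trans; [apply Rabs_triang|]. lra. Qed.

Lemma quadratic_form_le al ga de K X Y :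
  Rabs al <= K -> Rabs ga <= K -> Rabs de <= K ->
  Rabs (al * X ^ 2 + ga * (X * Y) + de * Y ^ 2) <= 2 * K * (X ^ 2 + Y ^ 2).
Proof.
  intros H1 H2 H3.
  assert (HXY : Rabs (X * Y) <= (X ^ 2 + Y ^ 2) / 2).
  { apply Rabs_le_between. assert (P1 := pow2_ge_0 (X + Y)). assert (P2 := pow2_ge_0 (X - Y)). nra. }
  assert (HX : Rabs (X ^ 2) <= X ^ 2) by (rewrite Rabs_pos_eq; [lra | apply pow2_ge_0]).
  assert (HY : Rabs (Y ^ 2) <= Y ^ 2) by (rewrite Rabs_pos_eq; [lra | apply pow2_ge_0]).
  assert (B1 := Rabs_mult_le _ _ _ _ H1 HX). assert (B2 := Rabs_mult_le _ _ _ _ H2 HXY).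
  assert (B3 := Rabs_mult_le _ _ _ _ H3 HY).
  assert (B := Rabs_plus_le _ _ _ _ (Rabs_plus_le _ _ _ _ B1 B2) B3).
  assert (0 <= K) by (eapply Rle_trans; [apply Rabs_pos | exact H1]).
  assert (P1 := pow2_ge_0 X). assert (P2 := pow2_ge_0 Y). nra.
Qed.

Lemma energy_coercive (a w0 c : R) : 0 < a -> 0 <= w0 ->
  exists eta m K, 0 < eta /\ 0 < m /\ 0 < K /\ forall Om sg X Y,
    Rabs (Om - a) <= eta -> 0 <= sg <= eta -> Rabs X <= eta ->
    m * (X ^ 2 + Y ^ 2) <= energy w0 c Om sg X Y <= K * (X ^ 2 + Y ^ 2).
Proof.
  intros Ha Hw.
  set (k := 1 + w0 + Rabs c). assert (Pc := Rabs_pos c).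
  assert (Hmin : 0 < Rmin 1 a) by (apply Rmin_glb_lt; lra).
  assert (Hl := Rmin_l 1 a). assert (Hr := Rmin_r 1 a).
  set (m0 := Rmin 1 a) in *.
  exists (m0 / (8 * k)), (m0 / 4), (1 + a).
  assert (Hk : 0 < 8 * k) by (unfold k; lra).
  set (eta := m0 / (8 * k)).
  assert (Heta : 0 < eta) by (apply Rdiv_lt_0_compat; lra).
  repeat split; try lra.
  all: assert (E : Rabs (energy w0 c Om sg X Y - (Y ^ 2 / 2 + a * X ^ 2 / 2)) <= 2 * (eta * k) * (X ^ 2 + Y ^ 2)).
  1,3: replace (energy w0 c Om sg X Y - (Y ^ 2 / 2 + a * X ^ 2 / 2))
    with (((Om - a) / 2 + w0 * X / 3) * X ^ 2 + (c * sg) * (X * Y) + 0 * Y ^ 2)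
    by (unfold energy; field);
    apply quadratic_form_le;
    [ assert (B := Rabs_plus_le _ _ _ _ H (Rabs_mult_le w0 X w0 eta ltac:(rewrite Rabs_pos_eq; lra) H1));
      replace ((Om - a) / 2 + w0 * X / 3) with (/ 2 * (Om - a) + / 3 * (w0 * X)) by field;
      eapply Rle_trans; [apply Rabs_plus_le; (apply Rabs_mult_le;
        [rewrite Rabs_pos_eq; [apply Rle_refl | lra] | eassumption
         || (apply Rabs_mult_le; [rewrite Rabs_pos_eq; [apply Rle_refl | lra] | eassumption])])|];
      unfold k; nra
    | eapply Rle_trans; [apply Rabs_mult_le; [apply Rle_refl | rewrite Rabs_pos_eq; [apply H0 | lra]]|];
      unfold k; nra
    | rewrite Rabs_R0; nra ].
  all: replace (2 * (eta * k)) with (m0 / 4) in E by (unfold eta; field; unfold k; lra);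
    apply Rabs_le_between in E;
    assert (P1 := pow2_ge_0 X); assert (P2 := pow2_ge_0 Y); nra.
Qed.

(** The terms of order [sg] cancel because the potential is exact.  At order
    [mu = sg^2] the choice of [c] gives [Y^2] and [a X^2] the same rate [b], and all
    other terms carry a factor [eta]. *)
Lemma energy_decay (a w0 p s c b : R) : 0 < a -> 0 <= w0 -> b < 0 -> p - c = b -> s + c = b ->
  exists eta, 0 < eta <= 1 /\ forall mu sg X Y Om dOm dsg p' s' e1 e2 dX dY,
    0 < mu -> sg * sg = mu -> 0 <= sg <= eta -> Rabs (Om - a) <= eta ->
    Rabs dOm <= eta * mu -> Rabs dsg <= eta * mu ->
    Rabs (p' - p) <= eta -> Rabs (s' - s) <= eta -> Rabs e1 <= eta -> Rabs e2 <= eta ->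
    Rabs X <= eta ->
    dX = sg * Y + mu * (p' * X + e1 * Y) ->
    dY = - (sg * (Om * X + w0 * X ^ 2)) + mu * (s' * Y + e2 * X) ->
    Y * dY + (Om * X + w0 * X ^ 2) * dX + dOm * X ^ 2 / 2
    + c * (sg * dX * Y + sg * X * dY + dsg * X * Y) <= 0.
Proof.
  intros Ha Hw Hb Hp Hs.
  set (k := (1 + w0) * (Rabs p + 1) + a + 1 + Rabs c * (1 + w0 + 1)
            + (1 + a + w0) + Rabs c * (Rabs p + Rabs s + 3)).
  assert (Pp := Rabs_pos p). assert (Ps := Rabs_pos s). assert (Pc := Rabs_pos c).
  assert (Hk : 1 <= k).
  { unfold k. assert (0 <= (1 + w0) * (Rabs p + 1)) by (apply Rmult_le_pos; lra).
    assert (0 <= Rabs c * (1 + w0 + 1)) by (apply Rmult_le_pos; lra).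
    assert (0 <= Rabs c * (Rabs p + Rabs s + 3)) by (apply Rmult_le_pos; lra). lra. }
  assert (Hmin : 0 < Rmin 1 a) by (apply Rmin_glb_lt; lra).
  assert (Hl := Rmin_l 1 a). assert (Hr := Rmin_r 1 a).
  set (m0 := Rmin 1 a) in *.
  assert (Heta0 : 0 < - b * m0 / (2 * k)) by (apply Rdiv_lt_0_compat; nra).
  exists (Rmin 1 (- b * m0 / (2 * k))).
  assert (He1 := Rmin_l 1 (- b * m0 / (2 * k))). assert (He2 := Rmin_r 1 (- b * m0 / (2 * k))).
  assert (He : 0 < Rmin 1 (- b * m0 / (2 * k))) by (apply Rmin_glb_lt; lra).
  set (eta := Rmin 1 (- b * m0 / (2 * k))) in *.
  split; [lra|].
  intros mu sg X Y Om dOm dsg p' s' e1 e2 dX dY Hmu Hsg Hsgeta HOm HdOm Hdsg Hp' Hs' He1' He2' HX -> ->.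
  pose (d1 := dOm / mu). pose (d2 := dsg / mu).
  assert (E1 : dOm = mu * d1) by (unfold d1; field; lra).
  assert (E2 : dsg = mu * d2) by (unfold d2; field; lra).
  assert (Hd : forall z, Rabs (mu * z) <= eta * mu -> Rabs z <= eta).
  { intros z Hz. rewrite Rabs_mult, (Rabs_pos_eq mu) in Hz by lra.
    apply Rmult_le_reg_l with mu; lra. }
  rewrite E1 in *. rewrite E2 in *. apply Hd in HdOm. apply Hd in Hdsg.
  assert (Hsgabs : Rabs sg <= eta) by (rewrite Rabs_pos_eq; lra).
  assert (Bw0 : Rabs w0 <= w0) by (rewrite Rabs_pos_eq; lra).
  assert (Ba : Rabs a <= a) by (rewrite Rabs_pos_eq; lra).
  assert (Bp : Rabs p' <= Rabs p + 1).
  { replace p' with (p + (p' - p)) by ring. apply Rabs_plus_le; lra. }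
  assert (Bs : Rabs s' <= Rabs s + 1).
  { replace s' with (s + (s' - s)) by ring. apply Rabs_plus_le; lra. }
  assert (BwX := Rabs_mult_le w0 X w0 eta Bw0 HX).
  assert (B0 := Rabs_plus_le _ _ _ _ HOm BwX).
  assert (BOw : Rabs (Om + w0 * X) <= 1 + a + w0).
  { replace (Om + w0 * X) with (a + (Om - a + w0 * X)) by ring.
    eapply Rle_trans; [apply (Rabs_plus_le _ _ _ _ Ba B0)|]. nra. }
  pose (al := (Om - a + w0 * X) * p' + a * (p' - p) + d1 / 2 + (- c) * (Om - a + w0 * X) + c * (sg * e2)).
  pose (ga := e2 + e1 * (Om + w0 * X) + c * (sg * (p' + s')) + c * d2).
  pose (de := (s' - s) + c * (sg * e1)).
  assert (Bc : Rabs c <= Rabs c) by lra.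
  assert (Bnc : Rabs (- c) <= Rabs c) by (rewrite Rabs_Ropp; lra).
  assert (Bse : forall e, Rabs e <= eta -> Rabs (sg * e) <= eta).
  { intros e Hee. eapply Rle_trans; [apply (Rabs_mult_le _ _ _ _ Hsgabs Hee)|]. nra. }
  assert (Bal : Rabs al <= eta * k).
  { eapply Rle_trans.
    - apply (Rabs_plus_le _ _ _ _ (Rabs_plus_le _ _ _ _ (Rabs_plus_le _ _ _ _ (Rabs_plus_le _ _ _ _
        (Rabs_mult_le _ _ _ _ B0 Bp) (Rabs_mult_le _ _ _ _ Ba Hp'))
        (Rabs_mult_le d1 (/ 2) eta 1 HdOm ltac:(rewrite Rabs_pos_eq; lra)))
        (Rabs_mult_le _ _ _ _ Bnc B0)) (Rabs_mult_le _ _ _ _ Bc (Bse e2 He2'))).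
    - apply Rle_trans with (eta * ((1 + w0) * (Rabs p + 1) + a + 1 + Rabs c * (1 + w0 + 1))).
      + right. ring.
      + apply Rmult_le_compat_l; [lra|]. unfold k.
        assert (0 <= Rabs c * (Rabs p + Rabs s + 3)) by (apply Rmult_le_pos; lra). lra. }
  assert (Bga : Rabs ga <= eta * k).
  { eapply Rle_trans.
    - apply (Rabs_plus_le _ _ _ _ (Rabs_plus_le _ _ _ _ (Rabs_plus_le _ _ _ _
        He2' (Rabs_mult_le _ _ _ _ He1' BOw))
        (Rabs_mult_le _ _ _ _ Bc (Rabs_mult_le _ _ _ _ Hsgabs (Rabs_plus_le _ _ _ _ Bp Bs))))
        (Rabs_mult_le _ _ _ _ Bc Hdsg)).
    - apply Rle_trans with (eta * (1 + (1 + a + w0) + Rabs c * (Rabs p + Rabs s + 3))).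
      + right. ring.
      + apply Rmult_le_compat_l; [lra|]. unfold k.
        assert (0 <= (1 + w0) * (Rabs p + 1)) by (apply Rmult_le_pos; lra).
        assert (0 <= Rabs c * (1 + w0 + 1)) by (apply Rmult_le_pos; lra). lra. }
  assert (Bde : Rabs de <= eta * k).
  { eapply Rle_trans.
    - apply (Rabs_plus_le _ _ _ _ Hs' (Rabs_mult_le _ _ _ _ Bc (Bse e1 He1'))).
    - apply Rle_trans with (eta * (1 + Rabs c)).
      + right. ring.
      + apply Rmult_le_compat_l; [lra|]. unfold k.
        assert (0 <= (1 + w0) * (Rabs p + 1)) by (apply Rmult_le_pos; lra).
        assert (0 <= Rabs c * (1 + w0)) by (apply Rmult_le_pos; lra).
        assert (0 <= Rabs c * (Rabs p + Rabs s + 3)) by (apply Rmult_le_pos; lra). lra. }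
  assert (Err := quadratic_form_le al ga de (eta * k) X Y Bal Bga Bde).
  match goal with |- ?lhs <= 0 =>
    replace lhs with (mu * (b * (Y ^ 2 + a * X ^ 2) + (al * X ^ 2 + ga * (X * Y) + de * Y ^ 2))) end.
  2: { replace b with (p - c) at 1 by lra. unfold al, ga, de.
       replace p with (s + 2 * c) by lra. rewrite <- Hsg. field. }
  apply Rabs_le_between in Err. destruct Err as [_ Err].
  assert (H2k : 2 * (eta * k) <= - b * m0).
  { replace (- b * m0) with (2 * (- b * m0 / (2 * k) * k)) by (field; lra). nra. }
  assert (P1 := pow2_ge_0 X). assert (P2 := pow2_ge_0 Y).
  assert (b * (Y ^ 2 + a * X ^ 2) <= b * (m0 * (X ^ 2 + Y ^ 2))).
  { assert (m0 * (X ^ 2 + Y ^ 2) <= Y ^ 2 + a * X ^ 2) by nra. nra. }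
  assert (2 * (eta * k) * (X ^ 2 + Y ^ 2) <= - b * m0 * (X ^ 2 + Y ^ 2))
    by (apply Rmult_le_compat_r; lra).
  nra.
Qed.

(** * The rescaled equations *)

Lemma is_derive_tpow q k t : 0 < t ->
  is_derive (tpow q k) t (- (INR k / INR q) * tpow q k t / t).
Proof.
  intros Ht. unfold tpow, Rpower. set (e := INR k / INR q).
  auto_derive; [exact Ht | field; lra].
Qed.

Lemma tpow_half q n t : (1 <= q)%nat -> tpow (2 * q) n t * tpow (2 * q) n t = tpow q n t.
Proof.
  intros Hq. rewrite <- tpow_add. unfold tpow. f_equal.
  rewrite plus_INR, mult_INR. simpl. field. apply not_0_INR. lia.
Qed.

Lemma tpow_0 q t : tpow q 0 t = 1.
Proof.
  unfold tpow. simpl. unfold Rdiv. rewrite Rmult_0_l, Ropp_0. unfold Rpower.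
  rewrite Rmult_0_l. apply exp_0.
Qed.

Lemma tpow_one q t : (1 <= q)%nat -> 0 < t -> tpow q q t = / t.
Proof.
  intros Hq Ht. unfold tpow.
  replace (INR q / INR q) with 1 by (field; apply not_0_INR; lia).
  rewrite Rpower_Ropp, Rpower_1 by exact Ht. reflexivity.
Qed.

(** The logarithmic derivative of [t^(n/q)] is of the order of the damping exactly
    when [n = q]: this is where the Kronecker delta comes from. *)
Lemma dilation_rate q n eta : (1 <= n <= q)%nat -> 0 < eta ->
  eventually_t (fun t => Rabs (INR n / INR q / t - kron n q * tpow q n t) <= eta * tpow q n t).
Proof.
  intros Hn He. assert (Hq : (1 <= q)%nat) by lia. unfold kron. destruct (Nat.eq_dec n q) as [->|Hne].
  - apply (ev_imp _ _) with (2 := ev_ge 1). intros t Ht.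
    rewrite tpow_one by (lia || lra).
    replace (INR q / INR q / t - 1 * / t) with 0
      by (field; split; [lra | apply not_0_INR; lia]).
    rewrite Rabs_R0. assert (0 < / t) by (apply Rinv_0_lt_compat; lra). nra.
  - assert (Hv := tpow_vanish q (q - n) eta Hq ltac:(lia) He).
    apply (ev_imp _ _) with (2 := ev_and _ _ Hv (ev_ge 1)). intros t [H Ht].
    assert (E : / t = tpow q n t * tpow q (q - n) t).
    { rewrite <- tpow_add. replace (n + (q - n))%nat with q by lia. symmetry. apply tpow_one; [lia|lra]. }
    rewrite Rmult_0_l, Rminus_0_r. unfold Rdiv at 1. rewrite E.
    assert (P1 := tpow_pos q n t). assert (P2 := tpow_pos q (q - n) t).
    assert (Hr0 := tpow_exponent q n Hq).
    assert (Hr : INR n / INR q <= 1).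
    { apply Rmult_le_reg_r with (INR q); [apply lt_0_INR; lia|].
      assert (INR n <= INR q) by (apply le_INR; lia).
      replace (INR n / INR q * INR q) with (INR n); [lra|].
      field. apply not_0_INR. lia. }
    rewrite Rabs_pos_eq.
    2: { apply Rmult_le_pos; [exact Hr0|]. apply Rmult_le_pos; lra. }
    set (a := tpow q n t) in *. set (b := tpow q (q - n) t) in *. set (r := INR n / INR q) in *.
    assert (a * b <= a * eta) by (apply Rmult_le_compat_l; lra).
    assert (0 <= a * b) by (apply Rmult_le_pos; lra). nra.
Qed.

(** The rescaled frequency varies slowly enough for its derivative to be negligible
    against the damping: it is a finite sum of powers of [t] with constant leading
    term. *)
Lemma frequency q n om j : (1 <= q)%nat ->
  exists dOm, (forall t, 0 < t ->
     is_derive (fun t => sum_n_m (fun k => tpow q (k - n) t * om k) n (n + j)) t (dOm t)) /\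
   forall eta, 0 < eta -> eventually_t (fun t =>
     Rabs (sum_n_m (fun k => tpow q (k - n) t * om k) n (n + j) - om n) <= eta /\
     Rabs (dOm t) <= eta / t).
Proof.
  intros Hq. induction j as [|j (dOm & Hd & Hev)].
  - exists (fun _ => 0). split.
    + intros t Ht. apply (is_derive_ext (fun _ => om n)).
      * intros s. rewrite Nat.add_0_r, sum_n_n, Nat.sub_diag, tpow_0. symmetry; apply Rmult_1_l.
      * apply (is_derive_const (om n)).
    + intros eta He. apply (ev_imp _ _) with (2 := ev_ge 1). intros t Ht.
      rewrite Nat.add_0_r, sum_n_n, Nat.sub_diag, tpow_0, Rmult_1_l, Rminus_diag, !Rabs_R0.
      split; [lra|]. apply Rdiv_le_0_compat; lra.
  - assert (Esum : forall t, sum_n_m (fun k => tpow q (k - n) t * om k) n (n + S j)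
        = sum_n_m (fun k => tpow q (k - n) t * om k) n (n + j) + om (n + S j)%nat * tpow q (S j) t).
    { intros t. rewrite Nat.add_succ_r, sum_n_Sm by lia.
      replace (S (n + j) - n)%nat with (S j) by lia. rewrite (Rmult_comm (om _)). reflexivity. }
    set (z := om (n + S j)%nat) in *.
    set (e := INR (S j) / INR q).
    assert (He0 : 0 <= e) by (apply tpow_exponent, Hq).
    exists (fun t => dOm t + z * (- e * tpow q (S j) t / t)). split.
    + intros t Ht. eapply is_derive_ext; [intros s; symmetry; apply Esum|].
      apply (is_derive_plus (fun t => sum_n_m (fun k => tpow q (k - n) t * om k) n (n + j))
               (fun t => z * tpow q (S j) t)); [apply Hd, Ht|].
      apply (is_derive_scal (tpow q (S j))), is_derive_tpow, Ht.
    + intros eta He. assert (Pz := Rabs_pos z).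
      assert (Hb : 0 < (Rabs z + 1) * (e + 1)) by nra.
      assert (Hv := tpow_vanish q (S j) (eta / 2 / ((Rabs z + 1) * (e + 1))) Hq ltac:(lia)
        ltac:(apply Rdiv_lt_0_compat; lra)).
      apply (ev_imp _ _) with (2 := ev_and _ _ (ev_and _ _ (Hev (eta / 2) ltac:(lra)) Hv) (ev_ge 1)).
      intros t [[[H1 H2] H3] Ht]. rewrite Esum.
      assert (P := tpow_pos q (S j) t). set (s := tpow q (S j) t) in *.
      assert (Hs : (Rabs z + 1) * (e + 1) * s <= eta / 2).
      { apply Rlt_le. replace (eta / 2) with (eta / 2 / ((Rabs z + 1) * (e + 1)) * ((Rabs z + 1) * (e + 1)))
          by (field; lra). rewrite Rmult_comm. apply Rmult_lt_compat_r; assumption. }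
      assert (Ps : 0 <= Rabs z * s) by (apply Rmult_le_pos; lra).
      assert (Pes : 0 <= e * s) by (apply Rmult_le_pos; lra).
      assert (Pzes : 0 <= Rabs z * (e * s)) by (apply Rmult_le_pos; lra).
      split.
      * match goal with |- Rabs (?x + _ - _) <= _ =>
          replace (x + z * s - om n) with ((x - om n) + z * s) by ring end.
        eapply Rle_trans; [apply Rabs_triang|]. rewrite Rabs_mult, (Rabs_pos_eq s) by lra. nra.
      * eapply Rle_trans; [apply Rabs_triang|].
        replace (z * (- e * s / t)) with (- (z * (e * s) * / t)) by (field; lra).
        assert (Hti : 0 < / t) by (apply Rinv_0_lt_compat; lra).
        rewrite Rabs_Ropp, !Rabs_mult, (Rabs_pos_eq (/ t)), (Rabs_pos_eq e), (Rabs_pos_eq s) by lra.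
        unfold Rdiv in *. assert (Rabs z * (e * s) * / t <= eta * / 2 * / t); [|lra].
        apply Rmult_le_compat_r; nra.
Qed.

(** The force [x^2 w(x)] differs from [w(0) x^2] by a function whose slope is
    [O(x^2)]; on balls of the size of the leading gauge this is below the damping. *)
Lemma force_remainder w dw : (forall x, is_derive w x (dw x)) -> (forall x, continuous dw x) ->
  exists K, 0 <= K /\ forall x x' rho, Rabs x <= rho -> Rabs x' <= rho -> rho <= 1 ->
    exists e, Rabs e <= K * rho ^ 2 /\
      x' ^ 2 * w x' - x ^ 2 * w x = w 0 * (x' ^ 2 - x ^ 2) + e * (x' - x).
Proof.
  intros Hw Hdw.
  destruct (bounded_on_box (fun x _ _ => dw x) 1 0 0) as (K & HK & B).
  { intros. apply cont3_of_x, Hdw. }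
  assert (B' : forall z, Rabs z <= 1 -> Rabs (dw z) <= K).
  { intros z Hz. apply (B z 0 0); rewrite ?Rabs_R0; lra. }
  exists (3 * K). split; [lra|]. intros x x' rho Hx Hx' Hrho.
  assert (Hx0 := Rabs_pos x).
  destruct (mean_value (fun z => z ^ 2 * (w z - w 0)) (fun z => 2 * z * (w z - w 0) + z ^ 2 * dw z)
    (- rho) rho x x') as (c & Hc & _ & E).
  - intros z _. auto_derive; [eexists; apply Hw|].
    replace (Derive _ z) with (dw z) by (symmetry; exact (is_derive_unique _ _ _ (Hw z))). ring.
  - apply Rabs_le_between, Hx.
  - apply Rabs_le_between, Hx'.
  - exists (2 * c * (w c - w 0) + c ^ 2 * dw c). split; [|lra].
    destruct (mean_value w dw (- rho) rho 0 c) as (c' & Hc' & _ & E'); try lra.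
    { intros; apply Hw. }
    assert (Hc1 : Rabs c <= rho) by (apply Rabs_le_between, Hc).
    assert (Hc'1 : Rabs c' <= rho) by (apply Rabs_le_between, Hc').
    assert (Bc := B' c ltac:(lra)). assert (Bc' := B' c' ltac:(lra)).
    rewrite E', Rminus_0_r.
    replace (2 * c * (dw c' * c) + c ^ 2 * dw c) with ((c * c) * (2 * dw c' + dw c)) by ring.
    replace (3 * K * rho ^ 2) with ((rho * rho) * (2 * K + K)) by ring.
    apply Rabs_mult_le; [apply Rabs_mult_le; assumption|].
    apply Rabs_plus_le; [|assumption]. apply Rabs_mult_le; [rewrite Rabs_pos_eq; lra | assumption].
Qed.

Lemma sum_n_m_lincomb (c al be : nat -> R) k n N :
  sum_n_m (fun i => c i * (k * al i - be i)) n N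
  = k * sum_n_m (fun i => c i * al i) n N - sum_n_m (fun i => c i * be i) n N :> R.
Proof.
  assert (E : sum_n_m (fun i => c i * (k * al i - be i) + c i * be i) n N
    = sum_n_m (fun i => c i * (k * al i - be i)) n N + sum_n_m (fun i => c i * be i) n N :> R)
    by exact (sum_n_m_plus (G := R_AbelianMonoid) _ _ n N).
  assert (E' : sum_n_m (fun i => c i * (k * al i - be i) + c i * be i) n N
    = k * sum_n_m (fun i => c i * al i) n N :> R).
  { etransitivity; [|exact (sum_n_m_mult_l (K := R_Ring) k (fun i => c i * al i) n N)].
    apply sum_n_m_ext. intros i.
    change (c i * (k * al i - be i) + c i * be i = k * (c i * al i) :> R). ring. }
  lra.
Qed.

Lemma increment_2d F Fx Fy Ft r t x y u v : C1field F Fx Fy Ft -> 0 < t ->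
  Rabs x <= r -> Rabs y <= r -> Rabs (x + u) <= r -> Rabs (y + v) <= r ->
  exists c d, Rabs c <= r /\ Rabs d <= r /\
    F (x + u) (y + v) t - F x y t = Fx c (y + v) t * u + Fy x d t * v.
Proof.
  intros HF Ht Hx Hy Hxu Hyv.
  apply Rabs_le_between in Hx. apply Rabs_le_between in Hy.
  apply Rabs_le_between in Hxu. apply Rabs_le_between in Hyv.
  destruct (mean_value (fun z => F z (y + v) t) (fun z => Fx z (y + v) t) (- r) r x (x + u))
    as (c & Hc & _ & E1); try assumption.
  { intros. apply (C1_dx _ _ _ _ HF), Ht. }
  destruct (mean_value (fun z => F x z t) (fun z => Fy x z t) (- r) r y (y + v))
    as (d & Hd & _ & E2); try assumption.
  { intros. apply (C1_dy _ _ _ _ HF), Ht. }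
  exists c, d. split; [apply Rabs_le_between, Hc|]. split; [apply Rabs_le_between, Hd|].
  replace (Fx c (y + v) t * u) with (Fx c (y + v) t * (x + u - x)) by ring.
  replace (Fy x d t * v) with (Fy x d t * (y + v - y)) by ring.
  rewrite <- E1, <- E2. ring.
Qed.

(** The equations of the deviation from [(xs, ys)], in the variables
    [X = u / sigma^2], [Y = v / sigma^3] with [sigma = t^(-n/(2q))].  All coefficients
    are exhibited by the mean value theorem, and their distance to the limit values is
    read off the expansions. *)
Lemma rescaled_increments q n w dw F Fx Fy Ft G Gx Gy Gt A A' D (B xk : nat -> R) (xs ys : R -> R) :
  (1 <= n)%nat -> (1 <= q)%nat ->
  (forall x, is_derive w x (dw x)) -> (forall x, continuous dw x) ->
  C1field F Fx Fy Ft -> C1field G Gx Gy Gt ->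
  (forall eta, 0 < eta -> exists r, 0 < r /\ eventually_t (fun t =>
     forall x y, Rabs x <= r -> Rabs y <= r ->
     Rabs (Fx x y t - tpow q n t * A) <= eta * tpow q n t /\
     Rabs (Fy x y t - tpow q n t * A') <= eta * tpow q n t /\
     Rabs (Gy x y t - tpow q n t * D) <= eta * tpow q n t)) ->
  (exists C, 0 <= C /\ eventually_t (fun t => forall x y, Rabs x <= 1 -> Rabs y <= 1 ->
    Rabs (Gx x y t - sum_n_m (fun k => tpow q k t * B k) n (2 * n - 1)) <=
    C * (tpow q n t * (Rabs x + Rabs y) + tpow q (2 * n) t))) ->
  (exists C, 0 <= C /\ eventually_t (fun t =>
     Rabs (xs t) <= C * tpow q n t /\ Rabs (ys t) <= C * tpow q n t /\
     Rabs (xs t - sum_n_m (fun k => tpow q k t * xk k) n (2 * n - 1)) <= C * tpow q (2 * n) t)) ->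
  forall eta, 0 < eta -> eventually_t (fun t => forall X Y, Rabs X <= 1 -> Rabs Y <= 1 ->
    let sg := tpow (2 * q) n t in
    let mu := sg * sg in
    let Om := sum_n_m (fun k => tpow q (k - n) t * (2 * w 0 * xk k - B k)) n (2 * n - 1) in
    exists p s e1 e2,
      Rabs (p - A) <= eta /\ Rabs (s - D) <= eta /\ Rabs e1 <= eta /\ Rabs e2 <= eta /\
      F (xs t + mu * X) (ys t + sg * mu * Y) t - F (xs t) (ys t) t
        = mu * mu * (p * X + e1 * Y) /\
      - ((xs t + mu * X) ^ 2 * w (xs t + mu * X)) + G (xs t + mu * X) (ys t + sg * mu * Y) t
      - (- (xs t ^ 2 * w (xs t)) + G (xs t) (ys t) t)
        = - (mu * mu * (Om * X + w 0 * X ^ 2)) + mu * (sg * mu) * (s * Y + e2 * X)).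
Proof.
  intros Hn Hq Hw Hdw HF HG Hlead (C1 & HC1 & HGx) (C2 & HC2 & Hxs) eta Heta.
  destruct (force_remainder w dw Hw Hdw) as (K & HK & Hforce).
  destruct (Hlead eta Heta) as (r & Hr & Hl). clear Hlead.
  pose (r' := Rmin r 1). assert (Hr' : 0 < r') by (apply Rmin_glb_lt; lra).
  assert (Hr1 := Rmin_l r 1 : r' <= r). assert (Hr2 := Rmin_r r 1 : r' <= 1).
  pose (C := 2 * Rabs (w 0) * C2 + K * (C2 + 1) ^ 2 + C1 * (2 * (C2 + 1) + 1)).
  assert (Pw := Rabs_pos (w 0)). assert (PA := Rabs_pos A').
  assert (HC : 0 <= C).
  { unfold C. assert (0 <= Rabs (w 0) * C2) by nra. assert (0 <= K * (C2 + 1) ^ 2) by nra.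
    assert (0 <= C1 * (2 * (C2 + 1) + 1)) by nra. lra. }
  assert (Hv1 := tpow_vanish q n (r' / (C2 + 1)) Hq Hn ltac:(apply Rdiv_lt_0_compat; lra)).
  assert (Hv2 := tpow_vanish (2 * q) n (eta / (C + Rabs A' + eta + 1)) ltac:(lia) Hn
    ltac:(apply Rdiv_lt_0_compat; lra)).
  apply (ev_imp _ _) with (2 := ev_and _ _ (ev_and _ _ Hl (ev_and _ _ HGx Hxs))
    (ev_and _ _ (ev_and _ _ Hv1 Hv2) (ev_ge 1))).
  clear Hl HGx Hxs Hv1 Hv2.
  intros t [[Hl [HGx (Hx & Hy & Hxhat)]] [[Hv1 Hv2] Ht]] X Y HX HY sg mu Om.
  assert (Psg : 0 < sg) by apply tpow_pos.
  assert (Emu : tpow q n t = mu) by (symmetry; apply tpow_half, Hq).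
  assert (E2n : tpow q (2 * n) t = mu * mu).
  { replace (2 * n)%nat with (n + n)%nat by lia. rewrite tpow_add, Emu. reflexivity. }
  rewrite Emu in *. rewrite E2n in *. fold sg in Hv2.
  assert (Pmu : 0 < mu) by (unfold mu; nra).
  assert (Hsg1 : sg <= 1) by (apply tpow_le_1; [lia | lra]).
  set (x := xs t) in *. set (y := ys t) in *.
  set (u := mu * X). set (v := sg * mu * Y).
  assert (Hu : Rabs u <= mu).
  { unfold u. rewrite Rabs_mult, (Rabs_pos_eq mu) by lra. nra. }
  assert (Hvv : Rabs v <= mu).
  { unfold v. rewrite !Rabs_mult, (Rabs_pos_eq sg), (Rabs_pos_eq mu) by lra.
    assert (sg * mu <= mu) by nra. assert (0 <= sg * mu) by nra. nra. }
  pose (rr := (C2 + 1) * mu).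
  assert (Hrr : rr <= r').
  { unfold rr. apply Rlt_le. replace r' with (r' / (C2 + 1) * (C2 + 1)) by (field; lra).
    rewrite Rmult_comm. apply Rmult_lt_compat_r; lra. }
  assert (Bx : Rabs x <= rr) by (unfold rr; lra).
  assert (By : Rabs y <= rr) by (unfold rr; lra).
  assert (Bxu : Rabs (x + u) <= rr).
  { unfold rr. eapply Rle_trans; [apply Rabs_triang|]. lra. }
  assert (Byv : Rabs (y + v) <= rr).
  { unfold rr. eapply Rle_trans; [apply Rabs_triang|]. lra. }
  destruct (increment_2d F _ _ _ rr t x y u v HF ltac:(lra) Bx By Bxu Byv) as (c & d & Bc & Bd & EF).
  destruct (increment_2d G _ _ _ rr t x y u v HG ltac:(lra) Bx By Bxu Byv) as (c' & d' & Bc' & Bd' & EG).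
  destruct (Hforce x (x + u) rr Bx Bxu ltac:(lra)) as (e & Be & EP).
  destruct (Hl c (y + v) ltac:(lra) ltac:(lra)) as (Lx & _ & _).
  destruct (Hl x d ltac:(lra) ltac:(lra)) as (_ & Ly & _).
  destruct (Hl x d' ltac:(lra) ltac:(lra)) as (_ & _ & Lgy).
  specialize (HGx c' (y + v) ltac:(lra) ltac:(lra)).
  assert (Hdivmu : forall z z0, Rabs (z - mu * z0) <= eta * mu -> Rabs (z / mu - z0) <= eta).
  { intros z z0 H. replace (z / mu - z0) with ((z - mu * z0) * / mu) by (field; lra).
    rewrite Rabs_mult, (Rabs_pos_eq (/ mu)) by (left; apply Rinv_0_lt_compat; lra).
    apply Rmult_le_reg_r with mu; [lra|]. rewrite Rmult_assoc, Rinv_l by lra. lra. }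
  set (W := 2 * w 0 * (sum_n_m (fun k => tpow q k t * xk k) n (2 * n - 1) - x) - e
            + (Gx c' (y + v) t - sum_n_m (fun k => tpow q k t * B k) n (2 * n - 1))).
  assert (EOm : mu * Om = 2 * w 0 * sum_n_m (fun k => tpow q k t * xk k) n (2 * n - 1)
                          - sum_n_m (fun k => tpow q k t * B k) n (2 * n - 1)).
  { rewrite <- sum_n_m_lincomb. unfold Om.
    etransitivity; [symmetry; exact (sum_n_m_mult_l (K := R_Ring) mu _ n (2 * n - 1))|].
    apply sum_n_m_ext_loc. intros k Hk. unfold mult; simpl.
    rewrite <- Emu, <- Rmult_assoc, <- tpow_add.
    replace (n + (k - n))%nat with k by lia. reflexivity. }
  assert (BW : Rabs W <= C * (mu * mu)).
  { unfold W.
    assert (B1 : Rabs (2 * w 0 * (sum_n_m (fun k => tpow q k t * xk k) n (2 * n - 1) - x))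
                 <= 2 * Rabs (w 0) * (C2 * (mu * mu))).
    { apply Rabs_mult_le; [rewrite Rabs_mult, (Rabs_pos_eq 2); lra|].
      rewrite Rabs_minus_sym. exact Hxhat. }
    assert (B2 : Rabs (- e) <= K * (C2 + 1) ^ 2 * (mu * mu)).
    { rewrite Rabs_Ropp. eapply Rle_trans; [exact Be|]. unfold rr. right. ring. }
    eapply Rle_trans; [apply (Rabs_plus_le _ _ _ _ (Rabs_plus_le _ _ _ _ B1 B2) HGx)|].
    assert (mu * (Rabs c' + Rabs (y + v)) <= mu * (2 * (C2 + 1) * mu)).
    { apply Rmult_le_compat_l; [lra|]. unfold rr in *. lra. }
    unfold C.
    assert (C1 * (mu * (Rabs c' + Rabs (y + v)) + mu * mu)
            <= C1 * (mu * (2 * (C2 + 1) * mu) + mu * mu)) by (apply Rmult_le_compat_l; lra).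
    nra. }
  assert (Hsmall : sg * (C + Rabs A' + eta + 1) <= eta).
  { apply Rlt_le. replace eta with (eta / (C + Rabs A' + eta + 1) * (C + Rabs A' + eta + 1)) at 2
      by (field; lra). apply Rmult_lt_compat_r; lra. }
  assert (PC : 0 <= sg * C) by (apply Rmult_le_pos; lra).
  assert (PAs : 0 <= sg * Rabs A') by (apply Rmult_le_pos; lra).
  assert (Pes : 0 <= sg * eta) by (apply Rmult_le_pos; lra).
  exists (Fx c (y + v) t / mu), (Gy x d' t / mu), (sg * (Fy x d t / mu)), (W / (sg * mu)).
  split; [apply Hdivmu, Lx|]. split; [apply Hdivmu, Lgy|]. split; [|split; [|split]].
  - apply Hdivmu in Ly. rewrite Rabs_mult, (Rabs_pos_eq sg) by lra.
    assert (Rabs (Fy x d t / mu) <= Rabs A' + eta).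
    { replace (Fy x d t / mu) with (A' + (Fy x d t / mu - A')) by ring.
      apply Rabs_plus_le; lra. }
    assert (sg * Rabs (Fy x d t / mu) <= sg * (Rabs A' + eta)) by (apply Rmult_le_compat_l; lra).
    lra.
  - unfold Rdiv. rewrite Rabs_mult, (Rabs_pos_eq (/ (sg * mu)))
      by (left; apply Rinv_0_lt_compat; nra).
    apply Rle_trans with (C * (mu * mu) * / (sg * mu)).
    + apply Rmult_le_compat_r; [left; apply Rinv_0_lt_compat; nra | exact BW].
    + replace (C * (mu * mu) * / (sg * mu)) with (sg * C) by (unfold mu; field; lra). lra.
  - rewrite EF. unfold u, v. field. lra.
  - replace (- ((x + u) ^ 2 * w (x + u)) + G (x + u) (y + v) t - (- (x ^ 2 * w x) + G x y t))
      with (- ((x + u) ^ 2 * w (x + u) - x ^ 2 * w x) + (G (x + u) (y + v) t - G x y t)) by ring.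
    rewrite EP, EG.
    replace (mu * mu * (Om * X + w 0 * X ^ 2)) with (mu * Om * (mu * X) + w 0 * (mu * X) ^ 2) by ring.
    rewrite EOm. unfold W, u, v. field. lra.
Qed.

Lemma is_derive_energy w0 c (Om sg X Y : R -> R) t dOm dsg dX dY :
  is_derive Om t dOm -> is_derive sg t dsg -> is_derive X t dX -> is_derive Y t dY ->
  is_derive (fun t => energy w0 c (Om t) (sg t) (X t) (Y t)) t
    (Y t * dY + (Om t * X t + w0 * X t ^ 2) * dX + dOm * X t ^ 2 / 2
     + c * (sg t * dX * Y t + sg t * X t * dY + dsg * X t * Y t)).
Proof.
  intros H1 H2 H3 H4. unfold energy.
  auto_derive.
  - repeat split; eexists; eassumption.
  - assert (E1 : Derive (fun t => Om t) t = dOm) by exact (is_derive_unique _ _ _ H1).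
    assert (E2 : Derive (fun t => sg t) t = dsg) by exact (is_derive_unique _ _ _ H2).
    assert (E3 : Derive (fun t => X t) t = dX) by exact (is_derive_unique _ _ _ H3).
    assert (E4 : Derive (fun t => Y t) t = dY) by exact (is_derive_unique _ _ _ H4).
    rewrite E1, E2, E3, E4. field.
Qed.

Lemma is_derive_rescaled (u v sg : R -> R) t du dv k :
  is_derive u t du -> is_derive v t dv -> is_derive sg t (- (k / 2) * sg t) -> 0 < sg t ->
  is_derive (fun t => u t / (sg t * sg t)) t (du / (sg t * sg t) + k * (u t / (sg t * sg t))) /\
  is_derive (fun t => v t / (sg t * (sg t * sg t))) t
    (dv / (sg t * (sg t * sg t)) + 3 / 2 * k * (v t / (sg t * (sg t * sg t)))).
Proof.
  intros H1 H2 H3 Hp.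
  assert (E1 : Derive (fun t => u t) t = du) by exact (is_derive_unique _ _ _ H1).
  assert (E2 : Derive (fun t => v t) t = dv) by exact (is_derive_unique _ _ _ H2).
  assert (E3 : Derive (fun t => sg t) t = - (k / 2) * sg t) by exact (is_derive_unique _ _ _ H3).
  assert (N : sg t * sg t <> 0) by nra.
  assert (N' : sg t * (sg t * sg t) <> 0) by (apply Rmult_integral_contrapositive; split; lra).
  split; auto_derive.
  - repeat split; try (eexists; eassumption); assumption.
  - rewrite E1, E3. field. lra.
  - repeat split; try (eexists; eassumption); assumption.
  - rewrite E2, E3. field. lra.
Qed.

Lemma nonincreasing_of_ex_derive (f : R -> R) (a b : R) : a <= b ->
  (forall t, a <= t <= b -> exists d, is_derive f t d /\ d <= 0) -> f b <= f a.
Proof.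
  intros Hab H. apply (nonincreasing_of_derive f (Derive f) a b Hab).
  - intros t Ht. destruct (H t Ht) as (d & Hd & _). apply Derive_correct. exists d; exact Hd.
  - intros t Ht. destruct (H t Ht) as (d & Hd & Hle). rewrite (is_derive_unique _ _ _ Hd). exact Hle.
Qed.

(** The energy is nonincreasing as long as the rescaled deviation is small, and by
    coercivity it keeps the deviation small.  The equations are only required near
    [(xs, ys)] so that trajectories of a truncated field are covered too. *)
Theorem stable_tail q n w dw F Fx Fy Ft G Gx Gy Gt A A' D (B xk : nat -> R) (xs ys : R -> R) t0 :
  (1 <= n <= q)%nat ->
  (forall x, is_derive w x (dw x)) -> (forall x, continuous dw x) -> 0 < w 0 ->
  C1field F Fx Fy Ft -> C1field G Gx Gy Gt ->
  (forall eta, 0 < eta -> exists r, 0 < r /\ eventually_t (fun t =>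
     forall x y, Rabs x <= r -> Rabs y <= r ->
     Rabs (Fx x y t - tpow q n t * A) <= eta * tpow q n t /\
     Rabs (Fy x y t - tpow q n t * A') <= eta * tpow q n t /\
     Rabs (Gy x y t - tpow q n t * D) <= eta * tpow q n t)) ->
  (exists C, 0 <= C /\ eventually_t (fun t => forall x y, Rabs x <= 1 -> Rabs y <= 1 ->
    Rabs (Gx x y t - sum_n_m (fun k => tpow q k t * B k) n (2 * n - 1)) <=
    C * (tpow q n t * (Rabs x + Rabs y) + tpow q (2 * n) t))) ->
  (exists C, 0 <= C /\ eventually_t (fun t =>
     Rabs (xs t) <= C * tpow q n t /\ Rabs (ys t) <= C * tpow q n t /\
     Rabs (xs t - sum_n_m (fun k => tpow q k t * xk k) n (2 * n - 1)) <= C * tpow q (2 * n) t)) ->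
  0 < 2 * w 0 * xk n - B n ->
  A + D + 5 / 2 * kron n q < 0 ->
  (forall t, t0 <= t -> is_derive xs t (ys t + F (xs t) (ys t) t) /\
     is_derive ys t (- (xs t ^ 2 * w (xs t)) + G (xs t) (ys t) t)) ->
  exists T, t0 <= T /\ forall eps, 0 < eps -> exists delta, 0 < delta /\
    forall x y : R -> R,
    (forall t, T <= t -> continuous x t /\ continuous y t) ->
    (forall t, T <= t -> Rabs (x t - xs t) <= 1 -> Rabs (y t - ys t) <= 1 ->
       is_derive x t (y t + F (x t) (y t) t) /\
       is_derive y t (- (x t ^ 2 * w (x t)) + G (x t) (y t) t)) ->
    Rabs (x T - xs T) < delta -> Rabs (y T - ys T) < delta ->
    forall t, T <= t -> Rabs (x t - xs t) < eps /\ Rabs (y t - ys t) < eps.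
Proof.
  intros Hn Hw Hdw Hw0 HF HG Hlead HGx Hxs Ha Hbeta Hsol.
  set (a := 2 * w 0 * xk n - B n) in *.
  set (k := kron n q) in *.
  pose (p0 := A + k). pose (s0 := D + 3 / 2 * k).
  pose (b := (p0 + s0) / 2). pose (c := (p0 - s0) / 2).
  destruct (energy_coercive a (w 0) c Ha ltac:(lra)) as (eta1 & m & K & He1 & Hm & HK & Hcoer).
  destruct (energy_decay a (w 0) p0 s0 c b Ha ltac:(lra) ltac:(unfold b, p0, s0; lra)
    ltac:(unfold b, c; lra) ltac:(unfold b, c; lra)) as (eta2 & He2 & Hdecay).
  assert (Hl := Rmin_l eta1 eta2). assert (Hr := Rmin_r eta1 eta2).
  assert (Heta : 0 < Rmin eta1 eta2) by (apply Rmin_glb_lt; lra).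
  set (eta := Rmin eta1 eta2) in *.
  destruct (frequency q n (fun k => 2 * w 0 * xk k - B k) (n - 1) ltac:(lia)) as (dOm & HdOm & HOm).
  replace (n + (n - 1))%nat with (2 * n - 1)%nat in * by lia.
  assert (Hinc := rescaled_increments q n w dw F Fx Fy Ft G Gx Gy Gt A A' D B xk xs ys
    ltac:(lia) ltac:(lia) Hw Hdw HF HG Hlead HGx Hxs (eta / 4) ltac:(lra)).
  assert (Hdil := dilation_rate q n (eta / 4) Hn ltac:(lra)).
  assert (Hsg := tpow_vanish (2 * q) n eta ltac:(lia) ltac:(lia) Heta).
  destruct (ev_and _ _ (ev_and _ _ Hinc (HOm eta Heta)) (ev_and _ _ (ev_and _ _ Hdil Hsg) (ev_ge 1)))
    as [T0 HT0].
  clear Hinc HOm Hdil Hsg Hlead HGx Hxs.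
  assert (Hm1 := Rmax_l t0 (T0 + 1)). assert (Hm2 := Rmax_r t0 (T0 + 1)).
  set (T := Rmax t0 (T0 + 1)) in *.
  exists T. split; [exact Hm1|]. intros eps Heps.
  pose (sg := tpow (2 * q) n).
  pose (Om := fun t => sum_n_m (fun k => tpow q (k - n) t * (2 * w 0 * xk k - B k)) n (2 * n - 1)).
  assert (Psg : forall t, 0 < sg t) by (intros; apply tpow_pos).
  assert (Hsg1 : forall t, T <= t -> sg t <= 1).
  { intros t Ht. destruct (HT0 t ltac:(lra)) as (_ & _ & Ht1). apply tpow_le_1; [lia | exact Ht1]. }
  pose (lv := Rmin eta eps).
  assert (Hlv : 0 < lv) by (apply Rmin_glb_lt; lra).
  assert (Hlv1 := Rmin_l eta eps : lv <= eta). assert (Hlv2 := Rmin_r eta eps : lv <= eps).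
  pose (S3 := sg T * (sg T * sg T)).
  assert (PS3 : 0 < S3).
  { unfold S3. assert (P := Psg T). apply Rmult_lt_0_compat; [lra | nra]. }
  (* initial deviations of size [lv * q0] have energy below [m * lv^2], which
     bounds the energy on the circle of radius [lv] from below *)
  pose (q0 := Rmin 1 (m / (4 * (K + m)))).
  assert (Hq0 : 0 < q0) by (apply Rmin_glb_lt; [lra | apply Rdiv_lt_0_compat; lra]).
  assert (Hq1 := Rmin_l 1 (m / (4 * (K + m))) : q0 <= 1).
  assert (Hq2 := Rmin_r 1 (m / (4 * (K + m))) : q0 <= m / (4 * (K + m))).
  exists (S3 * (lv * q0)). split; [apply Rmult_lt_0_compat; [lra | apply Rmult_lt_0_compat; lra]|].
  intros x y Hc Hxy HxT HyT.
  pose (X := fun t => (x t - xs t) / (sg t * sg t)).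
  pose (Y := fun t => (y t - ys t) / (sg t * (sg t * sg t))).
  assert (EX : forall t, x t - xs t = sg t * sg t * X t).
  { intros t. unfold X. field. assert (P := Psg t). lra. }
  assert (EY : forall t, y t - ys t = sg t * (sg t * sg t) * Y t).
  { intros t. unfold Y. field. assert (P := Psg t). lra. }
  assert (Hsmall : forall t, T <= t -> X t ^ 2 + Y t ^ 2 < lv ^ 2 \/ X t ^ 2 + Y t ^ 2 <= lv ^ 2 ->
            Rabs (X t) <= lv /\ Rabs (Y t) <= lv).
  { intros t Ht Hr2. assert (Hle : X t ^ 2 + Y t ^ 2 <= lv ^ 2) by lra.
    assert (P1 := pow2_ge_0 (X t)). assert (P2 := pow2_ge_0 (Y t)).
    split; apply Rabs_le_between; split; nra. }
  assert (Hdev : forall t, T <= t -> forall l, 0 <= l -> Rabs (X t) <= l -> Rabs (Y t) <= l ->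
            Rabs (x t - xs t) <= l /\ Rabs (y t - ys t) <= l).
  { intros t Ht l Hl0 HX HY. assert (P := Psg t). specialize (Hsg1 t Ht).
    assert (M1 : 0 <= sg t * sg t <= 1) by nra.
    assert (M2 : 0 <= sg t * (sg t * sg t) <= 1) by nra.
    rewrite EX, EY, !(Rabs_mult (_ * _)), (Rabs_pos_eq (sg t * sg t)),
      (Rabs_pos_eq (sg t * (sg t * sg t))) by lra.
    assert (PX := Rabs_pos (X t)). assert (PY := Rabs_pos (Y t)). split; nra. }
  assert (Hsgd : forall t, T <= t -> is_derive sg t (- (INR n / INR q / t / 2) * sg t)).
  { intros t Ht. destruct (HT0 t ltac:(lra)) as (_ & _ & Ht1).
    replace (- (INR n / INR q / t / 2) * sg t) with (- (INR n / INR (2 * q)) * tpow (2 * q) n t / t).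
    - apply is_derive_tpow. lra.
    - rewrite mult_INR. simpl (INR 2). unfold sg. field.
      repeat split; first [lra | apply not_0_INR; lia]. }
  pose (Z := fun t => energy (w 0) c (Om t) (sg t) (X t) (Y t)).
  assert (Hcoer' : forall t, T <= t -> X t ^ 2 + Y t ^ 2 <= lv ^ 2 ->
            m * (X t ^ 2 + Y t ^ 2) <= Z t <= K * (X t ^ 2 + Y t ^ 2)).
  { intros t Ht Hr2. destruct (Hsmall t Ht (or_intror Hr2)) as [HX HY].
    destruct (HT0 t ltac:(lra)) as ((_ & HOm & _) & (_ & Hsgt) & Ht1).
    apply Hcoer; [eapply Rle_trans; [exact HOm | lra] | split; [left; apply Psg | unfold sg; lra] | lra]. }
  assert (HZ : forall t, T <= t -> X t ^ 2 + Y t ^ 2 <= lv ^ 2 ->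
            exists d, is_derive Z t d /\ d <= 0).
  { intros t Ht Hr2. destruct (Hsmall t Ht (or_intror Hr2)) as [HX HY].
    destruct (HT0 t ltac:(lra)) as ((Hinc & HOm & HdOm') & (Hdil & Hsgt) & Ht1).
    destruct (Hdev t Ht 1 ltac:(lra) ltac:(lra) ltac:(lra)) as [Hu Hv].
    destruct (Hxy t Ht Hu Hv) as [Dx Dy].
    destruct (Hsol t ltac:(lra)) as [Dxs Dys].
    destruct (Hinc (X t) (Y t) ltac:(lra) ltac:(lra)) as (p & s & e1 & e2 & Hp & Hs & He1' & He2' & EF & EG).
    fold (sg t) in EF, EG, Hsgt. fold (Om t) in EG, HOm.
    rewrite <- EX, <- EY in EF, EG.
    replace (xs t + (x t - xs t)) with (x t) in * by ring.
    replace (ys t + (y t - ys t)) with (y t) in * by ring.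
    assert (P := Psg t).
    assert (Emu : tpow q n t = sg t * sg t) by (symmetry; apply tpow_half; lia).
    assert (Hinv := inv_le_tpow q n t ltac:(lia) ltac:(lia) Ht1).
    rewrite Emu in *. set (mu := sg t * sg t) in *.
    assert (Pmu : 0 < mu) by (unfold mu; nra).
    pose (kt := INR n / INR q / t).
    fold kt k in Hdil.
    assert (Hkt : Rabs (kt / mu - k) <= eta / 4).
    { replace (kt / mu - k) with ((kt - k * mu) * / mu) by (field; lra).
      rewrite Rabs_mult, (Rabs_pos_eq (/ mu)) by (left; apply Rinv_0_lt_compat; lra).
      apply Rmult_le_reg_r with mu; [lra|]. rewrite Rmult_assoc, Rinv_l by lra. lra. }
    assert (DU : is_derive (fun t => x t - xs t) t (y t + F (x t) (y t) t - (ys t + F (xs t) (ys t) t)))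
      by exact (is_derive_minus x xs t _ _ Dx Dxs).
    assert (DV : is_derive (fun t => y t - ys t) t
       (- (x t ^ 2 * w (x t)) + G (x t) (y t) t - (- (xs t ^ 2 * w (xs t)) + G (xs t) (ys t) t)))
      by exact (is_derive_minus y ys t _ _ Dy Dys).
    destruct (is_derive_rescaled _ _ sg t _ _ kt DU DV (Hsgd t Ht) P) as [DX DY].
    eexists. split.
    - exact (is_derive_energy (w 0) c Om sg X Y t _ _ _ _ (HdOm t ltac:(lra)) (Hsgd t Ht) DX DY).
    - apply (Hdecay mu (sg t) (X t) (Y t) (Om t) (dOm t) (- (kt / 2) * sg t)
               (p + kt / mu) (s + 3 / 2 * (kt / mu)) e1 e2); try lra.
      + reflexivity.
      + eapply Rle_trans; [exact HOm | lra].
      + eapply Rle_trans; [exact HdOm'|]. unfold Rdiv.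
        apply Rmult_le_compat; [lra | left; apply Rinv_0_lt_compat; lra | lra | exact Hinv].
      + assert (Hn0 := tpow_exponent q n ltac:(lia)).
        assert (Hn1 : INR n / INR q <= 1).
        { apply Rmult_le_reg_r with (INR q); [apply lt_0_INR; lia|].
          assert (INR n <= INR q) by (apply le_INR; lia).
          replace (INR n / INR q * INR q) with (INR n); [lra|].
          field. apply not_0_INR. lia. }
        assert (Hti : 0 < / t) by (apply Rinv_0_lt_compat; lra).
        assert (Hkt0 : 0 <= kt) by (apply Rmult_le_pos; lra).
        assert (Hkt1 : kt <= mu).
        { eapply Rle_trans; [|exact Hinv]. unfold kt, Rdiv at 1.
          rewrite <- (Rmult_1_l (/ t)) at 2. apply Rmult_le_compat_r; lra. }
        rewrite Rabs_mult, Rabs_Ropp, !Rabs_pos_eq by lra.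
        rewrite (Rmult_comm eta2 mu). apply Rmult_le_compat; lra.
      + unfold p0. replace (p + kt / mu - (A + k)) with ((p - A) + (kt / mu - k)) by ring.
        eapply Rle_trans; [apply (Rabs_plus_le _ _ _ _ Hp Hkt)|]. lra.
      + unfold s0. replace (s + 3 / 2 * (kt / mu) - (D + 3 / 2 * k))
          with ((s - D) + 3 / 2 * (kt / mu - k)) by ring.
        eapply Rle_trans; [apply (Rabs_plus_le _ _ _ _ Hs (Rabs_mult_le (3 / 2) _ (3 / 2) _
          ltac:(rewrite Rabs_pos_eq; lra) Hkt))|]. lra.
      + fold mu. change ((x t - xs t) / mu) with (X t).
        replace (y t + F (x t) (y t) t - (ys t + F (xs t) (ys t) t))
          with ((y t - ys t) + (F (x t) (y t) t - F (xs t) (ys t) t)) by ring.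
        rewrite EF, EY. fold mu. unfold mu. field. lra.
      + fold mu. change ((y t - ys t) / (sg t * mu)) with (Y t). rewrite EG. unfold mu. field. lra. }
  assert (HrT : X T ^ 2 + Y T ^ 2 < lv ^ 2 /\ K * (X T ^ 2 + Y T ^ 2) < m * lv ^ 2).
  { assert (P := Psg T). assert (P1 := Hsg1 T (Rle_refl _)).
    assert (HS2 : S3 <= sg T * sg T) by (unfold S3; nra).
    assert (HX : Rabs (X T) < lv * q0).
    { rewrite EX, Rabs_mult, (Rabs_pos_eq (sg T * sg T)) in HxT by nra.
      apply Rmult_lt_reg_l with (sg T * sg T); [nra|]. eapply Rlt_le_trans; [exact HxT|].
      apply Rmult_le_compat_r; [|exact HS2]. left. apply Rmult_lt_0_compat; assumption. }
    assert (HY : Rabs (Y T) < lv * q0).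
    { rewrite EY, Rabs_mult, (Rabs_pos_eq (sg T * (sg T * sg T))) in HyT by (unfold S3 in PS3; lra).
      apply Rmult_lt_reg_l with S3; [exact PS3|]. exact HyT. }
    assert (Hsum : X T ^ 2 + Y T ^ 2 <= 2 * (lv * q0) ^ 2).
    { rewrite <- (pow2_abs (X T)), <- (pow2_abs (Y T)).
      assert (Q1 := Rabs_pos (X T)). assert (Q2 := Rabs_pos (Y T)). nra. }
    assert (Hqq : q0 * (4 * (K + m)) <= m).
    { replace m with (m / (4 * (K + m)) * (4 * (K + m))) at 2 by (field; lra).
      apply Rmult_le_compat_r; lra. }
    assert (Hq4 : 4 * q0 <= 1) by nra.
    assert (Hlv2' : 0 < lv ^ 2) by nra.
    assert (Hq22 : q0 ^ 2 <= q0) by nra.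
    replace (2 * (lv * q0) ^ 2) with (lv ^ 2 * (2 * q0 ^ 2)) in Hsum by ring.
    split.
    - assert (lv ^ 2 * (2 * q0 ^ 2) <= lv ^ 2 * (/ 2)) by (apply Rmult_le_compat_l; lra). lra.
    - apply Rle_lt_trans with (K * (lv ^ 2 * (2 * q0 ^ 2))); [apply Rmult_le_compat_l; lra|].
      replace (K * (lv ^ 2 * (2 * q0 ^ 2))) with (lv ^ 2 * (2 * K * q0 ^ 2)) by ring.
      rewrite (Rmult_comm m). apply Rmult_lt_compat_l; [exact Hlv2'|]. nra. }
  assert (Hall : forall t, T <= t -> X t ^ 2 + Y t ^ 2 < lv ^ 2).
  { intros t1 Ht1. apply (first_crossing (fun t => X t ^ 2 + Y t ^ 2) T t1 (lv ^ 2) Ht1).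
    - intros t [Ht _]. destruct (Hc t Ht) as [Cx Cy]. destruct (Hsol t ltac:(lra)) as [Dxs Dys].
      assert (Cxs : continuous xs t) by (apply (ex_derive_continuous xs); eexists; exact Dxs).
      assert (Cys : continuous ys t) by (apply (ex_derive_continuous ys); eexists; exact Dys).
      assert (P := Psg t).
      assert (Ci : forall h : R -> R, ex_derive h t -> h t <> 0 -> continuous (fun t => / h t) t).
      { intros h Hh Hh0. apply (ex_derive_continuous (fun t => / h t)). auto_derive. split; auto. }
      assert (Dsg : ex_derive sg t) by (eexists; apply Hsgd, Ht).
      assert (Csq : forall h : R -> R, continuous h t -> continuous (fun t => h t ^ 2) t).
      { intros h Hh. apply (continuous_comp h (fun z => z ^ 2)); [exact Hh|].
        apply (ex_derive_continuous (fun z => z ^ 2)). auto_derive. exact I. }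
      apply (continuous_plus (V := R_NormedModule)); apply Csq;
        apply (continuous_mult (K := R_AbsRing)).
      + apply (continuous_minus (V := R_NormedModule)); assumption.
      + apply Ci; [auto_derive; auto | nra].
      + apply (continuous_minus (V := R_NormedModule)); assumption.
      + apply Ci; [auto_derive; auto |]. apply Rgt_not_eq, Rmult_lt_0_compat; nra.
    - apply HrT.
    - intros t [Ht _] Hbefore.
      assert (HZt : Z t <= Z T).
      { apply nonincreasing_of_ex_derive; [exact Ht|]. intros s Hs. apply HZ; [lra|]. apply Hbefore, Hs. }
      destruct (Hcoer' t Ht (Hbefore t ltac:(lra))) as [C1 _].
      destruct (Hcoer' T ltac:(lra) ltac:(lra)) as [_ C2].
      destruct HrT as [_ HrT]. apply Rmult_lt_reg_l with m; [exact Hm|]. lra. }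
  intros t Ht. specialize (Hall t Ht).
  assert (P1 := pow2_ge_0 (X t)). assert (P2 := pow2_ge_0 (Y t)).
  assert (HX : Rabs (X t) < lv).
  { apply Rabs_def1; nra. }
  assert (HY : Rabs (Y t) < lv).
  { apply Rabs_def1; nra. }
  assert (Q1 := Rabs_pos (X t)).
  destruct (Hdev t Ht (Rmax (Rabs (X t)) (Rabs (Y t)))) as [Hu Hv];
    [eapply Rle_trans; [exact Q1 | apply Rmax_l] | apply Rmax_l | apply Rmax_r |].
  assert (Hmx : Rmax (Rabs (X t)) (Rabs (Y t)) < lv) by (apply Rmax_lub_lt; assumption).
  lra.
Qed.

(** * Global solutions of Lipschitz systems *)

(** Time is frozen before [t0], so that the iterates, and the solution, are
    differentiable on both sides of [t0]. *)
Definition rhs (f : R -> R -> R -> R) (t0 : R) (x y : R -> R) (s : R) : R :=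
  f (x (Rmax t0 s)) (y (Rmax t0 s)) (Rmax t0 s).

Definition integral_curve (f : R -> R -> R -> R) (t0 a : R) (x y : R -> R) (t : R) : R :=
  a + RInt (rhs f t0 x y) t0 t.

Fixpoint picard (f g : R -> R -> R -> R) (t0 a b : R) (k : nat) : (R -> R) * (R -> R) :=
  match k with
  | O => (fun _ => a, fun _ => b)
  | S k' => let (x, y) := picard f g t0 a b k' in
      (integral_curve f t0 a x y, integral_curve g t0 b x y)
  end.

Lemma continuous_rhs f t0 x y s : (forall x y t, t0 <= t -> cont3 f x y t) ->
  continuous (fun s => x (Rmax t0 s)) s -> continuous (fun s => y (Rmax t0 s)) s ->
  continuous (rhs f t0 x y) s.
Proof.
  intros Hf Hx Hy.
  apply (cont3_comp f (fun s => x (Rmax t0 s)) (fun s => y (Rmax t0 s)) (Rmax t0));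
    [exact Hx | exact Hy | apply continuous_Rmax | apply Hf, Rmax_l].
Qed.

Lemma is_derive_integral_curve f t0 a x y t : (forall s, continuous (rhs f t0 x y) s) ->
  is_derive (integral_curve f t0 a x y) t (rhs f t0 x y t).
Proof.
  intros Hc. unfold integral_curve.
  replace (rhs f t0 x y t) with (plus 0 (rhs f t0 x y t)) by apply Rplus_0_l.
  apply (is_derive_plus (fun _ => a)); [apply (is_derive_const a)|].
  apply (is_derive_RInt (rhs f t0 x y) _ t0); [|apply Hc].
  apply filter_forall. intros z. apply (@RInt_correct R_CompleteNormedModule), ex_RInt_cont, Hc.
Qed.

Lemma integral_curve_start f t0 a x y : integral_curve f t0 a x y t0 = a.
Proof. unfold integral_curve. rewrite (RInt_point t0). unfold zero; simpl. ring. Qed.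

Lemma dominated_increment (f df h dh : R -> R) (a b : R) : a <= b ->
  (forall t, a <= t <= b -> is_derive f t (df t)) ->
  (forall t, a <= t <= b -> is_derive h t (dh t)) ->
  (forall t, a <= t <= b -> Rabs (df t) <= dh t) ->
  Rabs (f b - f a) <= h b - h a.
Proof.
  intros Hab Hf Hh Hle.
  assert (H1 := nonincreasing_of_derive (fun t => f t - h t) (fun t => df t - dh t) a b Hab
    (fun t Ht => is_derive_minus f h t _ _ (Hf t Ht) (Hh t Ht))
    ltac:(intros t Ht; specialize (Hle t Ht); apply Rabs_le_between in Hle; lra)).
  assert (H2 := nonincreasing_of_derive (fun t => - f t - h t) (fun t => - df t - dh t) a b Hab
    (fun t Ht => is_derive_minus (fun t => - f t) h t _ _ (is_derive_opp f t _ (Hf t Ht)) (Hh t Ht))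
    ltac:(intros t Ht; specialize (Hle t Ht); apply Rabs_le_between in Hle; lra)).
  cbv beta in H1, H2. apply Rabs_le_between. lra.
Qed.

Lemma nonpos_of_geometric (z C : R) : (forall k, z <= C * (/ 2) ^ k) -> z <= 0.
Proof.
  intros H.
  assert (L : is_lim_seq (fun k => C * (/ 2) ^ k) (C * 0)).
  { apply (is_lim_seq_scal_l _ C 0), is_lim_seq_geom. rewrite Rabs_pos_eq; lra. }
  rewrite Rmult_0_r in L.
  apply (is_lim_seq_le (fun _ => z) _ z 0 H (is_lim_seq_const z) L).
Qed.

(** The bound depends on [u] through [C] only, so that for a sequence of functions it
    gives uniform convergence. *)
Lemma geometric_limit (u : nat -> R) (C : R) :
  (forall k, Rabs (u (S k) - u k) <= C * (/ 2) ^ k) ->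
  forall k, Rabs (real (Lim_seq u) - u k) <= 2 * C * (/ 2) ^ k.
Proof.
  intros Hu.
  assert (Hpow : forall k, 0 < (/ 2) ^ k) by (intros; apply pow_lt; lra).
  assert (Htail : forall j k, Rabs (u (k + j)%nat - u k) <= 2 * C * (/ 2) ^ k - 2 * C * (/ 2) ^ (k + j)).
  { induction j as [|j IH]; intros k.
    - rewrite Nat.add_0_r, !Rminus_diag, Rabs_R0. lra.
    - rewrite Nat.add_succ_r. specialize (IH k). specialize (Hu (k + j)%nat).
      replace (u (S (k + j)) - u k) with ((u (S (k + j)) - u (k + j)%nat) + (u (k + j)%nat - u k)) by ring.
      eapply Rle_trans; [apply Rabs_triang|]. simpl pow. lra. }
  assert (HC : 0 <= C).
  { specialize (Hu 0%nat). simpl in Hu. assert (P := Rabs_pos (u 1%nat - u 0%nat)). lra. }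
  assert (Hlim : is_lim_seq u (real (Lim_seq u))).
  { apply Lim_seq_correct', ex_lim_seq_cauchy_corr. intros eps.
    assert (L : is_lim_seq (fun k => 4 * C * (/ 2) ^ k) 0).
    { replace (Finite 0) with (Finite (4 * C * 0)) by (f_equal; ring).
      apply (is_lim_seq_scal_l _ (4 * C) 0), is_lim_seq_geom. rewrite Rabs_pos_eq; lra. }
    apply is_lim_seq_spec in L. destruct (L eps) as [N HN]. exists N. intros k l Hk Hl.
    specialize (HN N (le_n N)). rewrite Rminus_0_r, Rabs_pos_eq in HN
      by (specialize (Hpow N); apply Rmult_le_pos; lra).
    assert (Hj : forall k, (N <= k)%nat -> Rabs (u k - u N) <= 2 * C * (/ 2) ^ N).
    { intros i Hi. specialize (Htail (i - N)%nat N).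
      replace (N + (i - N))%nat with i in Htail by lia. specialize (Hpow i).
      assert (0 <= C * (/ 2) ^ i) by (apply Rmult_le_pos; lra). lra. }
    assert (H1 := Hj k Hk). assert (H2 := Hj l Hl).
    replace (u k - u l) with ((u k - u N) - (u l - u N)) by ring.
    eapply Rle_lt_trans; [apply Rabs_triang|]. rewrite Rabs_Ropp. lra. }
  intros k.
  assert (L : is_lim_seq (fun j => Rabs (u (j + k)%nat - u k)) (Rabs (real (Lim_seq u) - u k))).
  { apply (is_lim_seq_abs (fun j => u (j + k)%nat - u k) (real (Lim_seq u) - u k)).
    apply is_lim_seq_minus'; [|apply is_lim_seq_const].
    apply (is_lim_seq_incr_n u k). exact Hlim. }
  apply (is_lim_seq_le (fun j => Rabs (u (j + k)%nat - u k)) (fun _ => 2 * C * (/ 2) ^ k)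
    (Rabs (real (Lim_seq u) - u k)) (2 * C * (/ 2) ^ k)); [|exact L | apply is_lim_seq_const].
  intros j. specialize (Htail j k). rewrite Nat.add_comm. specialize (Hpow (k + j)%nat).
  assert (0 <= C * (/ 2) ^ (k + j)) by (apply Rmult_le_pos; lra). lra.
Qed.

(** Picard iteration; the exponential weight turns the integral operator into a
    contraction on compact time intervals of any length. *)
Theorem global_solution (f g : R -> R -> R -> R) (t0 a b : R) :
  (forall x y t, t0 <= t -> cont3 f x y t) -> (forall x y t, t0 <= t -> cont3 g x y t) ->
  (forall T, exists L, 0 <= L /\ forall x y x' y' t, t0 <= t <= T ->
     Rabs (f x y t - f x' y' t) <= L * (Rabs (x - x') + Rabs (y - y')) /\
     Rabs (g x y t - g x' y' t) <= L * (Rabs (x - x') + Rabs (y - y'))) ->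
  exists x y, x t0 = a /\ y t0 = b /\ forall t, t0 <= t ->
    is_derive x t (f (x t) (y t) t) /\ is_derive y t (g (x t) (y t) t).
Proof.
  intros Hf Hg HL.
  pose (X := fun k => fst (picard f g t0 a b k)). pose (Y := fun k => snd (picard f g t0 a b k)).
  assert (EX : forall k, X (S k) = integral_curve f t0 a (X k) (Y k)).
  { intros k. unfold X, Y. simpl. destruct picard. reflexivity. }
  assert (EY : forall k, Y (S k) = integral_curve g t0 b (X k) (Y k)).
  { intros k. unfold X, Y. simpl. destruct picard. reflexivity. }
  assert (Hcomp : forall (z : R -> R) s, continuous z (Rmax t0 s) -> continuous (fun s => z (Rmax t0 s)) s).
  { intros z s Hz. apply (continuous_comp (Rmax t0) z); [apply continuous_Rmax | exact Hz]. }
  assert (HXY : forall k, (forall t, continuous (X k) t) /\ (forall t, continuous (Y k) t)).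
  { induction k as [|k [IHx IHy]].
    - split; intros t; apply continuous_const.
    - rewrite EX, EY. split; intros t.
      + apply (ex_derive_continuous (integral_curve f t0 a (X k) (Y k))). eexists.
        apply is_derive_integral_curve. intros s. apply continuous_rhs; auto.
      + apply (ex_derive_continuous (integral_curve g t0 b (X k) (Y k))). eexists.
        apply is_derive_integral_curve. intros s. apply continuous_rhs; auto. }
  assert (Hfc : forall k s, continuous (rhs f t0 (X k) (Y k)) s).
  { intros k s. destruct (HXY k). apply continuous_rhs; auto. }
  assert (Hgc : forall k s, continuous (rhs g t0 (X k) (Y k)) s).
  { intros k s. destruct (HXY k). apply continuous_rhs; auto. }
  assert (Hgeo : forall T, t0 <= T -> exists C, 0 <= C /\ forall k t, t0 <= t <= T ->
     Rabs (X (S k) t - X k t) <= C * (/ 2) ^ k /\ Rabs (Y (S k) t - Y k t) <= C * (/ 2) ^ k).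
  { intros T HT. destruct (HL T) as (L0 & HL0 & HLip0).
    pose (L := L0 + 1). assert (PL : 0 < L) by (unfold L; lra).
    destruct (bounded_on_box f (Rabs a + Rabs b) t0 T) as (K1 & HK1 & B1).
    { intros; apply Hf; lra. }
    destruct (bounded_on_box g (Rabs a + Rabs b) t0 T) as (K2 & HK2 & B2).
    { intros; apply Hg; lra. }
    assert (Pa := Rabs_pos a). assert (Pb := Rabs_pos b).
    pose (K := (K1 + K2) * (T - t0)).
    assert (HK : 0 <= K) by (apply Rmult_le_pos; lra).
    assert (Hpow : forall k, 0 < (/ 2) ^ k) by (intros; apply pow_lt; lra).
    assert (Hstep : forall k t, t0 <= t <= T ->
       Rabs (X (S k) t - X k t) <= K * (/ 2) ^ k * exp (4 * L * (t - t0)) /\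
       Rabs (Y (S k) t - Y k t) <= K * (/ 2) ^ k * exp (4 * L * (t - t0))).
    { induction k as [|k IH]; intros t Ht.
      - assert (He : 1 <= exp (4 * L * (t - t0))).
        { eapply Rle_trans; [|apply exp_ineq1_le]. nra. }
        rewrite pow_O, Rmult_1_r, EX, EY.
        assert (H0 : forall (h : R -> R -> R -> R) c, (forall s, continuous (rhs h t0 (X 0%nat) (Y 0%nat)) s) ->
          (forall s, t0 <= s <= T -> Rabs (h a b s) <= K1 + K2) ->
          Rabs (integral_curve h t0 c (X 0%nat) (Y 0%nat) t - c) <= (K1 + K2) * (t - t0)).
        { intros h c Hc HB.
          assert (E := dominated_increment (integral_curve h t0 c (X 0%nat) (Y 0%nat)) _
            (fun s => (K1 + K2) * s) (fun _ => K1 + K2) t0 t ltac:(lra)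
            (fun s _ => is_derive_integral_curve h t0 c _ _ s Hc)).
          cbv beta in E. rewrite integral_curve_start in E.
          replace ((K1 + K2) * (t - t0)) with ((K1 + K2) * t - (K1 + K2) * t0) by ring.
          apply E.
          - intros s _. auto_derive; [exact I | ring].
          - intros s Hs. unfold rhs. rewrite Rmax_right by lra. apply HB. lra. }
        assert (Hmono : (K1 + K2) * (t - t0) <= K * exp (4 * L * (t - t0))).
        { apply Rle_trans with (K * 1); [|apply Rmult_le_compat_l; lra].
          rewrite Rmult_1_r. apply Rmult_le_compat_l; lra. }
        split; (eapply Rle_trans; [|exact Hmono]); apply H0; auto; intros s Hs.
        + specialize (B1 a b s ltac:(lra) ltac:(lra) Hs). lra.
        + specialize (B2 a b s ltac:(lra) ltac:(lra) Hs). lra.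
      - pose (h := fun s => K * (/ 2) ^ S k * exp (4 * L * (s - t0))).
        assert (H0 : forall (p : R -> R -> R -> R) c,
          (forall i s, continuous (rhs p t0 (X i) (Y i)) s) ->
          (forall x y x' y' t, t0 <= t <= T ->
             Rabs (p x y t - p x' y' t) <= L0 * (Rabs (x - x') + Rabs (y - y'))) ->
          Rabs (integral_curve p t0 c (X (S k)) (Y (S k)) t - integral_curve p t0 c (X k) (Y k) t) <= h t).
        { intros p c Hc HLp.
          assert (E := dominated_increment
            (fun s => integral_curve p t0 c (X (S k)) (Y (S k)) s - integral_curve p t0 c (X k) (Y k) s)
            (fun s => rhs p t0 (X (S k)) (Y (S k)) s - rhs p t0 (X k) (Y k) s)
            h (fun s => 4 * L * h s) t0 t ltac:(lra)).
          cbv beta in E. rewrite !integral_curve_start in E.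
          replace (c - c) with 0 in E by ring. rewrite Rminus_0_r in E.
          apply Rle_trans with (h t - h t0).
          - apply E.
            + intros s _. apply (is_derive_minus (integral_curve p t0 c (X (S k)) (Y (S k))));
                apply is_derive_integral_curve; apply Hc.
            + intros s _. unfold h. set (w := K * (/ 2) ^ S k). auto_derive; [exact I |].
              unfold Rminus. ring.
            + intros s Hs. unfold rhs. rewrite !Rmax_right by lra.
              eapply Rle_trans; [apply HLp; lra|].
              destruct (IH s ltac:(lra)) as [I1 I2].
              unfold h. simpl pow.
              set (w := K * (/ 2) ^ k * exp (4 * L * (s - t0))) in *.
              replace (4 * L * (K * (/ 2 * (/ 2) ^ k) * exp (4 * L * (s - t0)))) with (L * (w + w))
                by (unfold w; field).
              apply Rmult_le_compat; try lra.
              * assert (P1 := Rabs_pos (X (S k) s - X k s)). assert (P2 := Rabs_pos (Y (S k) s - Y k s)). lra.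
              * unfold L. lra.
          - assert (0 < exp (4 * L * (t0 - t0))) by apply exp_pos.
            assert (0 <= h t0); [|lra]. unfold h. specialize (Hpow (S k)).
            apply Rmult_le_pos; [apply Rmult_le_pos; lra | lra]. }
        assert (EXt : X (S k) t = integral_curve f t0 a (X k) (Y k) t) by (rewrite EX; reflexivity).
        assert (EYt : Y (S k) t = integral_curve g t0 b (X k) (Y k) t) by (rewrite EY; reflexivity).
        rewrite EXt, EYt, (EX (S k)), (EY (S k)).
        split; apply H0; auto; intros; apply HLip0; assumption. }
    exists (K * exp (4 * L * (T - t0))).
    assert (He := exp_pos (4 * L * (T - t0))).
    split; [apply Rmult_le_pos; lra|].
    intros k t Ht. destruct (Hstep k t Ht) as [S1 S2].
    assert (Hle : K * (/ 2) ^ k * exp (4 * L * (t - t0)) <= K * exp (4 * L * (T - t0)) * (/ 2) ^ k).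
    { replace (K * exp (4 * L * (T - t0)) * (/ 2) ^ k) with (K * (/ 2) ^ k * exp (4 * L * (T - t0))) by ring.
      apply Rmult_le_compat_l; [specialize (Hpow k); apply Rmult_le_pos; lra|].
      assert (Hl : 4 * L * (t - t0) <= 4 * L * (T - t0)) by (apply Rmult_le_compat_l; lra).
      destruct Hl as [Hl|Hl]; [left; apply exp_increasing, Hl | rewrite Hl; right; reflexivity]. }
    lra. }
  pose (x := fun t => real (Lim_seq (fun k => X k t))).
  pose (y := fun t => real (Lim_seq (fun k => Y k t))).
  assert (Hunif : forall T, t0 <= T -> exists C, 0 <= C /\ forall k t, t0 <= t <= T ->
     Rabs (x t - X k t) <= C * (/ 2) ^ k /\ Rabs (y t - Y k t) <= C * (/ 2) ^ k).
  { intros T HT. destruct (Hgeo T HT) as (C & HC & Hk). exists (2 * C). split; [lra|].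
    intros k t Ht. split.
    - apply (geometric_limit (fun k => X k t) C). intros i. apply Hk, Ht.
    - apply (geometric_limit (fun k => Y k t) C). intros i. apply Hk, Ht. }
  assert (Hcont : forall (z : R -> R) (Z : nat -> R -> R), (forall k t, continuous (Z k) t) ->
     (forall T, t0 <= T -> exists C, 0 <= C /\ forall k t, t0 <= t <= T -> Rabs (z t - Z k t) <= C * (/ 2) ^ k) ->
     forall s, continuous (fun s => z (Rmax t0 s)) s).
  { intros z Z HZ Hz s. apply filterlim_locally. intros eps.
    destruct (Hz (Rmax t0 s + 1)) as (C & HC & HzC).
    { assert (P := Rmax_l t0 s). lra. }
    assert (Hk : exists k, C * (/ 2) ^ k < eps / 3).
    { apply NNPP. intros Hn. assert (Hp := cond_pos eps).
      assert (eps / 3 <= 0); [|lra]. apply (nonpos_of_geometric _ C). intros k.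
      apply Rnot_lt_le. intros Hlt. apply Hn. exists k. exact Hlt. }
    destruct Hk as [k Hk].
    assert (He3 : 0 < eps / 3) by (assert (Hp := cond_pos eps); lra).
    destruct (proj1 (filterlim_locally _ _) (Hcomp (Z k) s (HZ k _)) (mkposreal _ He3)) as [d Hd].
    assert (Hd1 : 0 < Rmin d 1) by (apply Rmin_glb_lt; [apply cond_pos | lra]).
    exists (mkposreal _ Hd1). intros s' Hs'. change (Rabs (s' - s) < Rmin d 1) in Hs'.
    assert (Hm1 := Rmin_l d 1). assert (Hm2 := Rmin_r d 1).
    specialize (Hd s' ltac:(change (Rabs (s' - s) < d); lra)).
    change (Rabs (Z k (Rmax t0 s') - Z k (Rmax t0 s)) < eps / 3) in Hd.
    change (Rabs (z (Rmax t0 s') - z (Rmax t0 s)) < eps).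
    assert (Hms : Rmax t0 s' <= Rmax t0 s + 1).
    { apply Rabs_def2 in Hs'. apply Rmax_lub; [|].
      - assert (P := Rmax_l t0 s). lra.
      - assert (P := Rmax_r t0 s). lra. }
    assert (A1 := HzC k (Rmax t0 s') ltac:(split; [apply Rmax_l | exact Hms])).
    assert (A2 := HzC k (Rmax t0 s) ltac:(split; [apply Rmax_l | lra])).
    apply Rabs_le_between in A1. apply Rabs_le_between in A2. apply Rabs_def2 in Hd.
    apply Rabs_def1; lra. }
  assert (Hx : forall s, continuous (fun s => x (Rmax t0 s)) s).
  { apply (Hcont x X); [apply HXY|]. intros T HT. destruct (Hunif T HT) as (C & HC & H).
    exists C. split; [exact HC|]. intros; apply H; assumption. }
  assert (Hy : forall s, continuous (fun s => y (Rmax t0 s)) s).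
  { apply (Hcont y Y); [apply HXY|]. intros T HT. destruct (Hunif T HT) as (C & HC & H).
    exists C. split; [exact HC|]. intros; apply H; assumption. }
  assert (Hfix : forall (p : R -> R -> R -> R) c z (Z : nat -> R -> R),
     (forall x y t, t0 <= t -> cont3 p x y t) ->
     (forall i s, continuous (rhs p t0 (X i) (Y i)) s) ->
     (forall T, exists L, 0 <= L /\ forall x y x' y' t, t0 <= t <= T ->
        Rabs (p x y t - p x' y' t) <= L * (Rabs (x - x') + Rabs (y - y'))) ->
     (forall k, Z (S k) = integral_curve p t0 c (X k) (Y k)) ->
     (forall T, t0 <= T -> exists C, 0 <= C /\ forall k t, t0 <= t <= T -> Rabs (z t - Z k t) <= C * (/ 2) ^ k) ->
     forall t, t0 <= t -> z t = integral_curve p t0 c x y t).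
  { intros p c z Z Hp Hpc HLp EZ Hz t Ht.
    destruct (HLp t) as (L & HL0 & HLip). destruct (Hz t Ht) as (C1 & HC1 & HzC).
    destruct (Hunif t Ht) as (C & HC & HU).
    assert (Hle : Rabs (z t - integral_curve p t0 c x y t) <= 0).
    { apply (nonpos_of_geometric _ (C1 + L * (2 * C) * (t - t0))). intros k.
      assert (Hpow : 0 < (/ 2) ^ k) by (apply pow_lt; lra).
      assert (E := dominated_increment
        (fun s => integral_curve p t0 c (X k) (Y k) s - integral_curve p t0 c x y s)
        (fun s => rhs p t0 (X k) (Y k) s - rhs p t0 x y s)
        (fun s => L * (2 * C) * (/ 2) ^ k * s) (fun _ => L * (2 * C) * (/ 2) ^ k) t0 t Ht).
      cbv beta in E. rewrite !integral_curve_start in E.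
      replace (c - c) with 0 in E by ring. rewrite Rminus_0_r in E.
      specialize (HzC (S k) t ltac:(lra)). rewrite EZ in HzC. simpl pow in HzC.
      replace (z t - integral_curve p t0 c x y t)
        with ((z t - integral_curve p t0 c (X k) (Y k) t)
              + (integral_curve p t0 c (X k) (Y k) t - integral_curve p t0 c x y t)) by ring.
      eapply Rle_trans; [apply Rabs_triang|].
      assert (E' : Rabs (integral_curve p t0 c (X k) (Y k) t - integral_curve p t0 c x y t)
        <= L * (2 * C) * (/ 2) ^ k * t - L * (2 * C) * (/ 2) ^ k * t0).
      { apply E.
        - intros s _. apply (is_derive_minus (integral_curve p t0 c (X k) (Y k)));
            apply is_derive_integral_curve; [apply Hpc | intros; apply continuous_rhs; auto].
        - intros s _. auto_derive; [exact I | ring].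
        - intros s Hs. unfold rhs. rewrite !Rmax_right by lra.
          eapply Rle_trans; [apply HLip; lra|]. rewrite Rmult_assoc, Rmult_assoc.
          apply Rmult_le_compat_l; [exact HL0|].
          destruct (HU k s ltac:(lra)) as [U1 U2].
          rewrite (Rabs_minus_sym (X k s)), (Rabs_minus_sym (Y k s)). lra. }
      assert (0 <= C1 * (/ 2) ^ k) by (apply Rmult_le_pos; lra).
      lra. }
    assert (P := Rabs_pos (z t - integral_curve p t0 c x y t)).
    apply Rminus_diag_uniq. apply Rabs_eq_0. lra. }
  assert (Fx : forall t, t0 <= t -> x t = integral_curve f t0 a x y t).
  { apply (Hfix f a x X Hf Hfc); [|exact EX|].
    - intros T. destruct (HL T) as (L & H1 & H2). exists L. split; [exact H1|]. intros; apply H2; assumption.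
    - intros T HT. destruct (Hunif T HT) as (C & HC & H). exists C. split; [exact HC|]. intros; apply H; assumption. }
  assert (Fy : forall t, t0 <= t -> y t = integral_curve g t0 b x y t).
  { apply (Hfix g b y Y Hg Hgc); [|exact EY|].
    - intros T. destruct (HL T) as (L & H1 & H2). exists L. split; [exact H1|]. intros; apply H2; assumption.
    - intros T HT. destruct (Hunif T HT) as (C & HC & H). exists C. split; [exact HC|]. intros; apply H; assumption. }
  exists (integral_curve f t0 a x y), (integral_curve g t0 b x y).
  split; [apply integral_curve_start|]. split; [apply integral_curve_start|].
  intros t Ht. rewrite <- Fx, <- Fy by exact Ht.
  assert (Ef : rhs f t0 x y t = f (x t) (y t) t) by (unfold rhs; rewrite Rmax_right by exact Ht; reflexivity).
  assert (Eg : rhs g t0 x y t = g (x t) (y t) t) by (unfold rhs; rewrite Rmax_right by exact Ht; reflexivity).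
  rewrite <- Ef, <- Eg.
  split; apply is_derive_integral_curve; intros; apply continuous_rhs; auto.
Qed.

(** * Trajectories near a given solution *)

Lemma is_derive_sqdist (u v : R -> R) t du dv : is_derive u t du -> is_derive v t dv ->
  is_derive (fun t => u t ^ 2 + v t ^ 2) t (2 * u t * du + 2 * v t * dv).
Proof.
  intros H1 H2.
  assert (E1 : Derive (fun t => u t) t = du) by exact (is_derive_unique _ _ _ H1).
  assert (E2 : Derive (fun t => v t) t = dv) by exact (is_derive_unique _ _ _ H2).
  auto_derive; [repeat split; eexists; eassumption|].
  rewrite E1, E2. ring.
Qed.

(** Gronwall's inequality applies as long as the trajectory stays within distance 1
    of the solution, and its conclusion shows that it does. *)
Lemma close_on_compact f fx fy ft g gx gy gt t0 T B (xs ys : R -> R) :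
  C1field f fx fy ft -> C1field g gx gy gt -> 0 < t0 <= T ->
  (forall t, t0 <= t -> Rabs (xs t) <= B /\ Rabs (ys t) <= B) ->
  (forall t, t0 <= t -> is_derive xs t (f (xs t) (ys t) t) /\ is_derive ys t (g (xs t) (ys t) t)) ->
  forall d, 0 < d -> exists delta, 0 < delta /\ forall x y : R -> R,
    (forall t, t0 <= t -> continuous x t /\ continuous y t) ->
    (forall t, t0 <= t -> Rabs (x t - xs t) <= 1 -> Rabs (y t - ys t) <= 1 ->
       is_derive x t (f (x t) (y t) t) /\ is_derive y t (g (x t) (y t) t)) ->
    Rabs (x t0 - xs t0) < delta -> Rabs (y t0 - ys t0) < delta ->
    forall t, t0 <= t <= T -> Rabs (x t - xs t) < d /\ Rabs (y t - ys t) < d.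
Proof.
  intros Hf Hg HT HB Hsol d0 Hd0.
  destruct (lipschitz_on_box f _ _ _ (B + 1) t0 T Hf ltac:(lra)) as (L1 & HL1 & Lf).
  destruct (lipschitz_on_box g _ _ _ (B + 1) t0 T Hg ltac:(lra)) as (L2 & HL2 & Lg).
  pose (L := L1 + L2).
  pose (d := Rmin d0 1). assert (Hd : 0 < d) by (apply Rmin_glb_lt; lra).
  assert (Hdl := Rmin_l d0 1 : d <= d0). assert (Hdr := Rmin_r d0 1 : d <= 1).
  pose (E := exp (4 * L * (T - t0))).
  assert (HE : 1 <= E).
  { unfold E. eapply Rle_trans; [|apply exp_ineq1_le].
    assert (0 <= L * (T - t0)) by (apply Rmult_le_pos; unfold L; lra). lra. }
  exists (d / (2 * E)).
  assert (Hdel : 0 < d / (2 * E)) by (apply Rdiv_lt_0_compat; lra).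
  split; [exact Hdel|].
  intros x y Hc Hxy Hx0 Hy0.
  pose (r := fun t => (x t - xs t) ^ 2 + (y t - ys t) ^ 2).
  assert (Hrd : forall t, r t <= d ^ 2 -> Rabs (x t - xs t) <= 1 /\ Rabs (y t - ys t) <= 1).
  { intros t Hr. unfold r in Hr.
    assert (P1 := pow2_ge_0 (x t - xs t)). assert (P2 := pow2_ge_0 (y t - ys t)).
    split; apply Rabs_le_between; split; nra. }
  assert (Hr0 : r t0 * E < d ^ 2).
  { assert (E0 : d / (2 * E) * (2 * E) = d) by (field; lra).
    set (z := d / (2 * E)) in *.
    assert (Hrz : r t0 <= 2 * z ^ 2).
    { unfold r. rewrite <- (pow2_abs (x t0 - xs t0)), <- (pow2_abs (y t0 - ys t0)).
      assert (Q1 := Rabs_pos (x t0 - xs t0)). assert (Q2 := Rabs_pos (y t0 - ys t0)). nra. }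
    apply Rle_lt_trans with (2 * z ^ 2 * E); [apply Rmult_le_compat_r; lra|].
    rewrite <- E0. replace ((z * (2 * E)) ^ 2) with (2 * z ^ 2 * E * (2 * E)) by ring.
    assert (0 < 2 * z ^ 2 * E) by (apply Rmult_lt_0_compat; nra). nra. }
  assert (Hr0' : 0 <= r t0).
  { unfold r. assert (P1 := pow2_ge_0 (x t0 - xs t0)). assert (P2 := pow2_ge_0 (y t0 - ys t0)). lra. }
  assert (Hall : forall t, t0 <= t <= T -> r t < d ^ 2).
  { intros t Ht. apply (first_crossing r t0 t (d ^ 2)); [lra | | nra |].
    - intros s Hs. destruct (Hc s ltac:(lra)) as [Cx Cy]. destruct (Hsol s ltac:(lra)) as [Dxs Dys].
      assert (Csq : forall h : R -> R, continuous h s -> continuous (fun t => h t ^ 2) s).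
      { intros h Hh. apply (continuous_comp h (fun z => z ^ 2)); [exact Hh|].
        apply (ex_derive_continuous (fun z => z ^ 2)). auto_derive. exact I. }
      apply (continuous_plus (V := R_NormedModule)); apply Csq;
        apply (continuous_minus (V := R_NormedModule)); try assumption.
      + apply (ex_derive_continuous xs). eexists; exact Dxs.
      + apply (ex_derive_continuous ys). eexists; exact Dys.
    - intros s Hs Hbefore.
      pose (du := fun u => f (x u) (y u) u - f (xs u) (ys u) u).
      pose (dv := fun u => g (x u) (y u) u - g (xs u) (ys u) u).
      assert (Hg' : r s <= r t0 * exp (4 * L * (s - t0))).
      { apply (gronwall r (fun u => 2 * (x u - xs u) * du u + 2 * (y u - ys u) * dv u)); [lra | |].
        - intros u Hu. destruct (Hrd u (Hbefore u Hu)) as [N1 N2].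
          destruct (Hxy u ltac:(lra) N1 N2) as [Dx Dy]. destruct (Hsol u ltac:(lra)) as [Dxs Dys].
          apply (is_derive_sqdist (fun u => x u - xs u) (fun u => y u - ys u)).
          + exact (is_derive_minus x xs u _ _ Dx Dxs).
          + exact (is_derive_minus y ys u _ _ Dy Dys).
        - intros u Hu. destruct (Hrd u (Hbefore u Hu)) as [N1 N2].
          destruct (HB u ltac:(lra)) as [Bx By].
          assert (Bx' : Rabs (x u) <= B + 1).
          { replace (x u) with (xs u + (x u - xs u)) by ring. apply Rabs_plus_le; assumption. }
          assert (By' : Rabs (y u) <= B + 1).
          { replace (y u) with (ys u + (y u - ys u)) by ring. apply Rabs_plus_le; assumption. }
          specialize (Lf (x u) (y u) u (xs u) (ys u) u Bx' By' ltac:(lra) ltac:(lra) ltac:(lra) ltac:(lra)).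
          specialize (Lg (x u) (y u) u (xs u) (ys u) u Bx' By' ltac:(lra) ltac:(lra) ltac:(lra) ltac:(lra)).
          rewrite Rminus_diag, Rabs_R0, Rplus_0_r in Lf, Lg.
          fold (du u) in Lf. fold (dv u) in Lg. unfold r.
          set (p := x u - xs u) in *. set (s' := y u - ys u) in *.
          rewrite <- (pow2_abs p), <- (pow2_abs s').
          assert (Q1 := Rabs_pos p). assert (Q2 := Rabs_pos s').
          set (P := Rabs p) in *. set (S := Rabs s') in *.
          assert (A1 : p * du u <= P * (L1 * (P + S))).
          { eapply Rle_trans; [apply Rle_abs|]. apply Rabs_mult_le; [apply Rle_refl | exact Lf]. }
          assert (A2 : s' * dv u <= S * (L2 * (P + S))).
          { eapply Rle_trans; [apply Rle_abs|]. apply Rabs_mult_le; [apply Rle_refl | exact Lg]. }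
          unfold L.
          assert (0 <= (P - S) ^ 2) by apply pow2_ge_0.
          assert (A3 : P * (P + S) <= 2 * (P ^ 2 + S ^ 2)) by nra.
          assert (A4 : S * (P + S) <= 2 * (P ^ 2 + S ^ 2)) by nra.
          assert (L1 * (P * (P + S)) <= L1 * (2 * (P ^ 2 + S ^ 2))) by (apply Rmult_le_compat_l; lra).
          assert (L2 * (S * (P + S)) <= L2 * (2 * (P ^ 2 + S ^ 2))) by (apply Rmult_le_compat_l; lra).
          lra. }
      eapply Rle_lt_trans; [exact Hg'|]. eapply Rle_lt_trans; [|exact Hr0].
      apply Rmult_le_compat_l; [exact Hr0'|]. unfold E.
      assert (Hle : 4 * L * (s - t0) <= 4 * L * (T - t0)).
      { apply Rmult_le_compat_l; [unfold L|]; lra. }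
      destruct Hle as [Hlt|Heq]; [left; apply exp_increasing, Hlt | rewrite Heq; right; reflexivity]. }
  intros t Ht. specialize (Hall t Ht). unfold r in Hall.
  assert (P1 := pow2_ge_0 (x t - xs t)). assert (P2 := pow2_ge_0 (y t - ys t)).
  split; (eapply Rlt_le_trans; [|exact Hdl]); apply Rabs_def1; nra.
Qed.

Definition clamp (M z : R) : R := Rmax (- M) (- Rmax (- M) (- z)).

Lemma clamp_bound M z : 0 <= M -> Rabs (clamp M z) <= M.
Proof.
  intros HM. unfold clamp. apply Rabs_le_between. split; [apply Rmax_l|].
  apply Rmax_lub; [lra|]. assert (H := Rmax_l (- M) (- z)). lra.
Qed.

Lemma clamp_inside M z : Rabs z <= M -> clamp M z = z.
Proof.
  intros Hz. apply Rabs_le_between in Hz. unfold clamp.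
  rewrite (Rmax_right (- M) (- z)) by lra. rewrite Rmax_right by lra. ring.
Qed.

Lemma clamp_lipschitz M z z' : Rabs (clamp M z - clamp M z') <= Rabs (z - z').
Proof.
  assert (H : forall p q, Rabs (Rmax (- M) p - Rmax (- M) q) <= Rabs (p - q)).
  { intros p q. assert (P := Rabs_pos (p - q)).
    assert (P1 := Rle_abs (p - q)). assert (P2 := Rle_abs (- (p - q))). rewrite Rabs_Ropp in P2.
    unfold Rmax. destruct Rle_dec, Rle_dec; apply Rabs_le_between; lra. }
  unfold clamp. eapply Rle_trans; [apply H|].
  replace (- Rmax (- M) (- z) - - Rmax (- M) (- z'))
    with (- (Rmax (- M) (- z) - Rmax (- M) (- z'))) by ring.
  rewrite Rabs_Ropp. eapply Rle_trans; [apply H|].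
  replace (- z - - z') with (- (z - z')) by ring. rewrite Rabs_Ropp. apply Rle_refl.
Qed.

Lemma continuous_clamp M z : continuous (clamp M) z.
Proof.
  unfold clamp.
  apply (continuous_comp (fun z => - Rmax (- M) (- z)) (Rmax (- M))); [|apply continuous_Rmax].
  apply (continuous_opp (V := R_NormedModule)).
  apply (continuous_comp (fun z => - z) (Rmax (- M))); [|apply continuous_Rmax].
  apply (continuous_opp (V := R_NormedModule)), continuous_id.
Qed.

Lemma cont3_clamp f M x y t : cont3 f (clamp M x) (clamp M y) t ->
  cont3 (fun x y t => f (clamp M x) (clamp M y) t) x y t.
Proof.
  intros H. apply (cont3_comp f (fun p : R * R * R => clamp M (fst (fst p)))
                     (fun p => clamp M (snd (fst p))) snd).
  - apply (continuous_comp (fun p : R * R * R => fst (fst p)) (clamp M));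
      [apply cont3_fst | apply continuous_clamp].
  - apply (continuous_comp (fun p : R * R * R => snd (fst p)) (clamp M));
      [apply cont3_snd | apply continuous_clamp].
  - apply (continuous_snd (x, y) t).
  - exact H.
Qed.

(** Outside a square the field is replaced by its values on the boundary, which
    makes it Lipschitz; inside nothing changes. *)
Lemma clamped_solution f fx fy ft g gx gy gt (M t0 a b : R) :
  C1field f fx fy ft -> C1field g gx gy gt -> 0 < t0 -> 0 <= M ->
  exists x y : R -> R, x t0 = a /\ y t0 = b /\
    (forall t, t0 <= t -> continuous x t /\ continuous y t) /\
    forall t, t0 <= t -> Rabs (x t) <= M -> Rabs (y t) <= M ->
      is_derive x t (f (x t) (y t) t) /\ is_derive y t (g (x t) (y t) t).
Proof.
  intros Hf Hg Ht0 HM.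
  assert (HLip : forall h hx hy ht T, C1field h hx hy ht -> exists L, 0 <= L /\
    forall x y x' y' t, t0 <= t <= T ->
    Rabs (h (clamp M x) (clamp M y) t - h (clamp M x') (clamp M y') t)
      <= L * (Rabs (x - x') + Rabs (y - y'))).
  { intros h hx hy ht T Hh.
    destruct (lipschitz_on_box h _ _ _ M t0 T Hh Ht0) as (L & HL & H).
    exists L. split; [exact HL|]. intros x y x' y' t Ht.
    eapply Rle_trans; [apply H; auto using clamp_bound|].
    apply Rmult_le_compat_l; [exact HL|].
    rewrite Rminus_diag, Rabs_R0, Rplus_0_r.
    apply Rplus_le_compat; apply clamp_lipschitz. }
  destruct (global_solution (fun x y t => f (clamp M x) (clamp M y) t)
    (fun x y t => g (clamp M x) (clamp M y) t) t0 a b) as (x & y & Ea & Eb & H).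
  - intros x y t Ht. apply cont3_clamp, (C1_c _ _ _ _ Hf). lra.
  - intros x y t Ht. apply cont3_clamp, (C1_c _ _ _ _ Hg). lra.
  - intros T. destruct (HLip f _ _ _ T Hf) as (L1 & HL1 & H1).
    destruct (HLip g _ _ _ T Hg) as (L2 & HL2 & H2).
    exists (L1 + L2). split; [lra|]. intros x y x' y' t Ht.
    specialize (H1 x y x' y' t Ht). specialize (H2 x y x' y' t Ht).
    assert (P1 := Rabs_pos (x - x')). assert (P2 := Rabs_pos (y - y')).
    split; nra.
  - exists x, y. split; [exact Ea|]. split; [exact Eb|]. split.
    + intros t Ht. destruct (H t Ht) as [Dx Dy].
      split; [apply (ex_derive_continuous x); eexists; exact Dx
             | apply (ex_derive_continuous y); eexists; exact Dy].
    + intros t Ht Hx Hy. destruct (H t Ht) as [Dx Dy].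
      rewrite !clamp_inside in Dx, Dy by assumption. split; assumption.
Qed.

(** * Stability and instability of the asymptotic solution *)

Theorem theorem11
  (H : R -> R -> R -> R) (V : R -> R -> R) (w : R -> R) (d0 : R)
  (F G : R -> R -> R -> R) (Fk Gk : nat -> R -> R -> R)
  (q n : nat) (lam Delta nu_plus beta t0 : R)
  (xs ys : R -> R) (xk yk : nat -> R)
  (H_smooth : smooth3_on (fun _ _ _ => True) H)
  (F_smooth : smooth3_on (fun _ _ t => 0 < t) F)
  (G_smooth : smooth3_on (fun _ _ t => 0 < t) G)
  (H_def : forall x y l, H x y l = y ^ 2 / 2 + V x l)
  (V_deriv : forall x l, is_derive (fun u => V u l) x ((x ^ 2 - l) * w x))
  (d0_pos : 0 < d0)
  (w_pos : forall x l,
     (0 <= l /\ Rabs x < sqrt l + d0) \/ (l < 0 /\ Rabs x < d0) -> 0 < w x)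
  (F_vanish : vanishes_at_infinity F)
  (G_vanish : vanishes_at_infinity G)
  (q_pos : (1 <= q)%nat)
  (Fk_smooth : forall k, (1 <= k)%nat -> smooth2 (Fk k))
  (Gk_smooth : forall k, (1 <= k)%nat -> smooth2 (Gk k))
  (F_asymp : power_asymptotics q F Fk)
  (G_asymp : power_asymptotics q G Gk)
  (lam_eq : lam = 0)
  (n_ge1 : (1 <= n)%nat) (n_leq : (n <= q)%nat)
  (Fk_zero : forall i, (1 <= i)%nat -> (i < n)%nat -> forall x y, Fk i x y = 0)
  (Gk_zero : forall i, (1 <= i)%nat -> (i < n)%nat -> forall x y, Gk i x y = 0)
  (Gk_origin : forall l, (l < n)%nat -> Gk (n + l)%nat 0 0 = 0)
  (nondeg : Gk (2 * n)%nat 0 0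
            - Fk n 0 0 * (Derive (fun y => Gk n 0 y) 0 + kron n q) <> 0)
  (Delta_def : Delta =
     (Derive (fun x => Gk n x 0) 0) ^ 2
     - 4 * w 0 * ((Derive (fun y => Gk n 0 y) 0 + kron n q) * Fk n 0 0
                  - Gk (2 * n)%nat 0 0))
  (Delta_pos : 0 < Delta)
  (nu_plus_def : nu_plus =
     1 / (2 * w 0) * (Derive (fun x => Gk n x 0) 0 + sqrt Delta))
  (beta_def : beta =
     Derive (fun x => Fk n x 0) 0 + Derive (fun y => Gk n 0 y) 0
     + 5 / 2 * kron n q)
  (t0_pos : 0 < t0)
  (sol : is_solution H F G lam t0 xs ys)
  (xs_asymp : asymp_series q n xs xk)
  (ys_asymp : asymp_series q n ys yk)
  (xn_eq : xk n = nu_plus) :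
  (beta < 0 -> lyapunov_stable H F G lam t0 xs ys) /\
  (3 * kron n q < beta -> ~ lyapunov_stable H F G lam t0 xs ys).
Proof.
  subst lam.
  assert (Hw0 : 0 < w 0).
  { apply (w_pos 0 0). left. rewrite sqrt_0, Rabs_R0. lra. }
  destruct (weight_C1 H V w H_def V_deriv H_smooth) as (dw & Hw & Hdw).
  assert (HF := smooth3_C1field F F_smooth). assert (HG := smooth3_C1field G G_smooth).
  pose (f := fun x y t => y + F x y t).
  pose (g := fun x y t => - (x ^ 2 * w x) + G x y t).
  assert (Hsol : forall x y, is_solution H F G 0 t0 x y <->
    forall t, t0 <= t -> is_derive x t (f (x t) (y t) t) /\ is_derive y t (g (x t) (y t) t)).
  { assert (E1 : forall x y, d2 H x y 0 = y) by (intros; apply (hamiltonian_dy H V), H_def).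
    assert (E2 : forall x y, d1 H x y 0 = x ^ 2 * w x).
    { intros. rewrite (hamiltonian_dx H V w) by assumption. ring. }
    intros x y. unfold is_solution, f, g.
    split; intros Hxy t Ht; specialize (Hxy t Ht); rewrite ?E1, ?E2 in *; exact Hxy. }
  assert (Hf : C1field f (d1 F) (fun x y t => 1 + d2 F x y t) (d3 F)) by exact (C1field_add_y F _ _ _ HF).
  assert (Hg : C1field g (fun x y t => - (2 * x * w x + x ^ 2 * dw x) + d1 G x y t) (d2 G) (d3 G)).
  { apply (C1field_add_x (fun x => - (x ^ 2 * w x)) (fun x => - (2 * x * w x + x ^ 2 * dw x)));
      [| |exact HG].
    - intros x. auto_derive; [eexists; apply Hw|].
      replace (Derive _ x) with (dw x) by (symmetry; exact (is_derive_unique _ _ _ (Hw x))). ring.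
    - intros x. apply (continuous_opp (V := R_NormedModule)), (continuous_plus (V := R_NormedModule));
        apply (continuous_mult (K := R_AbsRing)).
      + apply (ex_derive_continuous (fun x => 2 * x)). auto_derive. exact I.
      + apply (ex_derive_continuous w). eexists; apply Hw.
      + apply (ex_derive_continuous (fun x => x ^ 2)). auto_derive. exact I.
      + apply Hdw. }
  set (A := Derive (fun x => Fk n x 0) 0) in *.
  set (D := Derive (fun y => Gk n 0 y) 0) in *.
  assert (Hz : forall (fk : nat -> R -> R -> R),
    (forall i, (1 <= i)%nat -> (i < n)%nat -> forall x y, fk i x y = 0) ->
    (forall k x y, (1 <= k < n)%nat -> Derive (fun u => fk k u y) x = 0) /\
    (forall k x y, (1 <= k < n)%nat -> Derive (fun u => fk k x u) y = 0)).
  { intros fk Hfk. split; intros k x y Hk; rewrite (Derive_ext _ (fun _ => 0)) by (intros; apply Hfk; lia);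
      apply Derive_const. }
  assert (Hcd : forall k, smooth2 k ->
    continuity_2d_pt (fun x y => Derive (fun u => k u y) x) 0 0 /\
    continuity_2d_pt (fun x y => Derive (fun u => k x u) y) 0 0).
  { intros k Hk. destruct (Hk 1%nat 0 0) as (_ & _ & _ & [H1 _] & [H2 _]). split; assumption. }
  assert (Hlead : forall eta, 0 < eta -> exists r, 0 < r /\ eventually_t (fun t =>
     forall x y, Rabs x <= r -> Rabs y <= r ->
     Rabs (d1 F x y t - tpow q n t * A) <= eta * tpow q n t /\
     Rabs (d2 F x y t - tpow q n t * Derive (fun y => Fk n 0 y) 0) <= eta * tpow q n t /\
     Rabs (d2 G x y t - tpow q n t * D) <= eta * tpow q n t)).
  { intros eta Heta. destruct F_asymp as (_ & F1 & F2). destruct G_asymp as (_ & _ & G2).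
    destruct (leading_term q n _ _ eta q_pos n_ge1 F1 (proj1 (Hz Fk Fk_zero))
      (proj1 (Hcd _ (Fk_smooth n n_ge1))) Heta) as (r1 & Hr1 & B1).
    destruct (leading_term q n _ _ eta q_pos n_ge1 F2 (proj2 (Hz Fk Fk_zero))
      (proj2 (Hcd _ (Fk_smooth n n_ge1))) Heta) as (r2 & Hr2 & B2).
    destruct (leading_term q n _ _ eta q_pos n_ge1 G2 (proj2 (Hz Gk Gk_zero))
      (proj2 (Hcd _ (Gk_smooth n n_ge1))) Heta) as (r3 & Hr3 & B3).
    assert (M1 := Rmin_l r1 (Rmin r2 r3)). assert (M2 := Rmin_r r1 (Rmin r2 r3)).
    assert (M3 := Rmin_l r2 r3). assert (M4 := Rmin_r r2 r3).
    exists (Rmin r1 (Rmin r2 r3)). split; [repeat apply Rmin_glb_lt; assumption|].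
    apply (ev_imp _ _) with (2 := ev_and _ _ B1 (ev_and _ _ B2 B3)).
    intros t (C1 & C2 & C3) x y Hx Hy.
    split; [apply C1; lra | split; [apply C2; lra | apply C3; lra]]. }
  assert (HGx : exists C, 0 <= C /\ eventually_t (fun t => forall x y, Rabs x <= 1 -> Rabs y <= 1 ->
    Rabs (d1 G x y t - sum_n_m (fun k => tpow q k t * Derive (fun x => Gk k x 0) 0) n (2 * n - 1)) <=
    C * (tpow q n t * (Rabs x + Rabs y) + tpow q (2 * n) t))).
  { destruct G_asymp as (_ & G1 & _).
    apply (first_terms q n _ _ q_pos n_ge1 G1 (proj1 (Hz Gk Gk_zero))).
    intros k x y Hk. destruct (Gk_smooth k ltac:(lia) 2%nat x y) as (_ & _ & _ & H1 & _). exact H1. }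
  destruct (asymp_series_bound q n xs xk q_pos xs_asymp) as (Cx & HCx & Bx).
  destruct (asymp_series_bound q n ys yk q_pos ys_asymp) as (Cy & HCy & By).
  assert (Hxs : exists C, 0 <= C /\ eventually_t (fun t =>
     Rabs (xs t) <= C * tpow q n t /\ Rabs (ys t) <= C * tpow q n t /\
     Rabs (xs t - sum_n_m (fun k => tpow q k t * xk k) n (2 * n - 1)) <= C * tpow q (2 * n) t)).
  { destruct (xs_asymp (2 * n - 1)%nat) as [C HC].
    replace (S (2 * n - 1)) with (2 * n)%nat in HC by lia.
    assert (PC := Rabs_pos C). assert (PC' := Rle_abs C).
    exists (Cx + Cy + Rabs C). split; [lra|].
    apply (ev_imp _ _) with (2 := ev_and _ _ Bx (ev_and _ _ By HC)).
    intros t (C1 & C2 & C3). assert (P := tpow_pos q n t). assert (P' := tpow_pos q (2 * n) t).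
    split; [nra|]. split; [nra|]. eapply Rle_trans; [exact C3|].
    apply Rmult_le_compat_r; [left; exact P' | lra]. }
  assert (Hlim : forall eta, 0 < eta -> eventually_t (fun t => Rabs (xs t) <= eta /\ Rabs (ys t) <= eta)).
  { intros eta Heta. destruct Hxs as (C & HC & Hxs).
    assert (Hv := tpow_vanish q n (eta / (C + 1)) q_pos n_ge1 ltac:(apply Rdiv_lt_0_compat; lra)).
    apply (ev_imp _ _) with (2 := ev_and _ _ Hxs Hv). intros t ((C1 & C2 & _) & C3).
    assert (P := tpow_pos q n t).
    assert ((C + 1) * tpow q n t <= eta).
    { apply Rlt_le. replace eta with (eta / (C + 1) * (C + 1)) at 1 by (field; lra).
      rewrite Rmult_comm. apply Rmult_lt_compat_r; lra. }
    lra. }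
  assert (Hs := proj1 (Hsol xs ys) sol).
  assert (Hcont : forall x y, is_solution H F G 0 t0 x y ->
    forall t, t0 <= t -> continuous x t /\ continuous y t).
  { intros x y Hxy t Ht. destruct (proj1 (Hsol x y) Hxy t Ht) as [D1 D2].
    split; [apply (ex_derive_continuous x) | apply (ex_derive_continuous y)]; eexists; eassumption. }
  split.
  - intros Hbeta.
    assert (Hfreq : 0 < 2 * w 0 * xk n - Derive (fun x => Gk n x 0) 0).
    { rewrite xn_eq, nu_plus_def.
      match goal with |- 0 < ?e => replace e with (sqrt Delta) by (field; lra) end.
      apply sqrt_lt_R0, Delta_pos. }
    destruct (stable_tail q n w dw F _ _ _ G _ _ _ A _ D (fun k => Derive (fun x => Gk k x 0) 0) xk xs ys t0
      (conj n_ge1 n_leq) Hw Hdw Hw0 HF HG Hlead HGx Hxs Hfreq ltac:(lra) Hs) as (T & HT & Htail).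
    destruct (bounded_on_halfline xs t0 1) as (B1 & HB1 & Bxs).
    { intros t Ht. apply (Hcont xs ys sol t Ht). }
    { apply (ev_imp _ _) with (2 := Hlim 1 Rlt_0_1). intros t [H1 _]. exact H1. }
    destruct (bounded_on_halfline ys t0 1) as (B2 & HB2 & Bys).
    { intros t Ht. apply (Hcont xs ys sol t Ht). }
    { apply (ev_imp _ _) with (2 := Hlim 1 Rlt_0_1). intros t [_ H1]. exact H1. }
    pose (B := B1 + B2).
    assert (HB : forall t, t0 <= t -> Rabs (xs t) <= B /\ Rabs (ys t) <= B).
    { intros t Ht. specialize (Bxs t Ht). specialize (Bys t Ht). unfold B. lra. }
    (* Stated for functions that obey the equations only near [(xs, ys)], this applies
       to all solutions, and to those of the truncated field, which exist globally. *)
    assert (Hclose : forall eps, 0 < eps -> exists delta, 0 < delta /\ forall x y : R -> R,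
      (forall t, t0 <= t -> continuous x t /\ continuous y t) ->
      (forall t, t0 <= t -> Rabs (x t - xs t) <= 1 -> Rabs (y t - ys t) <= 1 ->
         is_derive x t (f (x t) (y t) t) /\ is_derive y t (g (x t) (y t) t)) ->
      Rabs (x t0 - xs t0) < delta -> Rabs (y t0 - ys t0) < delta ->
      forall t, t0 <= t -> Rabs (x t - xs t) < eps /\ Rabs (y t - ys t) < eps).
    { intros eps Heps. destruct (Htail eps Heps) as (delta & Hdelta & Htl).
      destruct (close_on_compact f _ _ _ g _ _ _ t0 T B xs ys Hf Hg ltac:(lra) HB Hs (Rmin eps delta))
        as (delta' & Hdelta' & Hcl); [apply Rmin_glb_lt; assumption|].
      assert (M1 := Rmin_l eps delta). assert (M2 := Rmin_r eps delta).
      exists delta'. split; [exact Hdelta'|]. intros x y Hc Hxy Hx Hy t Ht.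
      specialize (Hcl x y Hc Hxy Hx Hy).
      destruct (Rle_dec t T) as [HtT|HtT].
      - destruct (Hcl t (conj Ht HtT)). lra.
      - destruct (Hcl T ltac:(lra)). apply Htl; try lra.
        + intros s Hs'. apply Hc. lra.
        + intros s Hs'. apply Hxy. lra. }
    intros eps Heps.
    destruct (Hclose (Rmin eps 1)) as (delta & Hdelta & Hcl); [apply Rmin_glb_lt; lra|].
    assert (M1 := Rmin_l eps 1). assert (M2 := Rmin_r eps 1).
    exists delta. split; [exact Hdelta|]. intros a b Ha Hb. split.
    + destruct (clamped_solution f _ _ _ g _ _ _ (B + 1) t0 a b Hf Hg t0_pos ltac:(unfold B; lra))
        as (x & y & Ea & Eb & Hc & Hxy).
      assert (Hxy' : forall t, t0 <= t -> Rabs (x t - xs t) <= 1 -> Rabs (y t - ys t) <= 1 ->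
         is_derive x t (f (x t) (y t) t) /\ is_derive y t (g (x t) (y t) t)).
      { intros t Ht H1 H2. destruct (HB t Ht) as [Q1 Q2]. apply Hxy; [exact Ht | |].
        - replace (x t) with (xs t + (x t - xs t)) by ring. apply Rabs_plus_le; assumption.
        - replace (y t) with (ys t + (y t - ys t)) by ring. apply Rabs_plus_le; assumption. }
      exists x, y. split; [|split; assumption].
      apply Hsol. intros t Ht.
      destruct (Hcl x y Hc Hxy' ltac:(rewrite Ea; exact Ha) ltac:(rewrite Eb; exact Hb) t Ht).
      apply Hxy'; [exact Ht | lra | lra].
    + intros x y Hxy Ea Eb t Ht.
      destruct (Hcl x y (Hcont x y Hxy) (fun s Hs' _ _ => proj1 (Hsol x y) Hxy s Hs')
        ltac:(rewrite Ea; exact Ha) ltac:(rewrite Eb; exact Hb) t Ht). lra.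
  - intros Hbeta Hstab.
    assert (Htr : 0 < A + D).
    { unfold kron in *. destruct (Nat.eq_dec n q); lra. }
    apply (unstable_of_positive_trace f _ _ _ g _ _ _ q n A D t0 xs ys Hf Hg q_pos
      (conj n_ge1 n_leq) t0_pos Htr).
    + intros eta Heta. destruct (Hlead eta Heta) as (r & Hr & Hev). exists r. split; [exact Hr|].
      apply (ev_imp _ _) with (2 := Hev). intros t Ht x y Hx Hy.
      destruct (Ht x y Hx Hy) as (C1 & _ & C3). split; assumption.
    + apply (Hcont xs ys sol).
    + exact Hlim.
    + intros eps Heps. destruct (Hstab eps Heps) as (delta & Hdelta & Hst).
      exists delta. split; [exact Hdelta|]. intros a b Ha Hb.
      destruct (Hst a b Ha Hb) as [(x & y & Hxy & Ea & Eb) Hnear].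
      exists x, y. split; [exact Ea|]. split; [exact Eb|]. intros t Ht.
      destruct (proj1 (Hsol x y) Hxy t Ht) as [D1 D2].
      destruct (Hnear x y Hxy Ea Eb t Ht) as [N1 N2].
      exact (conj D1 (conj D2 (conj N1 N2))).
Qed.
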